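(* Let $\alpha>0$, $0\le\beta<2$, $C>0$ and $\sigma>0$ be fixed, and set $\sigma_{\rm opt}=\frac{\pi\sqrt{2(2-\beta)}}{\sqrt{\alpha}}$, $\eta=\frac{\sigma_{\rm opt}}{\sigma}$. There exist coefficients $\{\widetilde a_j\}_{j=1}^{N_1}$ and a polynomial $\widetilde P_{N_2}$ of degree $N_2$ with $N_2=\mathcal{O}(\sqrt{N_1})$ such that the rational function $$\widetilde r_N(z)=\sum_{j=1}^{N_1}\frac{\widetilde a_j}{z-p_j}+\widetilde P_{N_2}(z),\qquad N=N_1+N_2,\qquad p_j=-C\exp\left(-\sigma(\sqrt{N_1}-\sqrt{j})\right),\ 1\le j\le N_1,$$ satisfies, as $N\to\infty$, $$|\widetilde r_N(z)-z^\alpha\log z|=\begin{cases}\mathcal{O}\left(\sqrt{N}e^{-\sigma\alpha\sqrt{N}}\right),&\sigma\le\sigma_{\rm opt},\\ \mathcal{O}\left(e^{-\pi\eta\sqrt{2(2-\beta)N\alpha}}\right),&\sigma>\sigma_{\rm opt},\end{cases}$$ uniformly for $z\in S_\beta$. In particular, if $\alpha$ is a positive integer, then $$|\widetilde r_N(z)-z^\alpha\log z|=\begin{cases}\mathcal{O}\left(e^{-\sigma\alpha\sqrt{N}}\right),&\sigma\le\sigma_{\rm opt},\\ \mathcal{O}\left(e^{-\pi\eta\sqrt{2(2-\beta)N\alpha}}\right),&\sigma>\sigma_{\rm opt},\end{cases}$$ uniformly for $z\in S_\beta$.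
   Context: For $\beta\in[0,2)$, $S_\beta=\{z: z=xe^{\pm\frac{\theta\pi}{2}i},\ x\in[0,1],\ \theta\in[0,\beta]\}$. The functions $z^\alpha$ and $\log z$ are the principal branches, and $z^\alpha\log z$ is given the value $0$ at $z=0$. The poles $p_j$, coefficients $\widetilde a_j$ and polynomial $\widetilde P_{N_2}$ depend on $N_1$; $N_2=N_2(N_1)$. ''Uniformly'' means that the implied constants do not depend on $z\in S_\beta$ or $N$. *)

(* Defs.v *)
From Stdlib Require Import Reals.
From Coquelicot Require Import Coquelicot.

Open Scope R_scope.

Definition Cexp (z : C) : C :=
  (exp (Re z) * cos (Im z), exp (Re z) * sin (Im z)).

(* The principal argument, with values in (-PI, PI] for z <> 0
   (Carg 0 is a junk value). *)
Definition Carg (z : C) : R :=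
  if Rle_dec 0 (Im z) then acos (Re z / Cmod z) else - acos (Re z / Cmod z).

Definition Clog (z : C) : C := (ln (Cmod z), Carg z).

(* Principal branch of z^alpha for alpha > 0, so that 0^alpha = 0. *)
Definition Cpowr (z : C) (alpha : R) : C :=
  if Ceq_dec z 0 then RtoC 0 else Cexp (alpha * Clog z)%C.

Definition zalogz (alpha : R) (z : C) : C :=
  if Ceq_dec z 0 then RtoC 0 else (Cpowr z alpha * Clog z)%C.

Definition S_ (beta : R) (z : C) : Prop :=
  exists x theta : R,
    0 <= x <= 1 /\ 0 <= theta <= beta /\
    (z = (x * Cexp ((theta * PI / 2)%R * Ci))%C \/
     z = (x * Cexp (- ((theta * PI / 2)%R * Ci)))%C).

Definition pole (C0 sigma : R) (N1 j : nat) : R :=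
  - C0 * exp (- sigma * (sqrt (INR N1) - sqrt (INR j))).

Definition polynomial_of_degree (n : nat) (P : C -> C) : Prop :=
  exists c : nat -> C,
    c n <> RtoC 0 /\ forall z : C, P z = sum_n (fun k => (c k * z ^ k)%C) n.

(* The sum over 1 <= j <= N1 is empty for N1 = 0. *)
Definition rational_approx (N1 : nat) (p : nat -> R) (a : nat -> C)
    (P : C -> C) (z : C) : C :=
  (sum_n_m (fun j => (a j / (z - p j))%C) 1 N1 + P z)%C.

Definition bigO (u v : nat -> R) : Prop :=
  exists K : R, eventually (fun n => Rabs (u n) <= K * Rabs (v n)).

(* err n z = O(g (N n)) as N n -> infinity, uniformly for z in D: the families
   are indexed by n, but the rate is expressed in terms of N n. *)
Definition uniform_bigO (N : nat -> nat) (D : C -> Prop)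
    (err : nat -> C -> R) (g : R -> R) : Prop :=
  exists (K : R) (M : nat), forall n : nat, (M <= N n)%nat ->
    forall z : C, D z -> Rabs (err n z) <= K * Rabs (g (INR (N n))).

(* Main.v *)
Require Import Defs.
From Stdlib Require Import Reals Lra Lia ZArith IndefiniteDescription.
From Coquelicot Require Import Coquelicot.

(** Why the rates hold. In the coordinate w = log z the function z^alpha log z becomes the entire
    function psi(w) = w e^(alpha w), and Cauchy's formula in a rectangle |Im w| <= pi ([keyhole])
    writes it as an integral over a circle of radius at least 2 minus an integral over the slit,
    of the jump phi(log s) ds / (s + z). In the variable u defined by
    s = C0 exp (- sigma (sqrt N1 - sqrt u)) the opposites of the prescribed poles are the points
    u = j, so that the rectangle rule with step 1 replaces the integral over the slit by a rational
    function with exactly these poles. Three errors arise.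
    
    Truncation. The rule starts near u = 1/2; the rest of the slit, of length about
    C0 exp (- sigma sqrt N1), contributes O(sqrt N1 exp (- sigma alpha sqrt N1)). The factor
    sqrt N1 comes from log s in the jump, and this term carries the factor sin (pi alpha), which
    vanishes when alpha is an integer ([psi_jump], [near_cut_bound]).
    
    Quadrature. By Poisson summation ([abel_sum]) the error of the rule is an integral against the
    sum of exp (2 pi i k u) over k >= 1, plus its conjugate counterpart. It is made small by moving
    the path off the real axis in the coordinate log s, up to the nearest pole of the kernel, where
    log s = log z + i pi and whose height is at least h = (2 - beta) pi / 2. At this height
    |exp (2 pi i u)| = exp (- 4 pi h x / sigma^2) at abscissa x = sigma sqrt u, to be compared with the
    growth e^(alpha x) of the jump. Since 4 pi h / sigma^2 = alpha (sigma_opt / sigma)^2, the left end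
    dominates when sigma <= sigma_opt, and the right end x = sigma sqrt N1 when sigma > sigma_opt:
    these are the two cases of the theorem ([size_rate]). A horizontal path touching the pole would
    lose a factor log N1. The path of [cheight] passes below the pole at a distance inversely
    proportional to its abscissa and then climbs above the height h, and the decay gained by
    climbing keeps the integral bounded ([majorant_bound], [shift_estimate]).
    
    Polynomials. What remains is analytic near the sector: the circle integral, the right end of
    the shifted path, and the nodes between -C0 and the circle, which are not among the prescribed
    poles. All these are approximated geometrically by polynomials, by Taylor expansion of the
    kernel ([taylor_approx]) and, for poles which may lie in the unit disc, by pushing them out along
    the negative axis as in Runge's theorem ([runge_pole]). A degree proportional to sqrt N1 thus
    suffices ([scheme]), and it changes exp (- c sqrt N) only by a constant factor ([sqrt_total]). *)

Open Scope R_scope.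

Ltac ceq := apply injective_projections; simpl; try ring.

Lemma Csub_eq_0 (a b : C) : (a - b = 0)%C -> a = b.
Proof.
  intros E; apply injective_projections.
  - pose proof (f_equal fst E) as H; simpl in H; lra.
  - pose proof (f_equal snd E) as H; simpl in H; lra.
Qed.

(** * Continuity of complex valued functions *)

Ltac cont_der := apply (ex_derive_continuous (K := R_AbsRing) (V := R_NormedModule)).

Ltac cont_real := cont_der; auto_derive; trivial.

(** Componentwise, because integrals are computed componentwise below. *)
Definition ccont {T : UniformSpace} (f : T -> C) (x : T) : Prop :=
  continuous (fun t => Re (f t)) x /\ continuous (fun t => Im (f t)) x.

Lemma ccont_const {T : UniformSpace} (c : C) (x : T) : ccont (fun _ => c) x.
Proof. split; apply continuous_const. Qed.

Lemma ccont_id (x : C) : ccont (fun z : C => z) x.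
Proof.
  destruct x as [a b]; split; [exact (continuous_fst a b)|exact (continuous_snd a b)].
Qed.

Lemma ccont_RtoC {T : UniformSpace} (f : T -> R) (x : T) :
  continuous f x -> ccont (fun t => RtoC (f t)) x.
Proof. intros H; split; [exact H|apply continuous_const]. Qed.

Lemma ccont_plus {T : UniformSpace} (f g : T -> C) (x : T) :
  ccont f x -> ccont g x -> ccont (fun t => (f t + g t)%C) x.
Proof.
  intros [H1 H2] [H3 H4]; split; simpl.
  - apply (continuous_plus (fun t => Re (f t)) (fun t => Re (g t))); assumption.
  - apply (continuous_plus (fun t => Im (f t)) (fun t => Im (g t))); assumption.
Qed.

Lemma ccont_opp {T : UniformSpace} (f : T -> C) (x : T) :
  ccont f x -> ccont (fun t => (- f t)%C) x.
Proof.
  intros [H1 H2]; split; simpl.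
  - apply (continuous_opp (fun t => Re (f t))); assumption.
  - apply (continuous_opp (fun t => Im (f t))); assumption.
Qed.

Lemma ccont_minus {T : UniformSpace} (f g : T -> C) (x : T) :
  ccont f x -> ccont g x -> ccont (fun t => (f t - g t)%C) x.
Proof.
  intros; apply ccont_plus; [|apply ccont_opp]; assumption.
Qed.

Lemma ccont_mult {T : UniformSpace} (f g : T -> C) (x : T) :
  ccont f x -> ccont g x -> ccont (fun t => (f t * g t)%C) x.
Proof.
  intros [H1 H2] [H3 H4]; split; simpl.
  - apply (continuous_minus (fun t => Re (f t) * Re (g t)) (fun t => Im (f t) * Im (g t)));
    apply (continuous_mult (K := R_AbsRing)); assumption.
  - apply (continuous_plus (fun t => Re (f t) * Im (g t)) (fun t => Im (f t) * Re (g t)));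
    apply (continuous_mult (K := R_AbsRing)); assumption.
Qed.

Lemma ccont_pow {T : UniformSpace} (f : T -> C) (n : nat) (x : T) :
  ccont f x -> ccont (fun t => (f t ^ n)%C) x.
Proof.
  intros H; induction n as [|n IH]; simpl.
  - apply ccont_const.
  - apply ccont_mult; assumption.
Qed.

Lemma Cnorm2_neq_0 (z : C) : z <> 0 -> Re z ^ 2 + Im z ^ 2 <> 0.
Proof.
  intros H E; apply H; apply Cmod_eq_0.
  unfold Cmod; unfold Re, Im in E; rewrite E; apply sqrt_0.
Qed.

Lemma continuous_Rdiv {T : UniformSpace} (f g : T -> R) (x : T) :
  continuous f x -> continuous g x -> g x <> 0 -> continuous (fun t => f t / g t) x.
Proof.
  intros Hf Hg H0.
  apply (continuous_mult (K := R_AbsRing) f (fun t => / g t)); [assumption|].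
  apply (continuous_comp g Rinv); [assumption|].
  apply continuous_Rinv; assumption.
Qed.

Lemma ccont_inv {T : UniformSpace} (f : T -> C) (x : T) :
  ccont f x -> f x <> 0 -> ccont (fun t => (/ f t)%C) x.
Proof.
  intros [H1 H2] H0.
  assert (Hd : continuous (fun t => Re (f t) ^ 2 + Im (f t) ^ 2) x).
  { apply (continuous_plus (fun t => Re (f t) ^ 2) (fun t => Im (f t) ^ 2)).
    - apply (continuous_comp (fun t => Re (f t)) (fun y => y ^ 2)); [assumption|].
      cont_real.
    - apply (continuous_comp (fun t => Im (f t)) (fun y => y ^ 2)); [assumption|].
      cont_real. }
  pose proof (Cnorm2_neq_0 _ H0) as Hn.
  split; unfold Cinv; simpl; simpl in Hd.
  - apply continuous_Rdiv; assumption.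
  - apply continuous_Rdiv; try assumption.
    apply (continuous_opp (fun t => Im (f t))); assumption.
Qed.

Lemma ccont_div {T : UniformSpace} (f g : T -> C) (x : T) :
  ccont f x -> ccont g x -> g x <> 0 -> ccont (fun t => (f t / g t)%C) x.
Proof.
  intros; apply ccont_mult; [assumption|apply ccont_inv; assumption].
Qed.

Lemma ccont_comp {T : UniformSpace} (g : T -> C) (f : C -> C) (x : T) :
  ccont g x -> ccont f (g x) -> ccont (fun t => f (g t)) x.
Proof.
  intros [H1 H2] [H3 H4].
  assert (Hg : continuous (T := T) (U := C_UniformSpace) g x).
  { apply (filterlim_ext (fun t => (Re (g t), Im (g t)))).
    - intros t; symmetry; apply surjective_pairing.
    - intros P [eps HP].
      generalize (H1 (ball (Re (g x)) eps) (locally_ball _ eps)).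
      generalize (H2 (ball (Im (g x)) eps) (locally_ball _ eps)).
      unfold filtermap; intros A B.
      generalize (filter_and _ _ A B); apply filter_imp.
      intros t [a b]; apply HP; split; assumption. }
  split.
  - apply (continuous_comp g (fun z => Re (f z))); assumption.
  - apply (continuous_comp g (fun z => Im (f z))); assumption.
Qed.

Lemma ccont_ext_loc {T : UniformSpace} (f g : T -> C) (x : T) :
  locally x (fun t => f t = g t) -> ccont f x -> ccont g x.
Proof.
  intros H [H1 H2]; split.
  - apply (continuous_ext_loc (fun t => Re (g t)) (fun t => Re (f t))); [|assumption].
    revert H; apply filter_imp; intros t E; cbv beta in E |- *; rewrite E; reflexivity.
  - apply (continuous_ext_loc (fun t => Im (g t)) (fun t => Im (f t))); [|assumption].
    revert H; apply filter_imp; intros t E; cbv beta in E |- *; rewrite E; reflexivity.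
Qed.

Lemma ccont_ext {T : UniformSpace} (f g : T -> C) (x : T) :
  (forall t, f t = g t) -> ccont f x -> ccont g x.
Proof. intros H; apply ccont_ext_loc; apply filter_forall; exact H. Qed.

Lemma Im_le_Cmod (z : C) : Rabs (Im z) <= Cmod z.
Proof.
  eapply Rle_trans; [|apply Rmax_Cmod]; apply Rmax_r.
Qed.

(** With [ccont_Cmod], the passage between the product uniform structure and the modulus. *)
Lemma ccont_of_Cmod (f : C -> C) (z : C) :
  (forall eps, 0 < eps -> exists del, 0 < del /\
     forall w, Cmod (w - z) < del -> Cmod (f w - f z) < eps) -> ccont f z.
Proof.
  intros H.
  assert (K : forall eps : posreal, locally z (fun w : C => Cmod (f w - f z) < eps)).
  { intros eps; destruct (H eps (cond_pos eps)) as [d [Hd Hw]].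
    assert (Hd2 : 0 < d / 2) by lra.
    exists (mkposreal _ Hd2); intros w [B1 B2]; apply Hw.
    unfold ball in B1, B2; simpl in B1, B2.
    unfold AbsRing_ball, abs, minus, plus, opp in B1, B2; simpl in B1, B2.
    eapply Rle_lt_trans; [apply Cmod_2Rmax|].
    assert (Hs : sqrt 2 < 2).
    { rewrite <- (sqrt_Rsqr 2) at 2 by lra. apply sqrt_lt_1; unfold Rsqr; lra. }
    assert (Rmax (Rabs (fst (w - z)%C)) (Rabs (snd (w - z)%C)) < d / 2).
    { apply Rmax_lub_lt; simpl; assumption. }
    assert (0 <= Rmax (Rabs (fst (w - z)%C)) (Rabs (snd (w - z)%C))).
    { eapply Rle_trans; [apply Rabs_pos|apply Rmax_l]. }
    pose proof (sqrt_pos 2); nra. }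
  split; intros P [eps HP]; generalize (K eps); unfold filtermap; apply filter_imp; intros w Hw; apply HP;
    unfold ball; simpl; unfold AbsRing_ball, abs, minus, plus, opp; simpl.
  - eapply Rle_lt_trans; [|exact Hw]. apply (re_le_Cmod (f w - f z)).
  - eapply Rle_lt_trans; [|exact Hw]. apply (Im_le_Cmod (f w - f z)).
Qed.

Lemma Cmod_le_abs (z : C) : Cmod z <= Rabs (Re z) + Rabs (Im z).
Proof.
  rewrite (surjective_pairing z) at 1.
  replace (fst z, snd z) with (RtoC (fst z) + Ci * RtoC (snd z))%C by ceq.
  eapply Rle_trans; [apply Cmod_triangle|].
  rewrite Cmod_mult, Cmod_Ci, !Cmod_R; unfold Re, Im; lra.
Qed.

Lemma ccont_Cmod {T : UniformSpace} (f : T -> C) (x : T) :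
  ccont f x -> forall eps, 0 < eps -> locally x (fun t => Cmod (f t - f x) < eps).
Proof.
  intros [H1 H2] eps He.
  assert (He2 : 0 < eps / 2) by lra.
  generalize (H1 _ (locally_ball (Re (f x)) (mkposreal _ He2))).
  generalize (H2 _ (locally_ball (Im (f x)) (mkposreal _ He2))).
  unfold filtermap; intros A B.
  generalize (filter_and _ _ A B); apply filter_imp; clear A B.
  intros t [A B]; unfold ball in A, B; simpl in A, B.
  unfold AbsRing_ball, abs, minus, plus, opp in A, B; simpl in A, B.
  eapply Rle_lt_trans; [apply Cmod_le_abs|]; simpl; unfold Re, Im in *.
  unfold Rminus in *; lra.
Qed.

(** * Complex differentiability *)

(** Caratheodory's form: the difference quotient extends to a function continuous at z. Products and
    compositions then need no estimates. *)
Definition cderiv (f : C -> C) (z l : C) : Prop :=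
  exists k : C -> C, (forall w, f w = f z + (w - z) * k w)%C /\ ccont k z /\ k z = l.

Lemma cderiv_ccont f z l : cderiv f z l -> ccont f z.
Proof.
  intros [k [H1 [H2 H3]]].
  apply (ccont_ext (fun w => f z + (w - z) * k w)%C); [intros; symmetry; apply H1|].
  apply ccont_plus; [apply ccont_const|]; apply ccont_mult; [|assumption].
  apply ccont_minus; [apply ccont_id|apply ccont_const].
Qed.

Lemma cderiv_const c z : cderiv (fun _ => c) z 0.
Proof.
  exists (fun _ => RtoC 0); split; [intros; ring|split; [apply ccont_const|reflexivity]].
Qed.

Lemma cderiv_id z : cderiv (fun w => w) z 1.
Proof.
  exists (fun _ => RtoC 1); split; [intros; ring|split; [apply ccont_const|reflexivity]].
Qed.

Lemma cderiv_plus f g z l m :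
  cderiv f z l -> cderiv g z m -> cderiv (fun w => f w + g w)%C z (l + m).
Proof.
  intros [k [H1 [H2 H3]]] [k' [H1' [H2' H3']]].
  exists (fun w => k w + k' w)%C; split; [|split].
  - intros w; rewrite (H1 w), (H1' w); ring.
  - apply ccont_plus; assumption.
  - rewrite H3, H3'; reflexivity.
Qed.

Lemma cderiv_mult f g z l m :
  cderiv f z l -> cderiv g z m -> cderiv (fun w => f w * g w)%C z (l * g z + f z * m).
Proof.
  intros [k [H1 [H2 H3]]] Hg; pose proof (cderiv_ccont _ _ _ Hg) as Cg.
  destruct Hg as [k' [H1' [H2' H3']]].
  exists (fun w => k w * g w + f z * k' w)%C; split; [|split].
  - intros w; rewrite (H1 w) at 1; rewrite (H1' w); ring.
  - apply ccont_plus; apply ccont_mult; try assumption; apply ccont_const.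
  - rewrite H3, H3'; reflexivity.
Qed.

Lemma cderiv_comp f g z l m :
  cderiv f (g z) l -> cderiv g z m -> cderiv (fun w => f (g w)) z (l * m).
Proof.
  intros [k [H1 [H2 H3]]] Hg; pose proof (cderiv_ccont _ _ _ Hg) as Cg.
  destruct Hg as [k' [H1' [H2' H3']]].
  exists (fun w => k (g w) * k' w)%C; split; [|split].
  - intros w; rewrite (H1 (g w)) at 1; rewrite (H1' w) at 1; ring.
  - apply ccont_mult; [apply ccont_comp|]; assumption.
  - rewrite H3, H3'; reflexivity.
Qed.

Lemma locally_C_neq (z c : C) : z <> c -> locally z (fun w : C => w <> c).
Proof.
  intros H.
  assert (Hp : 0 < Cmod (z - c)).
  { apply Cmod_gt_0; intros E; apply H, Csub_eq_0, E. }
  generalize (ccont_Cmod (fun w : C => w) z (ccont_id z) _ Hp); apply filter_imp.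
  intros w Hw E; subst w.
  replace (c - z)%C with (- (z - c))%C in Hw by ring; rewrite Cmod_opp in Hw; lra.
Qed.

Lemma cderiv_inv (z : C) : z <> 0 -> cderiv Cinv z (- / (z * z)).
Proof.
  intros Hz.
  exists (fun w => if Ceq_dec w 0 then (/ w - / z) / (w - z) else - / (w * z))%C; split; [|split].
  - intros w; destruct (Ceq_dec w 0) as [->|Hw].
    + assert (0 - z <> 0)%C.
      { intros E; apply Hz; symmetry; apply Csub_eq_0; exact E. }
      replace ((0 - z) * ((/ 0 - / z) / (0 - z)))%C with (/0 - /z)%C.
      * ring.
      * unfold Cdiv; rewrite (Cmult_comm (/ 0 - / z)), Cmult_assoc, Cinv_r by assumption. ring.
    + field; split; assumption.
  - apply (ccont_ext_loc (fun w => - / (w * z))%C).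
    + generalize (locally_C_neq z 0 Hz); apply filter_imp.
      intros w Hw; destruct (Ceq_dec w 0); [contradiction|reflexivity].
    + apply ccont_opp, ccont_inv.
      * apply ccont_mult; [apply ccont_id|apply ccont_const].
      * apply Cmult_neq_0; assumption.
  - destruct (Ceq_dec z 0); [contradiction|reflexivity].
Qed.

(** * The complex exponential *)

Lemma Cexp_plus a b : Cexp (a + b) = (Cexp a * Cexp b)%C.
Proof.
  unfold Cexp; ceq; rewrite exp_plus, ?cos_plus, ?sin_plus; unfold Re, Im; ring.
Qed.

Lemma Cexp_0 : Cexp 0 = 1.
Proof. unfold Cexp; ceq; rewrite exp_0, ?cos_0, ?sin_0; ring. Qed.

Lemma Cmod_Cexp z : Cmod (Cexp z) = exp (Re z).
Proof.
  unfold Cexp, Cmod; simpl.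
  pose proof (sin2_cos2 (Im z)) as H; unfold Rsqr in H.
  match goal with |- sqrt ?e = _ => replace e with (exp (Re z) * exp (Re z)) end.
  - apply sqrt_square; left; apply exp_pos.
  - transitivity (exp (Re z) * exp (Re z) *
      (cos (Im z) * cos (Im z) + sin (Im z) * sin (Im z))); [|ring].
    replace (cos (Im z) * cos (Im z) + sin (Im z) * sin (Im z)) with 1
      by (pose proof (sin2_cos2 (Im z)) as H'; unfold Rsqr in H'; lra); ring.
Qed.

Lemma Cexp_neq_0 (z : C) : Cexp z <> 0.
Proof.
  intros E; apply (f_equal Cmod) in E; rewrite Cmod_Cexp, Cmod_0 in E.
  pose proof (exp_pos (Re z)); lra.
Qed.

Lemma Cexp_opp z : Cexp (- z) = (/ Cexp z)%C.
Proof.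
  pose proof (Cexp_neq_0 z) as H.
  assert (E : (Cexp (- z) * Cexp z = 1)%C).
  { rewrite <- Cexp_plus; replace (- z + z)%C with (RtoC 0) by ring; apply Cexp_0. }
  rewrite <- (Cmult_1_r (Cexp (- z))), <- (Cinv_r (Cexp z)) by assumption.
  rewrite Cmult_assoc, E; ring.
Qed.

Lemma Cexp_RtoC x : Cexp (RtoC x) = RtoC (exp x).
Proof. unfold Cexp; ceq; rewrite ?cos_0, ?sin_0; ring. Qed.

Lemma Cexp_ccont z : ccont Cexp z.
Proof.
  unfold Cexp; split; simpl; apply (continuous_mult (K := R_AbsRing)).
  - apply (continuous_comp (fun z : C => Re z) exp); [apply ccont_id|].
    cont_real.
  - apply (continuous_comp (fun z : C => Im z) cos); [apply ccont_id|].
    cont_real.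
  - apply (continuous_comp (fun z : C => Re z) exp); [apply ccont_id|].
    cont_real.
  - apply (continuous_comp (fun z : C => Im z) sin); [apply ccont_id|].
    cont_real.
Qed.

Lemma deriv_0_bound (f : R -> R) (l : R) : is_derive f 0 l ->
  forall eps, 0 < eps -> exists del, 0 < del /\
    forall x, Rabs x < del -> Rabs (f x - f 0 - l * x) <= eps * Rabs x.
Proof.
  intros H eps He.
  apply is_derive_Reals in H.
  destruct (H eps He) as [d Hd]; exists d; split; [apply cond_pos|].
  intros x Hx; destruct (Req_dec x 0) as [->|Hx0].
  - replace (f 0 - f 0 - l * 0) with 0 by ring. rewrite Rabs_R0; lra.
  - specialize (Hd x Hx0 Hx); rewrite Rplus_0_l in Hd.
    replace (f x - f 0 - l * x) with (((f x - f 0) / x - l) * x) by (field; assumption).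
    rewrite Rabs_mult; apply Rmult_le_compat_r; [apply Rabs_pos|lra].
Qed.

(** The remainder splits into the first order remainders of exp, cos and sin at 0, up to products of
    small factors. *)
Lemma Cexp_near_0 : forall eps, 0 < eps -> exists del, 0 < del /\
  forall h, Cmod h < del -> Cmod (Cexp h - 1 - h) <= eps * Cmod h.
Proof.
  intros eps He.
  destruct (deriv_0_bound exp 1) with (eps := Rmin (eps / 8) 1) as [d1 [P1 H1]].
  { auto_derive; trivial; rewrite exp_0; ring. } { apply Rmin_glb_lt; lra. }
  destruct (deriv_0_bound cos 0) with (eps := Rmin (eps / 8) 1) as [d2 [P2 H2]].
  { auto_derive; trivial; rewrite sin_0; ring. } { apply Rmin_glb_lt; lra. }
  destruct (deriv_0_bound sin 1) with (eps := Rmin (eps / 8) 1) as [d3 [P3 H3]].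
  { auto_derive; trivial; rewrite cos_0; ring. } { apply Rmin_glb_lt; lra. }
  set (d4 := Rmin (eps / 16) (1 / 2)).
  assert (P4 : 0 < d4) by (apply Rmin_glb_lt; lra).
  exists (Rmin (Rmin d1 d2) (Rmin d3 d4)); split.
  { apply Rmin_glb_lt; apply Rmin_glb_lt; assumption. }
  intros [x y] Hh.
  assert (Hx : Rabs x <= Cmod (x, y)) by (apply (re_le_Cmod (x, y))).
  assert (Hy : Rabs y <= Cmod (x, y)) by (apply (Im_le_Cmod (x, y))).
  set (m := Cmod (x, y)) in *.
  assert (m < d1 /\ m < d2 /\ m < d3 /\ m < d4) as [M1 [M2 [M3 M4]]].
  { pose proof (Rmin_l (Rmin d1 d2) (Rmin d3 d4)); pose proof (Rmin_r (Rmin d1 d2) (Rmin d3 d4)).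
    pose proof (Rmin_l d1 d2); pose proof (Rmin_r d1 d2).
    pose proof (Rmin_l d3 d4); pose proof (Rmin_r d3 d4). lra. }
  assert (m < eps / 16 /\ m < 1/2) as [M5 M6].
  { unfold d4 in M4; pose proof (Rmin_l (eps/16) (1/2)); pose proof (Rmin_r (eps/16) (1/2)); lra. }
  specialize (H1 x ltac:(lra)); specialize (H2 y ltac:(lra)); specialize (H3 y ltac:(lra)).
  rewrite exp_0 in H1; rewrite cos_0 in H2; rewrite sin_0 in H3.
  set (e0 := Rmin (eps / 8) 1) in *.
  assert (E1 : e0 <= eps / 8) by apply Rmin_l.
  assert (E2 : e0 <= 1) by apply Rmin_r.
  assert (E0 : 0 < e0) by (apply Rmin_glb_lt; lra).
  pose proof (Rabs_pos x); pose proof (Rabs_pos y).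
  assert (A1 : Rabs (exp x - 1 - 1 * x) <= eps / 8 * m) by nra.
  assert (A2 : Rabs (cos y - 1 - 0 * y) <= eps / 8 * m) by nra.
  assert (A3 : Rabs (sin y - 0 - 1 * y) <= eps / 8 * m) by nra.
  assert (A4 : Rabs (exp x - 1 - 1 * x) <= Rabs x) by nra.
  assert (A5 : Rabs (sin y - 0 - 1 * y) <= Rabs y) by nra.
  eapply Rle_trans; [apply Cmod_le_abs|]; unfold Cexp; simpl.
  assert (X : Rabs (exp x - 1) <= 2 * m).
  { replace (exp x - 1) with ((exp x - 1 - 1 * x) + x) by ring.
    eapply Rle_trans; [apply Rabs_triang|]; lra. }
  assert (Y : Rabs (sin y) <= 2 * m).
  { replace (sin y) with ((sin y - 0 - 1 * y) + y) by ring.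
    eapply Rle_trans; [apply Rabs_triang|]; lra. }
  assert (Z : Rabs (exp x * cos y + - (1) + - x) <= eps / 8 * m + 2 * (eps / 8 * m)).
  { replace (exp x * cos y + - (1) + - x)
      with ((exp x - 1 - 1 * x) + exp x * (cos y - 1 - 0 * y)) by ring.
    eapply Rle_trans; [apply Rabs_triang|]; rewrite Rabs_mult.
    assert (Rabs (exp x) <= 2).
    { apply Rabs_le. apply Rabs_le_between in X. lra. }
    pose proof (Rabs_pos (exp x)). pose proof (Rabs_pos (cos y - 1 - 0 * y)). nra. }
  assert (W : Rabs (exp x * sin y + - 0 + - y) <= eps / 8 * m + 4 * m * m).
  { replace (exp x * sin y + - 0 + - y)
      with ((sin y - 0 - 1 * y) + (exp x - 1) * sin y) by ring.
    eapply Rle_trans; [apply Rabs_triang|]; rewrite Rabs_mult.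
    pose proof (Rabs_pos (exp x - 1)). pose proof (Rabs_pos (sin y)). nra. }
  unfold Rminus in *.
  assert (4 * m * m <= 4 * (eps / 16) * m) by (assert (Hm : 0 <= m) by apply Cmod_ge_0; nra).
  eapply Rle_trans; [apply Rplus_le_compat; [exact Z|exact W]|]; nra.
Qed.

Lemma cderiv_Cexp z : cderiv Cexp z (Cexp z).
Proof.
  set (E := fun w => if Ceq_dec w z then RtoC 1 else ((Cexp (w - z) - 1) / (w - z))%C).
  exists (fun w => Cexp z * E w)%C.
  assert (Ez : E z = 1) by (unfold E; destruct (Ceq_dec z z); [reflexivity|congruence]).
  assert (Hne : forall w, w <> z -> (w - z <> 0)%C).
  { intros w Hw E0; apply Hw, Csub_eq_0, E0. }
  split; [|split].
  - intros w; unfold E; destruct (Ceq_dec w z) as [->|Hw]; [ring|].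
    replace w with (z + (w - z))%C at 1 by ring. rewrite Cexp_plus.
    field. apply Hne; assumption.
  - apply ccont_mult; [apply ccont_const|].
    apply ccont_of_Cmod; intros eps He.
    destruct (Cexp_near_0 (eps / 2)) as [d [Hd H]]; [lra|].
    exists d; split; [assumption|]; intros w Hw; rewrite Ez.
    unfold E; destruct (Ceq_dec w z) as [->|Hwz].
    + replace (1 - 1)%C with (RtoC 0) by ring. rewrite Cmod_0; assumption.
    + specialize (Hne w Hwz).
      replace ((Cexp (w - z) - 1) / (w - z) - 1)%C
        with ((Cexp (w - z) - 1 - (w - z)) / (w - z))%C by (field; assumption).
      rewrite Cmod_div by assumption.
      pose proof (proj1 (Cmod_gt_0 _) Hne) as Hp.
      apply Rle_lt_trans with (eps / 2); [|lra].
      apply Rle_div_l; [assumption|]. apply H; assumption.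
  - rewrite Ez; ring.
Qed.

(** * Derivatives along paths *)

(** Derivative of a path in the plane, in a form accepted by the calculus of real functions. *)
Definition pderiv (g : R -> C) (t : R) (l : C) : Prop :=
  is_derive (fun s => Re (g s)) t (Re l) /\ is_derive (fun s => Im (g s)) t (Im l).

(** The product rule in Caratheodory's manner: as u vanishes at t, continuity of v suffices. It gives
    the chain rule along paths. *)
Lemma is_derive_vanishing (u v : R -> R) (t u' : R) :
  is_derive u t u' -> u t = 0 -> continuous v t ->
  is_derive (fun s => u s * v s) t (u' * v t).
Proof.
  intros Hu H0 Hv.
  apply is_derive_Reals in Hu.
  apply is_derive_Reals.
  intros eps He.
  set (m := Rabs (v t) + 1).
  assert (Hm : 0 < m) by (unfold m; pose proof (Rabs_pos (v t)); lra).
  set (n := Rabs u' + 1).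
  assert (Hn : 0 < n) by (unfold n; pose proof (Rabs_pos u'); lra).
  assert (He2 : 0 < eps / 2 / m) by (apply Rdiv_lt_0_compat; lra).
  destruct (Hu _ He2) as [d Hd].
  assert (He3 : 0 < Rmin 1 (eps / 2 / n)).
  { apply Rmin_glb_lt; [lra|apply Rdiv_lt_0_compat; lra]. }
  destruct (Hv _ (locally_ball (v t) (mkposreal _ He3))) as [d' Hd'].
  exists (mkposreal _ (Rmin_stable_in_posreal d d')); simpl.
  intros h Hh Hh2.
  assert (A1 : Rabs h < d) by (eapply Rlt_le_trans; [exact Hh2|apply Rmin_l]).
  assert (A2 : Rabs h < d') by (eapply Rlt_le_trans; [exact Hh2|apply Rmin_r]).
  specialize (Hd h Hh A1).
  assert (B : Rabs (v (t + h) - v t) < Rmin 1 (eps / 2 / n)).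
  { apply Hd'. unfold ball; simpl; unfold AbsRing_ball, abs, minus, plus, opp; simpl.
    replace (t + h + - t) with h by ring; exact A2. }
  rewrite H0 in *.
  replace ((u (t + h) * v (t + h) - 0 * v t) / h - u' * v t)
    with (((u (t + h) - 0) / h - u') * v (t + h) + u' * (v (t + h) - v t)) by (field; exact Hh).
  eapply Rle_lt_trans; [apply Rabs_triang|]; rewrite !Rabs_mult.
  assert (B1 : Rabs (v (t + h)) < m).
  { replace (v (t + h)) with (v t + (v (t + h) - v t)) by ring.
    eapply Rle_lt_trans; [apply Rabs_triang|]; unfold m.
    pose proof (Rmin_l 1 (eps / 2 / n)); lra. }
  assert (B2 : Rabs (v (t + h) - v t) < eps / 2 / n)
    by (eapply Rlt_le_trans; [exact B|apply Rmin_r]).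
  assert (C1 : Rabs ((u (t + h) - 0) / h - u') * Rabs (v (t + h)) <= eps / 2 / m * m).
  { apply Rmult_le_compat; try apply Rabs_pos; lra. }
  assert (C2 : Rabs u' * Rabs (v (t + h) - v t) < n * (eps / 2 / n)).
  { apply Rle_lt_trans with (Rabs u' * (eps / 2 / n)).
    - apply Rmult_le_compat_l; [apply Rabs_pos|lra].
    - apply Rmult_lt_compat_r; [apply Rdiv_lt_0_compat; lra|unfold n; lra]. }
  replace (eps / 2 / m * m) with (eps / 2) in C1 by (field; lra).
  replace (n * (eps / 2 / n)) with (eps / 2) in C2 by (field; lra).
  lra.
Qed.

Lemma pderiv_ccont g t l : pderiv g t l -> ccont g t.
Proof.
  intros [H1 H2]; split.
  - cont_der; eexists; exact H1.
  - cont_der; eexists; exact H2.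
Qed.

Lemma pderiv_ext f g t l : (forall s, f s = g s) -> pderiv f t l -> pderiv g t l.
Proof.
  intros E [H1 H2]; split;
  [apply (is_derive_ext (fun s => Re (f s)))|apply (is_derive_ext (fun s => Im (f s)))];
  try assumption; intros s; rewrite E; reflexivity.
Qed.

Lemma pderiv_const c t : pderiv (fun _ => c) t 0.
Proof. split; simpl; apply (is_derive_const (K := R_AbsRing) (V := R_NormedModule)). Qed.

Lemma pderiv_plus f g t l m : pderiv f t l -> pderiv g t m ->
  pderiv (fun s => f s + g s)%C t (l + m).
Proof.
  intros [H1 H2] [H3 H4]; split; simpl.
  - apply (is_derive_plus (K := R_AbsRing) (V := R_NormedModule)
      (fun s => Re (f s)) (fun s => Re (g s))); assumption.
  - apply (is_derive_plus (K := R_AbsRing) (V := R_NormedModule)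
      (fun s => Im (f s)) (fun s => Im (g s))); assumption.
Qed.

Lemma is_derive_Rmult (u v : R -> R) t u' v' : is_derive u t u' -> is_derive v t v' ->
  is_derive (fun s => u s * v s) t (u' * v t + u t * v').
Proof.
  intros H1 H2.
  apply (is_derive_mult (K := R_AbsRing) u v); [assumption|assumption|].
  intros; apply Rmult_comm.
Qed.

Lemma is_derive_Rplus (u v : R -> R) t u' v' : is_derive u t u' -> is_derive v t v' ->
  is_derive (fun s => u s + v s) t (u' + v').
Proof. apply (is_derive_plus (K := R_AbsRing) (V := R_NormedModule)). Qed.

Lemma is_derive_Rminus (u v : R -> R) t u' v' : is_derive u t u' -> is_derive v t v' ->
  is_derive (fun s => u s - v s) t (u' - v').
Proof. apply (is_derive_minus (K := R_AbsRing) (V := R_NormedModule)). Qed.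

Lemma is_derive_Rconst (c t : R) : is_derive (fun _ => c) t 0.
Proof. apply (is_derive_const (K := R_AbsRing) (V := R_NormedModule)). Qed.

Lemma pderiv_mult f g t l m : pderiv f t l -> pderiv g t m ->
  pderiv (fun s => f s * g s)%C t (l * g t + f t * m).
Proof.
  intros [H1 H2] [H3 H4]; split.
  - replace (Re (l * g t + f t * m)) with ((Re l * Re (g t) + Re (f t) * Re m) -
      (Im l * Im (g t) + Im (f t) * Im m)) by (simpl; unfold Re, Im; ring).
    apply (is_derive_Rminus (fun s => Re (f s) * Re (g s)) (fun s => Im (f s) * Im (g s)));
    apply (is_derive_Rmult (fun s => _ (f s)) (fun s => _ (g s))); assumption.
  - replace (Im (l * g t + f t * m)) with ((Re l * Im (g t) + Re (f t) * Im m) +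
      (Im l * Re (g t) + Im (f t) * Re m)) by (simpl; unfold Re, Im; ring).
    apply (is_derive_Rplus (fun s => Re (f s) * Im (g s)) (fun s => Im (f s) * Re (g s)));
    apply (is_derive_Rmult (fun s => _ (f s)) (fun s => _ (g s))); assumption.
Qed.

Lemma pderiv_mult_const f t l c : pderiv f t l -> pderiv (fun s => c * f s)%C t (c * l).
Proof.
  intros H; replace (c * l)%C with (0 * f t + c * l)%C by ring.
  apply pderiv_mult; [apply pderiv_const|assumption].
Qed.

Lemma pderiv_minus f g t l m : pderiv f t l -> pderiv g t m ->
  pderiv (fun s => f s - g s)%C t (l - m).
Proof.
  intros H1 H2.
  apply (pderiv_ext (fun s => f s + (-(1)) * g s)%C); [intros; ring|].
  replace (l - m)%C with (l + (-(1)) * m)%C by ring.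
  apply pderiv_plus, pderiv_mult_const; assumption.
Qed.

Lemma pderiv_comp f g t l m : cderiv f (g t) l -> pderiv g t m ->
  pderiv (fun s => f (g s)) t (l * m).
Proof.
  intros [k [H1 [H2 H3]]] Hg.
  pose proof (pderiv_ccont _ _ _ Hg) as Cg.
  assert (Hk : ccont (fun s => k (g s)) t) by (apply ccont_comp; assumption).
  destruct Hk as [K1 K2], Hg as [G1 G2].
  assert (D1 : is_derive (fun s => Re (g s) - Re (g t)) t (Re m)).
  { rewrite <- (Rminus_0_r (Re m)); apply (is_derive_Rminus (fun s => Re (g s))); [exact G1|apply is_derive_Rconst]. }
  assert (D2 : is_derive (fun s => Im (g s) - Im (g t)) t (Im m)).
  { rewrite <- (Rminus_0_r (Im m)); apply (is_derive_Rminus (fun s => Im (g s))); [exact G2|apply is_derive_Rconst]. }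
  pose proof (is_derive_vanishing _ _ _ _ D1 (Rminus_diag_eq _ _ eq_refl) K1) as V11.
  pose proof (is_derive_vanishing _ _ _ _ D1 (Rminus_diag_eq _ _ eq_refl) K2) as V12.
  pose proof (is_derive_vanishing _ _ _ _ D2 (Rminus_diag_eq _ _ eq_refl) K1) as V21.
  pose proof (is_derive_vanishing _ _ _ _ D2 (Rminus_diag_eq _ _ eq_refl) K2) as V22.
  cbv beta in *; rewrite H3 in *.
  split.
  - apply (is_derive_ext (fun s => Re (f (g t)) +
      ((Re (g s) - Re (g t)) * Re (k (g s)) - (Im (g s) - Im (g t)) * Im (k (g s))))).
    { intros s; rewrite (H1 (g s)); simpl; unfold Re, Im; ring. }
    replace (Re (l * m)) with (0 + (Re m * Re l - Im m * Im l)) by (simpl; unfold Re, Im; ring).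
    apply (is_derive_plus (K := R_AbsRing) (V := R_NormedModule)).
    + apply (is_derive_const (K := R_AbsRing) (V := R_NormedModule)).
    + apply (is_derive_minus (K := R_AbsRing) (V := R_NormedModule)); assumption.
  - apply (is_derive_ext (fun s => Im (f (g t)) +
      ((Re (g s) - Re (g t)) * Im (k (g s)) + (Im (g s) - Im (g t)) * Re (k (g s))))).
    { intros s; rewrite (H1 (g s)); simpl; unfold Re, Im; ring. }
    replace (Im (l * m)) with (0 + (Re m * Im l + Im m * Re l)) by (simpl; unfold Re, Im; ring).
    apply (is_derive_plus (K := R_AbsRing) (V := R_NormedModule)).
    + apply (is_derive_const (K := R_AbsRing) (V := R_NormedModule)).
    + apply (is_derive_plus (K := R_AbsRing) (V := R_NormedModule)); assumption.
Qed.

(** * Integrals of complex valued functions *)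

Definition CInt (f : R -> C) (a b : R) : C :=
  (RInt (fun t => Re (f t)) a b, RInt (fun t => Im (f t)) a b).

Definition ccont_on (f : R -> C) (a b : R) : Prop :=
  forall t, Rmin a b <= t <= Rmax a b -> ccont f t.

Lemma ccont_on_ex f a b : ccont_on f a b ->
  ex_RInt (fun t => Re (f t)) a b /\ ex_RInt (fun t => Im (f t)) a b.
Proof.
  intros H; split; apply (ex_RInt_continuous (V := R_CompleteNormedModule));
  intros t Ht; apply (H t Ht).
Qed.

Lemma CInt_ext f g a b :
  (forall t, Rmin a b <= t <= Rmax a b -> f t = g t) -> CInt f a b = CInt g a b.
Proof.
  intros H; unfold CInt; f_equal; apply RInt_ext; intros t Ht; rewrite H; try reflexivity; lra.
Qed.

Lemma CInt_plus f g a b : ccont_on f a b -> ccont_on g a b ->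
  CInt (fun t => f t + g t)%C a b = (CInt f a b + CInt g a b)%C.
Proof.
  intros Hf Hg; destruct (ccont_on_ex _ _ _ Hf), (ccont_on_ex _ _ _ Hg).
  unfold CInt; apply injective_projections; simpl;
  apply (RInt_plus (V := R_CompleteNormedModule)); assumption.
Qed.

Lemma CInt_scal f c a b : ccont_on f a b ->
  CInt (fun t => c * f t)%C a b = (c * CInt f a b)%C.
Proof.
  intros Hf; destruct (ccont_on_ex _ _ _ Hf) as [H1 H2].
  assert (S : forall r (s : R -> R), ex_RInt s a b -> ex_RInt (fun t => r * s t) a b).
  { intros; apply (ex_RInt_scal (V := R_NormedModule)); assumption. }
  assert (Q : forall r (s : R -> R), ex_RInt s a b -> RInt (fun t => r * s t) a b = r * RInt s a b).
  { intros; apply (RInt_scal (V := R_CompleteNormedModule)); assumption. }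
  unfold CInt; apply injective_projections; simpl; unfold Re, Im in *.
  - rewrite (RInt_minus (V := R_CompleteNormedModule)
      (fun t => fst c * fst (f t)) (fun t => snd c * snd (f t))); auto.
    rewrite !Q; auto.
  - rewrite (RInt_plus (V := R_CompleteNormedModule)
      (fun t => fst c * snd (f t)) (fun t => snd c * fst (f t))); auto.
    rewrite !Q; auto.
Qed.

Lemma CInt_opp f a b : ccont_on f a b -> CInt (fun t => - f t)%C a b = (- CInt f a b)%C.
Proof.
  intros H.
  rewrite (CInt_ext _ (fun t => (-(1)) * f t)%C); [|intros; ring].
  rewrite CInt_scal by assumption; ring.
Qed.

Lemma CInt_minus f g a b : ccont_on f a b -> ccont_on g a b ->
  CInt (fun t => f t - g t)%C a b = (CInt f a b - CInt g a b)%C.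
Proof.
  intros Hf Hg. unfold Cminus.
  rewrite (CInt_plus f (fun t => - g t)%C); [|assumption|].
  - rewrite CInt_opp by assumption; reflexivity.
  - intros t Ht; apply ccont_opp, Hg, Ht.
Qed.

Lemma CInt_const c a b : CInt (fun _ => c) a b = ((b - a)%R * c)%C.
Proof.
  unfold CInt; rewrite !RInt_const; unfold scal; simpl; unfold mult; simpl.
  ceq; unfold Re, Im; ring.
Qed.

Lemma CInt_point f a : CInt f a a = 0.
Proof. unfold CInt; rewrite !RInt_point; reflexivity. Qed.

Lemma CInt_Chasles f a b c : a <= b <= c -> ccont_on f a c ->
  (CInt f a b + CInt f b c)%C = CInt f a c.
Proof.
  intros Hb H.
  assert (H1 : ccont_on f a b).
  { intros t; rewrite Rmin_left, Rmax_right by lra; intros; apply H.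
    rewrite Rmin_left, Rmax_right; lra. }
  assert (H2 : ccont_on f b c).
  { intros t; rewrite Rmin_left, Rmax_right by lra; intros; apply H.
    rewrite Rmin_left, Rmax_right; lra. }
  destruct (ccont_on_ex _ _ _ H1), (ccont_on_ex _ _ _ H2).
  unfold CInt; apply injective_projections; simpl;
  apply (RInt_Chasles (V := R_CompleteNormedModule)); assumption.
Qed.

(** Bounding the components separately costs the factor 2, which is immaterial for the rates. *)
Lemma CInt_bound f (g : R -> R) a b : a <= b -> ccont_on f a b ->
  (forall t, a <= t <= b -> Cmod (f t) <= g t) ->
  ex_RInt g a b -> Cmod (CInt f a b) <= 2 * RInt g a b.
Proof.
  intros Hab Hf Hg Ex; destruct (ccont_on_ex _ _ _ Hf) as [H1 H2].
  eapply Rle_trans; [apply Cmod_le_abs|]; unfold CInt; simpl.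
  assert (Rabs (RInt (fun t => Re (f t)) a b) <= RInt g a b).
  { apply (norm_RInt_le (V := R_NormedModule) (fun t => Re (f t)) g a b); try assumption.
    - intros t Ht; apply Rle_trans with (Cmod (f t)); [apply re_le_Cmod|auto].
    - apply (RInt_correct (V := R_CompleteNormedModule)); assumption.
    - apply (RInt_correct (V := R_CompleteNormedModule)); assumption. }
  assert (Rabs (RInt (fun t => Im (f t)) a b) <= RInt g a b).
  { apply (norm_RInt_le (V := R_NormedModule) (fun t => Im (f t)) g a b); try assumption.
    - intros t Ht; apply Rle_trans with (Cmod (f t)); [apply Im_le_Cmod|auto].
    - apply (RInt_correct (V := R_CompleteNormedModule)); assumption.
    - apply (RInt_correct (V := R_CompleteNormedModule)); assumption. }
  lra.
Qed.

Lemma CInt_bound_const f M a b : a <= b -> ccont_on f a b ->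
  (forall t, a <= t <= b -> Cmod (f t) <= M) ->
  Cmod (CInt f a b) <= 2 * ((b - a) * M).
Proof.
  intros Hab Hf Hg.
  replace ((b - a) * M) with (RInt (fun _ => M) a b).
  - apply CInt_bound; try assumption. apply ex_RInt_const.
  - rewrite RInt_const; reflexivity.
Qed.

Lemma CInt_FTC F f a b :
  (forall t, Rmin a b <= t <= Rmax a b -> pderiv F t (f t)) -> ccont_on f a b ->
  CInt f a b = (F b - F a)%C.
Proof.
  intros HF Hf; unfold CInt; apply injective_projections; simpl;
  apply (is_RInt_unique (V := R_CompleteNormedModule)).
  - apply (is_RInt_derive (V := R_CompleteNormedModule) (fun t => Re (F t))).
    + intros t Ht; apply (HF t Ht).
    + intros t Ht; apply (Hf t Ht).
  - apply (is_RInt_derive (V := R_CompleteNormedModule) (fun t => Im (F t))).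
    + intros t Ht; apply (HF t Ht).
    + intros t Ht; apply (Hf t Ht).
Qed.

Lemma pderiv_CInt f a t eps : 0 < eps ->
  (forall s, Rmin a t - eps < s < Rmax a t + eps -> ccont f s) ->
  pderiv (fun x => CInt f a x) t (f t).
Proof.
  intros He H.
  assert (L : locally t (fun x => ccont_on f a x)).
  { exists (mkposreal eps He); intros x Hx s Hs; apply H.
    unfold ball in Hx; simpl in Hx; unfold AbsRing_ball, abs, minus, plus, opp in Hx; simpl in Hx.
    apply Rabs_def2 in Hx.
    unfold Rmin, Rmax in *; destruct (Rle_dec a x), (Rle_dec a t); lra. }
  assert (Ht : ccont f t).
  { apply H. pose proof (Rmin_r a t); pose proof (Rmax_r a t); lra. }
  split; simpl.
  - apply (is_derive_RInt (V := R_NormedModule) (fun s => Re (f s)) _ a); [|apply Ht].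
    revert L; apply filter_imp; intros x Hx.
    apply (RInt_correct (V := R_CompleteNormedModule)); apply (ccont_on_ex _ _ _ Hx).
  - apply (is_derive_RInt (V := R_NormedModule) (fun s => Im (f s)) _ a); [|apply Ht].
    revert L; apply filter_imp; intros x Hx.
    apply (RInt_correct (V := R_CompleteNormedModule)); apply (ccont_on_ex _ _ _ Hx).
Qed.

Lemma CInt_comp_lin f u v a b :
  ccont_on f (u * a + v) (u * b + v) ->
  CInt (fun y => RtoC u * f (u * y + v)%R)%C a b = CInt f (u * a + v) (u * b + v).
Proof.
  intros H; destruct (ccont_on_ex _ _ _ H) as [H1 H2].
  unfold CInt; apply injective_projections; simpl.
  - rewrite <- (RInt_comp_lin (V := R_CompleteNormedModule)) by assumption.
    apply RInt_ext; intros; unfold scal; simpl; unfold mult; simpl; unfold Re, Im; ring.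
  - rewrite <- (RInt_comp_lin (V := R_CompleteNormedModule)) by assumption.
    apply RInt_ext; intros; unfold scal; simpl; unfold mult; simpl; unfold Re, Im; ring.
Qed.

(** * Differentiation under the integral sign *)

Lemma is_derive_RInt_param_joint (G Gx : R -> R -> R) (x eps : R) : 0 < eps ->
  (forall s t, Rabs (s - x) < eps -> -eps < t < 1 + eps ->
     is_derive (fun u => G u t) s (Gx s t) /\
     continuous (T := prod_UniformSpace R_UniformSpace R_UniformSpace)
       (fun p => Gx (fst p) (snd p)) (s, t)) ->
  (forall s, Rabs (s - x) < eps -> ex_RInt (G s) 0 1) ->
  is_derive (fun s => RInt (G s) 0 1) x (RInt (Gx x) 0 1).
Proof.
  intros He H Hex.
  assert (Lx : locally x (fun s => Rabs (s - x) < eps)).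
  { exists (mkposreal eps He); intros s Hs; exact Hs. }
  assert (Hx0 : Rabs (x - x) < eps) by (rewrite Rminus_diag_eq, Rabs_R0; trivial).
  rewrite (RInt_ext (Gx x) (fun t => Derive (fun u => G u t) x)).
  2:{ intros t Ht; rewrite Rmin_left, Rmax_right in Ht by lra.
      symmetry; apply is_derive_unique, H; [assumption|lra]. }
  apply is_derive_RInt_param.
  - revert Lx; apply filter_imp; intros s Hs t Ht.
    rewrite Rmin_left, Rmax_right in Ht by lra.
    exists (Gx s t); apply H; [assumption|lra].
  - intros t Ht; rewrite Rmin_left, Rmax_right in Ht by lra.
    apply (continuity_2d_pt_ext_loc Gx).
    + exists (mkposreal eps He); simpl; intros u v Hu Hv.
      symmetry; apply is_derive_unique, H; [assumption|].
      apply Rabs_def2 in Hv; lra.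
    + apply continuity_2d_pt_filterlim.
      apply (H x t); [assumption|lra].
  - revert Lx; apply filter_imp; exact Hex.
Qed.

Lemma pderiv_CInt_param (G Gx : R -> R -> C) (x eps : R) : 0 < eps ->
  (forall s t, Rabs (s - x) < eps -> -eps < t < 1 + eps ->
     pderiv (fun u => G u t) s (Gx s t) /\
     ccont (T := prod_UniformSpace R_UniformSpace R_UniformSpace)
       (fun p => Gx (fst p) (snd p)) (s, t)) ->
  (forall s, Rabs (s - x) < eps -> ccont_on (G s) 0 1) ->
  pderiv (fun s => CInt (G s) 0 1) x (CInt (Gx x) 0 1).
Proof.
  intros He H Hex; split; simpl.
  - apply (is_derive_RInt_param_joint (fun s t => Re (G s t)) (fun s t => Re (Gx s t)) x eps He).
    + intros s t Hs Ht; split; apply (H s t Hs Ht).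
    + intros s Hs; apply (ccont_on_ex _ _ _ (Hex s Hs)).
  - apply (is_derive_RInt_param_joint (fun s t => Im (G s t)) (fun s t => Im (Gx s t)) x eps He).
    + intros s t Hs Ht; split; apply (H s t Hs Ht).
    + intros s Hs; apply (ccont_on_ex _ _ _ (Hex s Hs)).
Qed.

(** * Cauchy's theorem *)

Lemma continuous_of_is_derive (y : R -> R) (x l : R) : is_derive y x l -> continuous y x.
Proof.
  intros H; cont_der.
  eexists; exact H.
Qed.

Lemma locally_lt (y : R -> R) (x c : R) : continuous y x -> y x < c ->
  exists d, 0 < d /\ forall s, Rabs (s - x) < d -> y s < c.
Proof.
  intros H Hc.
  assert (He : 0 < c - y x) by lra.
  destruct (H _ (locally_ball (y x) (mkposreal _ He))) as [d Hd].
  exists d; split; [apply cond_pos|]; intros s Hs.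
  specialize (Hd s Hs); unfold ball in Hd; simpl in Hd.
  unfold AbsRing_ball, abs, minus, plus, opp in Hd; simpl in Hd.
  apply Rabs_def2 in Hd; lra.
Qed.

Lemma pderiv_line (x c d t : R) : pderiv (fun s => (x, c + s * d)) t (0, d).
Proof.
  split; simpl.
  - apply is_derive_Rconst.
  - auto_derive; trivial; ring.
Qed.

Lemma ccont_real_pair {T : UniformSpace} (u v : T -> R) (x : T) :
  continuous u x -> continuous v x -> ccont (fun p => (u p, v p)) x.
Proof. intros; split; assumption. Qed.

(** Cauchy's theorem between a horizontal line and the graph of y. Seen as functions of the right end,
    both sides have the same derivative: differentiated under the integral sign, the rescaled column
    yields an exact derivative in the column variable. The margin eps keeps the neighbouring columns
    in the domain. *)
Lemma cauchy_graph (f f' : C -> C) (a b c eps : R) (y y' : R -> R) :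
  0 < eps -> a < b ->
  (forall x, a - eps < x < b + eps -> c <= y x /\ is_derive y x (y' x) /\ continuous y' x) ->
  (forall x t, a - eps < x < b + eps -> c - eps < t < y x + eps ->
     cderiv f (x, t) (f' (x, t)) /\ ccont f' (x, t)) ->
  (CInt (fun x => f (x, c)) a b + Ci * CInt (fun t => f (b, t)) c (y b) =
   CInt (fun x => f (x, y x) * (1, y' x)) a b + Ci * CInt (fun t => f (a, t)) c (y a))%C.
Proof.
  intros He Hab Hy Hf.
  set (gam := fun s t : R => ((s, c + t * (y s - c)) : C)).
  set (G := fun s t : R => (f (gam s t) * (0, (y s - c)%R))%C).
  set (Gx := fun s t : R => (f' (gam s t) * (1, (t * y' s)%R) * (0, (y s - c)%R)
                             + f (gam s t) * (0, y' s))%C).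
  (* Rescaling each column to the unit interval makes the interval of integration independent
     of the parameter. *)
  assert (Hscal : forall s, a - eps < s < b + eps ->
    (Ci * CInt (fun t => f (s, t)) c (y s))%C = CInt (G s) 0 1).
  { intros s Hs; destruct (Hy s Hs) as [Hc _].
    assert (Cf : ccont_on (fun t => f (s, t)) c (y s)).
    { intros t Ht; rewrite Rmin_left, Rmax_right in Ht by lra.
      apply (ccont_comp (fun t => (s, t)) f).
      - apply ccont_real_pair; [apply continuous_const|apply continuous_id].
      - destruct (Hf s t Hs) as [D _]; [lra|]. exact (cderiv_ccont _ _ _ D). }
    transitivity (Ci * CInt (fun t => f (s, t)) ((y s - c) * 0 + c) ((y s - c) * 1 + c))%C.
    { f_equal; f_equal; ring. }
    rewrite <- CInt_comp_lin.
    2:{ replace ((y s - c) * 0 + c) with c by ring.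
        replace ((y s - c) * 1 + c) with (y s) by ring. exact Cf. }
    rewrite <- CInt_scal.
    - apply CInt_ext; intros t Ht; unfold G, gam.
      replace ((y s - c) * t + c) with (c + t * (y s - c)) by ring.
      replace ((0, y s - c) : C) with (Ci * RtoC (y s - c))%C by ceq. ring.
    - intros t Ht; rewrite Rmin_left, Rmax_right in Ht by lra.
      apply ccont_mult; [apply ccont_const|].
      apply (ccont_comp (fun t => (s, (y s - c) * t + c)) f).
      + apply ccont_real_pair; [apply continuous_const|]. cont_real.
      + destruct (Hf s ((y s - c) * t + c) Hs) as [D _]; [nra|].
        exact (cderiv_ccont _ _ _ D). }
  (* Differentiating under the integral sign needs the neighbouring columns as well, and a little
     beyond their ends. *)
  assert (Hdom : forall x, a - eps < x < b + eps -> exists e, 0 < e /\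
     forall s t, Rabs (s - x) < e -> -e < t < 1 + e ->
       a - eps < s < b + eps /\ c - eps < c + t * (y s - c) < y s + eps).
  { intros x Hx; destruct (Hy x Hx) as [Hc [Hd _]].
    destruct (locally_lt y x (y x + 1)) as [d [Hd0 Hd1]].
    { eapply continuous_of_is_derive; exact Hd. } { lra. }
    set (Y := y x - c + 2).
    assert (HY : 1 < Y) by (unfold Y; lra).
    set (e := Rmin (Rmin d (eps / Y)) (Rmin (x - (a - eps)) (b + eps - x))).
    assert (P : 0 < eps / Y) by (apply Rdiv_lt_0_compat; lra).
    assert (E1 : e <= d /\ e <= eps / Y /\ e <= x - (a - eps) /\ e <= b + eps - x).
    { unfold e; pose proof (Rmin_l (Rmin d (eps / Y)) (Rmin (x - (a - eps)) (b + eps - x))).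
      pose proof (Rmin_r (Rmin d (eps / Y)) (Rmin (x - (a - eps)) (b + eps - x))).
      pose proof (Rmin_l d (eps / Y)); pose proof (Rmin_r d (eps / Y)).
      pose proof (Rmin_l (x - (a - eps)) (b + eps - x)).
      pose proof (Rmin_r (x - (a - eps)) (b + eps - x)). lra. }
    exists e; split.
    { unfold e; repeat apply Rmin_glb_lt; lra. }
    intros s t Hs Ht.
    assert (a - eps < s < b + eps) by (apply Rabs_def2 in Hs; lra).
    split; [assumption|].
    destruct (Hy s) as [Hcs _]; [assumption|].
    assert (y s < y x + 1) by (apply Hd1; lra).
    assert (e * Y <= eps).
    { replace eps with (eps / Y * Y) by (field; lra). apply Rmult_le_compat_r; lra. }
    assert (0 <= y s - c < Y) by (unfold Y; lra).
    assert (0 < e) by (pose proof (Rabs_pos (s - x)); lra).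
    assert (e * (y s - c) < e * Y) by (apply Rmult_lt_compat_l; lra).
    assert (- e * (y s - c) <= t * (y s - c)) by (apply Rmult_le_compat_r; lra).
    assert ((t - 1) * (y s - c) <= e * (y s - c)) by (apply Rmult_le_compat_r; lra).
    lra. }
  assert (Hcf : forall x, a - eps < x < b + eps -> ccont (fun s => f (s, c)) x).
  { intros x Hx; apply (ccont_comp (fun s => (s, c)) f).
    - apply ccont_real_pair; [apply continuous_id|apply continuous_const].
    - destruct (Hf x c Hx) as [D _]; [destruct (Hy x Hx); lra|]. exact (cderiv_ccont _ _ _ D). }
  assert (Hct : forall x, a - eps < x < b + eps -> ccont (fun s => f (s, y s) * (1, y' s))%C x).
  { intros x Hx; destruct (Hy x Hx) as [Hc [Hd Hc']].
    apply ccont_mult; [apply (ccont_comp (fun s => (s, y s)) f)|].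
    - apply ccont_real_pair; [apply continuous_id|]. eapply continuous_of_is_derive; exact Hd.
    - destruct (Hf x (y x) Hx) as [D _]; [lra|]. exact (cderiv_ccont _ _ _ D).
    - apply ccont_real_pair; [apply continuous_const|exact Hc']. }
  assert (HB : forall x, a <= x <= b ->
     pderiv (fun s => CInt (G s) 0 1) x (f (x, y x) * (1, y' x) - f (x, c))%C).
  { intros x Hx.
    destruct (Hdom x ltac:(lra)) as [e [He0 Hdom']].
    assert (HGc : forall s t, Rabs (s - x) < e -> - e < t < 1 + e -> ccont (G s) t).
    { intros s t Hs Ht; destruct (Hdom' s t Hs Ht) as [Ds Dt].
      unfold G; apply ccont_mult; [|apply ccont_const].
      unfold gam; apply (ccont_comp (fun t => (s, c + t * (y s - c))) f).
      - apply ccont_real_pair; [apply continuous_const|]. cont_real.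
      - destruct (Hf s (c + t * (y s - c)) Ds Dt) as [D _]; exact (cderiv_ccont _ _ _ D). }
    replace (f (x, y x) * (1, y' x) - f (x, c))%C with (CInt (Gx x) 0 1).
    - apply (pderiv_CInt_param G Gx x e He0).
      + intros s t Hs Ht; destruct (Hdom' s t Hs Ht) as [Ds Dt].
        destruct (Hy s Ds) as [Hc [Hd Hc']].
        destruct (Hf s (c + t * (y s - c)) Ds Dt) as [Df Cf'].
        split.
        * unfold G, Gx.
          apply (pderiv_mult (fun u => f (gam u t)) (fun u => (0, y u - c))).
          -- apply pderiv_comp; [exact Df|]. unfold gam; split; simpl.
             ++ apply (is_derive_id (K := R_AbsRing)).
             ++ replace (t * y' s) with (0 + (0 * (y s - c) + t * (y' s - 0))) by ring.
                apply (is_derive_Rplus (fun _ => c) (fun u => t * (y u - c)));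
                  [apply is_derive_Rconst|].
                apply (is_derive_Rmult (fun _ => t) (fun u => y u - c));
                  [apply is_derive_Rconst|].
                apply (is_derive_Rminus y (fun _ => c)); [exact Hd|apply is_derive_Rconst].
          -- split; simpl; [apply is_derive_Rconst|].
             rewrite <- (Rminus_0_r (y' s)).
             apply (is_derive_Rminus y (fun _ => c)); [exact Hd|apply is_derive_Rconst].
        * unfold Gx, gam.
          assert (C1 : continuous (T := prod_UniformSpace R_UniformSpace R_UniformSpace)
                         (fun p => fst p) (s, t)) by apply continuous_fst.
          assert (C2 : continuous (T := prod_UniformSpace R_UniformSpace R_UniformSpace)
                         (fun p => snd p) (s, t)) by apply continuous_snd.
          assert (C3 : continuous (T := prod_UniformSpace R_UniformSpace R_UniformSpace)
                         (fun p => y (fst p) - c) (s, t)).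
          { apply (continuous_minus (fun p : R * R => y (fst p)) (fun _ => c)).
            - apply (continuous_comp (fun p : R * R => fst p) y); [exact C1|].
              eapply continuous_of_is_derive; exact Hd.
            - apply continuous_const. }
          assert (C4 : continuous (T := prod_UniformSpace R_UniformSpace R_UniformSpace)
                         (fun p => y' (fst p)) (s, t)).
          { apply (continuous_comp (fun p : R * R => fst p) y'); [exact C1|exact Hc']. }
          assert (C5 : ccont (T := prod_UniformSpace R_UniformSpace R_UniformSpace)
                         (fun p => (fst p, c + snd p * (y (fst p) - c))) (s, t)).
          { apply ccont_real_pair; [exact C1|].
            apply (continuous_plus (fun _ : R * R => c) (fun p : R * R => snd p * (y (fst p) - c))).
            - apply continuous_const.
            - apply (continuous_mult (K := R_AbsRing) (fun p : R * R => snd p)); assumption. }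
          apply ccont_plus; apply ccont_mult; try apply ccont_mult.
          -- apply (ccont_comp (fun p : R * R => (fst p, c + snd p * (y (fst p) - c))) f'); assumption.
          -- apply ccont_real_pair; [apply continuous_const|].
             apply (continuous_mult (K := R_AbsRing) (fun p : R * R => snd p)); assumption.
          -- apply ccont_real_pair; [apply continuous_const|assumption].
          -- apply (ccont_comp (fun p : R * R => (fst p, c + snd p * (y (fst p) - c))) f);
               [assumption|exact (cderiv_ccont _ _ _ Df)].
          -- apply ccont_real_pair; [apply continuous_const|assumption].
      + intros s Hs t Ht; rewrite Rmin_left, Rmax_right in Ht by lra.
        apply HGc; [assumption|lra].
    - destruct (Hy x ltac:(lra)) as [Hc [Hd Hc']].
      assert (Hx0 : Rabs (x - x) < e) by (rewrite Rminus_diag_eq, Rabs_R0; trivial).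
      transitivity (f (gam x 1) * (1, (1 * y' x)%R) - f (gam x 0) * (1, (0 * y' x)%R))%C.
      + apply (CInt_FTC (fun t => f (gam x t) * (1, (t * y' x)%R))%C).
        * intros t Ht; rewrite Rmin_left, Rmax_right in Ht by lra.
          destruct (Hdom' x t Hx0 ltac:(lra)) as [Ds Dt].
          destruct (Hf x (c + t * (y x - c)) Ds Dt) as [Df Cf'].
          unfold Gx.
          replace (f' (gam x t) * (1, (t * y' x)%R) * (0, (y x - c)%R)
                             + f (gam x t) * (0, y' x))%C
            with ((f' (gam x t) * (0, (y x - c)%R)) * (1, (t * y' x)%R)
                             + f (gam x t) * (0, y' x))%C by ring.
          apply (pderiv_mult (fun u => f (gam x u)) (fun u => (1, u * y' x))).
          -- apply pderiv_comp; [exact Df|apply pderiv_line].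
          -- split; simpl; [apply is_derive_Rconst|]. auto_derive; trivial; ring.
        * intros t Ht; rewrite Rmin_left, Rmax_right in Ht by lra.
          destruct (Hdom' x t Hx0 ltac:(lra)) as [Ds Dt].
          destruct (Hf x (c + t * (y x - c)) Ds Dt) as [Df Cf'].
          unfold Gx, gam.
          assert (C5 : ccont (fun t => (x, c + t * (y x - c))) t).
          { apply ccont_real_pair; [apply continuous_const|]. cont_real. }
          apply ccont_plus; apply ccont_mult; try apply ccont_mult; try apply ccont_const.
          -- apply (ccont_comp _ f'); assumption.
          -- apply ccont_real_pair; [apply continuous_const|cont_real].
          -- apply (ccont_comp _ f); [assumption|exact (cderiv_ccont _ _ _ Df)].
      + unfold gam. replace (c + 1 * (y x - c)) with (y x) by ring.
        replace (c + 0 * (y x - c)) with c by ring.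
        replace (1 * y' x) with (y' x) by ring. replace (0 * y' x) with 0 by ring.
        change ((1, 0) : C) with (RtoC 1). ring. }
  (* The difference of the two sides with the right end moved to s. *)
  set (W := fun s => (CInt (fun x => f (x, c)) a s + CInt (G s) 0 1
                      - CInt (fun x => f (x, y x) * (1, y' x)) a s)%C).
  assert (HW : forall x, a <= x <= b -> pderiv W x 0).
  { intros x Hx; unfold W.
    replace (RtoC 0) with (f (x, c) + (f (x, y x) * (1, y' x) - f (x, c))
                           - f (x, y x) * (1, y' x))%C by ring.
    apply (pderiv_minus (fun s => CInt (fun x => f (x, c)) a s + CInt (G s) 0 1)%C).
    - apply (pderiv_plus (fun s => CInt (fun x => f (x, c)) a s)).
      + apply (pderiv_CInt (fun x => f (x, c)) a x eps He).
        intros s; rewrite Rmin_left, Rmax_right by lra; intros; apply Hcf; lra.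
      + apply HB; assumption.
    - apply (pderiv_CInt (fun x => f (x, y x) * (1, y' x))%C a x eps He).
      intros s; rewrite Rmin_left, Rmax_right by lra; intros; apply Hct; lra. }
  assert (E : W a = W b).
  { apply injective_projections.
    - apply (eq_is_derive (V := R_NormedModule) (fun s => Re (W s))); [|assumption].
      intros t Ht; apply (HW t Ht).
    - apply (eq_is_derive (V := R_NormedModule) (fun s => Im (W s))); [|assumption].
      intros t Ht; apply (HW t Ht). }
  unfold W in E; rewrite !CInt_point in E.
  rewrite !Hscal by lra.
  replace (CInt (G a) 0 1) with (0 + CInt (G a) 0 1 - 0)%C by ring.
  rewrite E; ring.
Qed.

Lemma cauchy_rect (f f' : C -> C) (a b c d eps : R) :
  0 < eps -> a < b -> c <= d ->
  (forall x t, a - eps < x < b + eps -> c - eps < t < d + eps ->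
     cderiv f (x, t) (f' (x, t)) /\ ccont f' (x, t)) ->
  (CInt (fun x => f (x, c)) a b + Ci * CInt (fun t => f (b, t)) c d =
   CInt (fun x => f (x, d)) a b + Ci * CInt (fun t => f (a, t)) c d)%C.
Proof.
  intros He Hab Hcd Hf.
  rewrite (cauchy_graph f f' a b c eps (fun _ => d) (fun _ => 0)); try assumption.
  - f_equal; apply CInt_ext; intros; change ((1, 0) : C) with (RtoC 1); ring.
  - intros x _; split; [assumption|split; [apply is_derive_Rconst|apply continuous_const]].
Qed.

Ltac ccs :=
  repeat first
   [ assumption
   | lazymatch goal with
     | |- ccont (fun _ => ?c) _ => apply ccont_const
     | |- ccont (fun t => t) _ => apply ccont_id
     | |- ccont (fun t => Cplus _ _) _ => apply ccont_plus
     | |- ccont (fun t => Cminus _ _) _ => apply ccont_minus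
     | |- ccont (fun t => Copp _) _ => apply ccont_opp
     | |- ccont (fun t => Cmult _ _) _ => apply ccont_mult
     | |- ccont (fun t => Cpow _ _) _ => apply ccont_pow
     | |- ccont (fun t => Cexp _) _ => apply (ccont_comp _ Cexp); [|apply Cexp_ccont]
     | |- ccont (fun t => RtoC _) _ => apply ccont_RtoC
     | |- ccont (fun t => (_, _)) _ => apply ccont_real_pair
     | |- ccont (Cplus ?a) ?x => change (ccont (fun t => Cplus a t) x)
     | |- ccont (Cminus ?a) ?x => change (ccont (fun t => Cminus a t) x)
     | |- ccont (Cmult ?a) ?x => change (ccont (fun t => Cmult a t) x)
     | |- ccont (pair ?a) ?x => change (ccont (fun t => (a, t)) x)
     | |- ccont RtoC ?x => change (ccont (fun t => RtoC t) x)
     | |- ccont Cexp _ => apply Cexp_ccont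
     | |- continuous (fun _ => ?c) _ => apply continuous_const
     | |- continuous (fun t => t) _ => apply continuous_id
     | |- continuous _ _ => cont_real
     end ].

(** * Means over the circle *)

Definition Eu (u : R) : C := Cexp (0, 2 * PI * u).

Lemma Cmod_Eu u : Cmod (Eu u) = 1.
Proof. unfold Eu; rewrite Cmod_Cexp; apply exp_0. Qed.

Lemma Cexp_pow z n : (Cexp z ^ n)%C = Cexp (RtoC (INR n) * z).
Proof.
  induction n as [|n IH]; simpl pow.
  - simpl INR. replace (RtoC 0 * z)%C with (RtoC 0) by ring. symmetry; apply Cexp_0.
  - change (Cexp z ^ S n)%C with (Cexp z * Cexp z ^ n)%C.
    rewrite IH, <- Cexp_plus, S_INR. f_equal. rewrite RtoC_plus; ring.
Qed.

Lemma Eu_pow u n : (Eu u ^ n)%C = Cexp (0, (2 * PI * INR n * u)%R).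
Proof. unfold Eu; rewrite Cexp_pow; f_equal; ceq. Qed.

Lemma Cexp_period x t n : Cexp (x, t + 2 * INR n * PI) = Cexp (x, t).
Proof. unfold Cexp; simpl; rewrite cos_period, sin_period; reflexivity. Qed.

Lemma CInt_Eu_pow a n : (0 < n)%nat -> CInt (fun u => Eu u ^ n)%C a (a + 1) = 0.
Proof.
  intros Hn.
  assert (Hn0 : 0 < INR n) by (apply lt_0_INR; assumption).
  pose proof PI_RGT_0 as HP.
  set (c := ((0, 2 * PI * INR n) : C)).
  assert (Hc : c <> 0).
  { intros E; apply (f_equal snd) in E; simpl in E. nra. }
  rewrite (CInt_ext _ (fun u => Cexp (0, (2 * PI * INR n * u)%R))) by (intros; apply Eu_pow).
  rewrite (CInt_FTC (fun u => / c * Cexp (0, (2 * PI * INR n * u)%R))%C).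
  - replace (2 * PI * INR n * (a + 1)) with (2 * PI * INR n * a + 2 * INR n * PI) by ring.
    rewrite Cexp_period; ring.
  - intros t _.
    replace (Cexp (0, (2 * PI * INR n * t)%R)) with (/ c * (Cexp (0, (2 * PI * INR n * t)%R) * c))%C at 1
      by (field; assumption).
    apply pderiv_mult_const, pderiv_comp; [apply cderiv_Cexp|].
    split; simpl; [apply is_derive_Rconst|]. auto_derive; trivial; ring.
  - intros t _; ccs.
Qed.

Lemma Cmod_one_minus (z : C) : 1 - Cmod z <= Cmod (1 - z).
Proof.
  pose proof (Cmod_triangle (1 - z) z) as H.
  replace (1 - z + z)%C with (RtoC 1) in H by ring. rewrite Cmod_1 in H; lra.
Qed.

Lemma Cmod_pos_neq (z : C) : 0 < Cmod z -> z <> 0.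
Proof. intros H E; rewrite E, Cmod_0 in H; lra. Qed.

Lemma Rle_0_of_small (x K q : R) : 0 <= q < 1 -> (forall n : nat, x <= K * q ^ n) -> x <= 0.
Proof.
  intros Hq H.
  destruct (Rle_dec x 0) as [|Hx]; [assumption|exfalso].
  assert (HK : 0 < K). { pose proof (H O); simpl in *; lra. }
  destruct (pow_lt_1_zero q) with (y := x / K / 2) as [N HN].
  - rewrite Rabs_right; lra.
  - apply Rdiv_lt_0_compat; [apply Rdiv_lt_0_compat|]; lra.
  - specialize (HN N (Nat.le_refl _)); specialize (H N).
    rewrite Rabs_right in HN by (apply Rle_ge, pow_le; lra).
    assert (K * q ^ N < K * (x / K / 2)) by (apply Rmult_lt_compat_l; assumption).
    replace (K * (x / K / 2)) with (x / 2) in * by (field; lra). lra.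
Qed.

(** Only the constant term of the geometric series has a nonzero mean over a period. *)
Lemma CInt_geom (A : C) (a : R) : Cmod A < 1 ->
  CInt (fun u => / (1 - A * Eu u))%C a (a + 1) = 1.
Proof.
  intros HA.
  assert (HD : forall u, 1 - Cmod A <= Cmod (1 - A * Eu u)).
  { intros u; eapply Rle_trans; [|apply Cmod_one_minus].
    rewrite Cmod_mult, Cmod_Eu; lra. }
  assert (Hne : forall u, (1 - A * Eu u <> 0)%C).
  { intros u; apply Cmod_pos_neq; specialize (HD u); lra. }
  assert (HcE : forall u, ccont Eu u) by (intros; unfold Eu; ccs).
  assert (HcI : forall u, ccont (fun u => / (1 - A * Eu u))%C u).
  { intros; apply ccont_inv; [ccs; apply HcE|apply Hne]. }
  (* The remainders of the geometric series: all equal from n = 1 on, and tending to 0. *)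
  set (J := fun n => CInt (fun u => (A * Eu u) ^ n * / (1 - A * Eu u))%C a (a + 1)).
  assert (Hc : forall n u, ccont (fun u => (A * Eu u) ^ n * / (1 - A * Eu u))%C u).
  { intros; apply ccont_mult; [|apply HcI]; ccs; apply HcE. }
  assert (Hpow : forall (x y : C) n, ((x * y) ^ n = x ^ n * y ^ n)%C).
  { intros x y n; induction n as [|n IH]; simpl; [ring|rewrite IH; ring]. }
  assert (Step : forall n, J n = (CInt (fun u => (A * Eu u) ^ n)%C a (a + 1) + J (S n))%C).
  { intros n; unfold J; rewrite <- CInt_plus.
    - apply CInt_ext; intros u _; simpl; field; apply Hne.
    - intros u _; ccs; apply HcE.
    - intros u _; apply Hc. }
  assert (Step' : forall n, J (S n) = J (S (S n))).
  { intros n; rewrite (Step (S n)) at 1.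
    rewrite (CInt_ext _ (fun u => A ^ (S n) * Eu u ^ (S n))%C) by (intros; apply Hpow).
    rewrite CInt_scal by (intros u _; ccs; apply HcE).
    rewrite CInt_Eu_pow by lia. ring. }
  assert (Hn : forall n, J 1%nat = J (S n)).
  { induction n as [|n IH]; [reflexivity|rewrite IH; apply Step']. }
  assert (HB : forall n, Cmod (J n) <= 2 / (1 - Cmod A) * Cmod A ^ n).
  { intros n; unfold J.
    eapply Rle_trans; [apply (CInt_bound_const _ (Cmod A ^ n / (1 - Cmod A)))|].
    - lra.
    - intros u _; apply Hc.
    - intros u _. rewrite Cmod_mult, Cmod_pow, Cmod_mult, Cmod_Eu, Cmod_inv, Rmult_1_r by apply Hne.
      apply Rmult_le_compat_l; [apply pow_le, Cmod_ge_0|].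
      apply Rinv_le_contravar; [lra|apply HD].
    - apply Req_le; field; lra. }
  assert (HJ : Cmod (J 1%nat) <= 0).
  { apply (Rle_0_of_small _ (2 / (1 - Cmod A) * Cmod A) (Cmod A)).
    - split; [apply Cmod_ge_0|assumption].
    - intros n; rewrite (Hn n). eapply Rle_trans; [apply HB|]. simpl; lra. }
  assert (HJ1 : J 1%nat = 0).
  { apply Cmod_eq_0; apply Rle_antisym; [assumption|apply Cmod_ge_0]. }
  transitivity (J 0%nat).
  - unfold J; apply CInt_ext; intros; simpl; ring.
  - rewrite Step, HJ1. simpl. rewrite CInt_const. replace (a + 1 - a) with 1 by ring. ring.
Qed.

(** * Boundary integrals and removable singularities *)

Lemma Cexp_eq_1 x t : Rabs t < 2 * PI -> Cexp (x, t) = 1 -> x = 0 /\ t = 0.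
Proof.
  intros Ht E.
  assert (Hx : x = 0).
  { apply (f_equal Cmod) in E; rewrite Cmod_Cexp, Cmod_1 in E; simpl in E.
    rewrite <- exp_0 in E; apply exp_inv; exact E. }
  split; [assumption|].
  apply (f_equal fst) in E; unfold Cexp in E; simpl in E; rewrite Hx, exp_0 in E.
  assert (Hc : cos t = 1) by lra.
  replace t with (2 * (t / 2)) in Hc by field. rewrite cos_2a_sin in Hc.
  assert (Hs : sin (t / 2) = 0) by nra.
  apply Rabs_def2 in Ht.
  destruct (Rtotal_order t 0) as [H|[H|H]]; [|assumption|].
  - assert (0 < sin (- (t / 2))) by (apply sin_gt_0; lra). rewrite sin_neg in *; lra.
  - assert (0 < sin (t / 2)) by (apply sin_gt_0; lra). lra.
Qed.

(** Counterclockwise integral over the boundary of the rectangle [a, b] x [c, d]. *)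
Definition bdint (F : C -> C) (a b c d : R) : C :=
  (CInt (fun x => F (x, c)) a b + Ci * CInt (fun t => F (b, t)) c d
   - CInt (fun x => F (x, d)) a b - Ci * CInt (fun t => F (a, t)) c d)%C.

Lemma bdint_zero F F' a b c d eps : 0 < eps -> a < b -> c <= d ->
  (forall x t, a - eps < x < b + eps -> c - eps < t < d + eps ->
     cderiv F (x, t) (F' (x, t)) /\ ccont F' (x, t)) ->
  bdint F a b c d = 0.
Proof.
  intros He Hab Hcd H; unfold bdint.
  rewrite (cauchy_rect F F' a b c d eps) by assumption; ring.
Qed.

Lemma ccont_slice_h F (x t : R) : ccont F (x, t) -> ccont (fun x => F (x, t)) x.
Proof. intros H; apply (ccont_comp (fun x => (x, t)) F); [ccs|assumption]. Qed.

Lemma ccont_slice_v F (x t : R) : ccont F (x, t) -> ccont (fun t => F (x, t)) t.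
Proof. intros H; apply (ccont_comp (fun t => (x, t)) F); [ccs|assumption]. Qed.

(** The integral equals the one over any small square around the singularity, which is at most a
    multiple of its side. *)
Lemma bdint_removable F F' a b c d x0 t0 eps r0 B :
  0 < eps -> a < x0 < b -> c < t0 < d ->
  (forall x t, a - eps < x < b + eps -> c - eps < t < d + eps -> (x, t) <> (x0, t0) ->
     cderiv F (x, t) (F' (x, t)) /\ ccont F' (x, t)) ->
  0 < r0 ->
  (forall x t, Rabs (x - x0) <= r0 -> Rabs (t - t0) <= r0 -> (x, t) <> (x0, t0) ->
     Cmod (F (x, t)) <= B) ->
  bdint F a b c d = 0.
Proof.
  intros He Hx Ht HF Hr0 HB.
  assert (HB0 : 0 <= B).
  { eapply Rle_trans; [apply (Cmod_ge_0 (F (x0 + r0, t0)))|]. apply HB.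
    - replace (x0 + r0 - x0) with r0 by ring. rewrite Rabs_right; lra.
    - rewrite Rminus_diag_eq, Rabs_R0; lra.
    - intros E; apply (f_equal fst) in E; simpl in E; lra. }
  assert (HC : forall x t, a <= x <= b -> c <= t <= d -> (x <> x0 \/ t <> t0) -> ccont F (x, t)).
  { intros x t Hx' Ht' Hn. destruct (HF x t) as [D _]; [lra|lra| |exact (cderiv_ccont _ _ _ D)].
    intros E; injection E; intros; destruct Hn; contradiction. }
  set (r1 := Rmin (Rmin r0 1) (Rmin (Rmin (x0 - a) (b - x0)) (Rmin (t0 - c) (d - t0)))).
  assert (Hr1 : 0 < r1) by (unfold r1; repeat apply Rmin_glb_lt; lra).
  assert (Hr1' : r1 <= r0 /\ r1 <= 1 /\ r1 <= x0 - a /\ r1 <= b - x0 /\ r1 <= t0 - c /\ r1 <= d - t0).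
  { unfold r1, Rmin; repeat destruct Rle_dec; lra. }
  (* Cauchy's theorem on the four rectangles around the square of half side r. *)
  assert (Main : forall r, 0 < r < r1 -> Cmod (bdint F a b c d) <= 16 * (r * B)).
  { intros r Hr.
    set (e := Rmin eps (r / 2)).
    assert (Hee : 0 < e /\ e <= eps /\ e <= r / 2).
    { unfold e; split; [apply Rmin_glb_lt; lra|split; [apply Rmin_l|apply Rmin_r]]. }
    assert (Z1 : bdint F a (x0 - r) c d = 0).
    { apply (bdint_zero F F' _ _ _ _ e); try lra. intros x t ? ?; apply HF; try lra.
      intros E; injection E; intros; lra. }
    assert (Z2 : bdint F (x0 + r) b c d = 0).
    { apply (bdint_zero F F' _ _ _ _ e); try lra. intros x t ? ?; apply HF; try lra.
      intros E; injection E; intros; lra. }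
    assert (Z3 : bdint F (x0 - r) (x0 + r) c (t0 - r) = 0).
    { apply (bdint_zero F F' _ _ _ _ e); try lra. intros x t ? ?; apply HF; try lra.
      intros E; injection E; intros; lra. }
    assert (Z4 : bdint F (x0 - r) (x0 + r) (t0 + r) d = 0).
    { apply (bdint_zero F F' _ _ _ _ e); try lra. intros x t ? ?; apply HF; try lra.
      intros E; injection E; intros; lra. }
    assert (E : bdint F a b c d = bdint F (x0 - r) (x0 + r) (t0 - r) (t0 + r)).
    { replace (bdint F (x0 - r) (x0 + r) (t0 - r) (t0 + r)) with
        (bdint F (x0 - r) (x0 + r) (t0 - r) (t0 + r) + bdint F a (x0 - r) c d
         + bdint F (x0 + r) b c d + bdint F (x0 - r) (x0 + r) c (t0 - r)
         + bdint F (x0 - r) (x0 + r) (t0 + r) d)%C by (rewrite Z1, Z2, Z3, Z4; ring).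
      unfold bdint.
      assert (Hh : forall t, c <= t <= d -> t <> t0 ->
        CInt (fun x => F (x, t)) a b = (CInt (fun x => F (x, t)) a (x0 - r)
          + CInt (fun x => F (x, t)) (x0 - r) (x0 + r) + CInt (fun x => F (x, t)) (x0 + r) b)%C).
      { intros t Ht1 Ht2.
        assert (Cn : forall x, a <= x <= b -> ccont (fun x => F (x, t)) x).
        { intros; apply ccont_slice_h, HC; try lra; auto. }
        rewrite (CInt_Chasles _ a (x0 - r) (x0 + r)), (CInt_Chasles _ a (x0 + r) b);
          try lra; try reflexivity;
        intros x; rewrite Rmin_left, Rmax_right by lra; intros; apply Cn; lra. }
      assert (Hv : forall x, a <= x <= b -> x <> x0 ->
        CInt (fun t => F (x, t)) c d = (CInt (fun t => F (x, t)) c (t0 - r)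
          + CInt (fun t => F (x, t)) (t0 - r) (t0 + r) + CInt (fun t => F (x, t)) (t0 + r) d)%C).
      { intros x Hx1 Hx2.
        assert (Cn : forall t, c <= t <= d -> ccont (fun t => F (x, t)) t).
        { intros; apply ccont_slice_v, HC; try lra; auto. }
        rewrite (CInt_Chasles _ c (t0 - r) (t0 + r)), (CInt_Chasles _ c (t0 + r) d);
          try lra; try reflexivity;
        intros t; rewrite Rmin_left, Rmax_right by lra; intros; apply Cn; lra. }
      rewrite (Hh c), (Hh d), (Hv (x0 - r)), (Hv (x0 + r)) by lra. ring. }
    rewrite E; unfold bdint.
    assert (Hh : forall t, Rabs (t - t0) = r -> Cmod (CInt (fun x => F (x, t)) (x0 - r) (x0 + r))
       <= 4 * (r * B)).
    { intros t Ht1.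
      assert (t <> t0) by (intros E1; rewrite E1, Rminus_diag_eq, Rabs_R0 in Ht1; lra).
      assert (c <= t <= d) by (unfold Rabs in Ht1; destruct Rcase_abs; lra).
      eapply Rle_trans; [apply (CInt_bound_const _ B)|]; try lra.
      - intros x; rewrite Rmin_left, Rmax_right by lra; intros.
        apply ccont_slice_h, HC; try lra. auto.
      - intros x Hx1; apply HB.
        + apply Rabs_le; lra.
        + lra.
        + intros E1; injection E1; intros; contradiction. }
    assert (Hv : forall x, Rabs (x - x0) = r -> Cmod (Ci * CInt (fun t => F (x, t)) (t0 - r) (t0 + r))
       <= 4 * (r * B)).
    { intros x Hx1.
      assert (x <> x0) by (intros E1; rewrite E1, Rminus_diag_eq, Rabs_R0 in Hx1; lra).
      assert (a <= x <= b) by (unfold Rabs in Hx1; destruct Rcase_abs; lra).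
      rewrite Cmod_mult, Cmod_Ci, Rmult_1_l.
      eapply Rle_trans; [apply (CInt_bound_const _ B)|]; try lra.
      - intros t; rewrite Rmin_left, Rmax_right by lra; intros.
        apply ccont_slice_v, HC; try lra. auto.
      - intros t Ht1; apply HB.
        + lra.
        + apply Rabs_le; lra.
        + intros E1; injection E1; intros; contradiction. }
    assert (R1 : forall y, Rabs (y - r - y) = r).
    { intros y; replace (y - r - y) with (- r) by ring; rewrite Rabs_Ropp; apply Rabs_right; lra. }
    assert (R2 : forall y, Rabs (y + r - y) = r).
    { intros y; replace (y + r - y) with r by ring; apply Rabs_right; lra. }
    pose proof (Hh _ (R1 t0)) as Q1; pose proof (Hh _ (R2 t0)) as Q2.
    pose proof (Hv _ (R1 x0)) as Q3; pose proof (Hv _ (R2 x0)) as Q4.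
    eapply Rle_trans; [apply Cmod_triangle|]; rewrite Cmod_opp.
    eapply Rle_trans; [apply Rplus_le_compat_r, Cmod_triangle|]; rewrite Cmod_opp.
    eapply Rle_trans; [apply Rplus_le_compat_r, Rplus_le_compat_r, Cmod_triangle|]. lra. }
  apply Cmod_eq_0, Rle_antisym; [|apply Cmod_ge_0].
  apply Rnot_lt_le; intros Hpos.
  set (m := Cmod (bdint F a b c d)) in *.
  set (r := Rmin (r1 / 2) (m / (32 * (B + 1)))).
  assert (P : 0 < m / (32 * (B + 1))) by (apply Rdiv_lt_0_compat; lra).
  assert (Hr : 0 < r < r1).
  { unfold r; split; [apply Rmin_glb_lt; lra|].
    eapply Rle_lt_trans; [apply Rmin_l|lra]. }
  specialize (Main r Hr).
  assert (r <= m / (32 * (B + 1))) by apply Rmin_r.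
  assert (r * B <= m / (32 * (B + 1)) * (B + 1)) by (apply Rmult_le_compat; lra).
  replace (m / (32 * (B + 1)) * (B + 1)) with (m / 32) in * by (field; lra). lra.
Qed.

(** * Cauchy's formula in the logarithmic coordinate *)

Lemma ccont_conj {T : UniformSpace} (f : T -> C) (x : T) :
  ccont f x -> ccont (fun t => Cconj (f t)) x.
Proof.
  intros [H1 H2]; split; simpl; [exact H1|].
  apply (continuous_opp (fun t => Im (f t))); exact H2.
Qed.

Lemma CInt_conj f a b : ccont_on f a b ->
  CInt (fun t => Cconj (f t)) a b = Cconj (CInt f a b).
Proof.
  intros H; destruct (ccont_on_ex _ _ _ H) as [H1 H2].
  unfold CInt, Cconj; simpl; f_equal.
  apply (RInt_opp (V := R_CompleteNormedModule)); exact H2.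
Qed.

Lemma Cconj_mult a b : Cconj (a * b) = (Cconj a * Cconj b)%C.
Proof. unfold Cconj; ceq. Qed.

Lemma Cconj_plus a b : Cconj (a + b) = (Cconj a + Cconj b)%C.
Proof. unfold Cconj; ceq. Qed.

Lemma Cconj_minus a b : Cconj (a - b) = (Cconj a - Cconj b)%C.
Proof. unfold Cconj; ceq. Qed.

Lemma Cconj_RtoC x : Cconj (RtoC x) = RtoC x.
Proof. unfold Cconj; ceq. Qed.

Lemma Cconj_inv z : Cconj (/ z) = (/ Cconj z)%C.
Proof.
  unfold Cconj, Cinv; simpl.
  replace (- snd z * (- snd z * 1)) with (snd z * (snd z * 1)) by ring.
  apply injective_projections; simpl; unfold Rdiv; ring.
Qed.

Lemma Cconj_Cexp z : Cconj (Cexp z) = Cexp (Cconj z).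
Proof.
  unfold Cconj, Cexp; simpl; unfold Re, Im; rewrite cos_neg, sin_neg.
  apply injective_projections; simpl; ring.
Qed.

Lemma Eu_opp u : Eu (- u) = Cconj (Eu u).
Proof. unfold Eu; rewrite Cconj_Cexp; f_equal; unfold Cconj; ceq. Qed.

Lemma Cexp_minus a b : Cexp (a - b) = (Cexp a / Cexp b)%C.
Proof. unfold Cminus; rewrite Cexp_plus, Cexp_opp; reflexivity. Qed.

Lemma CInt_geom_conj (A : C) (a : R) : Cmod A < 1 ->
  CInt (fun u => / (1 - A * Eu (- u)))%C a (a + 1) = 1.
Proof.
  intros HA.
  assert (HA' : Cmod (Cconj A) < 1) by (rewrite Cmod_conj; exact HA).
  rewrite (CInt_ext _ (fun u => Cconj (/ (1 - Cconj A * Eu u)))).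
  - rewrite CInt_conj.
    + rewrite CInt_geom by assumption. apply Cconj_RtoC.
    + intros u _. apply ccont_inv.
      * unfold Eu; ccs.
      * apply Cmod_pos_neq. eapply Rlt_le_trans; [|apply Cmod_one_minus].
        rewrite Cmod_mult, Cmod_Eu; lra.
  - intros u _. rewrite Cconj_inv, Cconj_minus, Cconj_mult, Cconj_RtoC, Eu_opp.
    replace (Cconj (Cconj A)) with A by (unfold Cconj; ceq). reflexivity.
Qed.

(** In the coordinate w = log z' this is z' / (z' - z) with z = exp w0: the Cauchy kernel relative to dw. *)
Definition ckern (w0 w : C) : C := (/ (1 - Cexp (w0 - w)))%C.

Definition ckern' (w0 w : C) : C :=
  (- / ((1 - Cexp (w0 - w)) * (1 - Cexp (w0 - w))) * Cexp (w0 - w))%C.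

Lemma cderiv_opp f z l : cderiv f z l -> cderiv (fun w => - f w)%C z (- l).
Proof.
  intros H.
  assert (E : forall w, (-(1) * f w = - f w)%C) by (intros; ring).
  destruct (cderiv_mult _ _ _ _ _ (cderiv_const (-(1))%C z) H) as [k [H1 [H2 H3]]].
  exists k; split; [|split; [assumption|]].
  - intros w; specialize (H1 w). rewrite !E in H1. exact H1.
  - rewrite H3; ring.
Qed.

Lemma cderiv_minus f g z l m :
  cderiv f z l -> cderiv g z m -> cderiv (fun w => f w - g w)%C z (l - m).
Proof. intros; apply cderiv_plus; [|apply cderiv_opp]; assumption. Qed.

Lemma cderiv_eq f z l m : cderiv f z l -> l = m -> cderiv f z m.
Proof. intros H <-; exact H. Qed.

Lemma cderiv_ckern w0 w : Cexp (w0 - w) <> 1 ->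
  cderiv (ckern w0) w (ckern' w0 w) /\ ccont (ckern' w0) w.
Proof.
  intros H.
  assert (Hn : (1 - Cexp (w0 - w) <> 0)%C).
  { intros E; apply H; symmetry; apply Csub_eq_0; exact E. }
  split.
  - eapply cderiv_eq.
    + apply (cderiv_comp Cinv (fun w => 1 - Cexp (w0 - w))%C).
      * apply cderiv_inv; exact Hn.
      * apply cderiv_minus; [apply cderiv_const|].
        apply cderiv_comp; [apply cderiv_Cexp|].
        apply cderiv_minus; [apply cderiv_const|apply cderiv_id].
    + unfold ckern'; ring.
  - unfold ckern'; apply ccont_mult; [apply ccont_opp, ccont_inv|]; ccs.
    apply Cmult_neq_0; assumption.
Qed.

Lemma locally_C_ball (w0 : C) (P : C -> Prop) : locally w0 P ->
  exists d, 0 < d /\ forall x t, Rabs (x - Re w0) < d -> Rabs (t - Im w0) < d -> P (x, t).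
Proof.
  intros [d Hd]; exists d; split; [apply cond_pos|].
  intros x t Hx Ht; apply Hd; split; [exact Hx|exact Ht].
Qed.

Lemma bdint_ext F G a b c d : (forall w, F w = G w) -> bdint F a b c d = bdint G a b c d.
Proof.
  intros H; unfold bdint.
  rewrite (CInt_ext (fun x => F (x, c)) (fun x => G (x, c))) by (intros; apply H).
  rewrite (CInt_ext (fun x => F (x, d)) (fun x => G (x, d))) by (intros; apply H).
  rewrite (CInt_ext (fun t => F (a, t)) (fun t => G (a, t))) by (intros; apply H).
  rewrite (CInt_ext (fun t => F (b, t)) (fun t => G (b, t))) by (intros; apply H).
  reflexivity.
Qed.

Lemma ccont_bdint_scal (F G : C -> C) (c : C) a b y1 y2 :
  a <= b -> y1 <= y2 ->
  (forall x t, a <= x <= b -> y1 <= t <= y2 -> (x = a \/ x = b \/ t = y1 \/ t = y2) ->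
     ccont F (x, t) /\ ccont G (x, t)) ->
  bdint (fun w => F w + c * G w)%C a b y1 y2 =
  (bdint F a b y1 y2 + c * bdint G a b y1 y2)%C.
Proof.
  intros Hab Hy H; unfold bdint.
  assert (Hh : forall t, t = y1 \/ t = y2 -> CInt (fun x => F (x, t) + c * G (x, t))%C a b =
    (CInt (fun x => F (x, t)) a b + c * CInt (fun x => G (x, t)) a b)%C).
  { intros t Ht.
    assert (HF : ccont_on (fun x => F (x, t)) a b /\ ccont_on (fun x => G (x, t)) a b).
    { split; intros x; rewrite Rmin_left, Rmax_right by lra; intros Hx;
      apply ccont_slice_h, H; try lra; destruct Ht; subst; auto; lra. }
    destruct HF as [HF HG].
    rewrite CInt_plus, CInt_scal; try assumption; [reflexivity|].
    intros x Hx; apply ccont_mult; [apply ccont_const|apply HG, Hx]. }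
  assert (Hv : forall x, x = a \/ x = b -> CInt (fun t => F (x, t) + c * G (x, t))%C y1 y2 =
    (CInt (fun t => F (x, t)) y1 y2 + c * CInt (fun t => G (x, t)) y1 y2)%C).
  { intros x Hx.
    assert (HF : ccont_on (fun t => F (x, t)) y1 y2 /\ ccont_on (fun t => G (x, t)) y1 y2).
    { split; intros t; rewrite Rmin_left, Rmax_right by lra; intros Ht;
      apply ccont_slice_v, H; try lra; destruct Hx; subst; auto; lra. }
    destruct HF as [HF HG].
    rewrite CInt_plus, CInt_scal; try assumption; [reflexivity|].
    intros t Ht; apply ccont_mult; [apply ccont_const|apply HG, Ht]. }
  rewrite (Hh y1), (Hh y2), (Hv a), (Hv b) by auto. ring.
Qed.

Lemma CInt_circle (f : R -> C) : (forall t, ccont f t) ->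
  CInt f (- PI) PI = ((2 * PI)%R * CInt (fun u => f (2 * PI * u)%R) (- (1 / 2)) (1 / 2))%C.
Proof.
  intros Hf.
  assert (Hcc : forall u, ccont (fun u => f (2 * PI * u + 0)) u).
  { intros u. destruct (Hf (2 * PI * u + 0)) as [A B].
    split; [apply (continuous_comp (fun u => 2 * PI * u + 0) (fun t => Re (f t)))
           |apply (continuous_comp (fun u => 2 * PI * u + 0) (fun t => Im (f t)))];
    try assumption; cont_real. }
  replace (- PI) with (2 * PI * (- (1 / 2)) + 0) by field.
  replace PI with (2 * PI * (1 / 2) + 0) at 2 by field.
  rewrite <- CInt_comp_lin by (intros t _; apply Hf).
  rewrite CInt_scal by (intros t _; apply Hcc).
  f_equal. apply CInt_ext; intros t _; rewrite Rplus_0_r; reflexivity.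
Qed.

(** The horizontal sides cancel because exp has period 2 pi i; on the vertical ones the mean of the
    kernel is 1 on circles surrounding z and 0 on the others. *)
Lemma bdint_ckern x0 t0 L R1 : L < x0 < R1 ->
  bdint (ckern (x0, t0)) L R1 (- PI) PI = ((2 * PI)%R * Ci)%C.
Proof.
  intros Hx; unfold bdint, ckern.
  set (w0 := ((x0, t0) : C)).
  assert (Hmod : forall x t, Cmod (Cexp (w0 - (x, t))) = exp (x0 - x)).
  { intros; rewrite Cmod_Cexp; f_equal; simpl; unfold Re; simpl; ring. }
  assert (Hne : forall x t, x = L \/ x = R1 -> (1 - Cexp (w0 - (x, t)) <> 0)%C).
  { intros x t Hxx E.
    assert (E2 : Cexp (w0 - (x, t)) = 1) by (symmetry; apply Csub_eq_0; exact E).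
    apply (f_equal Cmod) in E2; rewrite Hmod, Cmod_1, <- exp_0 in E2.
    apply exp_inv in E2; destruct Hxx; lra. }
  assert (Hc : forall x t, x = L \/ x = R1 -> ccont (fun t => / (1 - Cexp (w0 - (x, t))))%C t).
  { intros; apply ccont_inv; [ccs|apply Hne; assumption]. }
  rewrite (CInt_ext (fun x => / (1 - Cexp (w0 - (x, PI))))%C
                    (fun x => / (1 - Cexp (w0 - (x, (- PI)%R))))%C).
  2:{ intros x _; do 2 f_equal.
      replace (w0 - (x, (- PI)%R))%C with ((x0 - x, t0 - PI + 2 * INR 1 * PI) : C)
        by (apply injective_projections; simpl; ring).
      rewrite Cexp_period; f_equal; apply injective_projections; simpl; ring. }
  rewrite !CInt_circle by (intros; apply Hc; auto).
  rewrite (CInt_ext (fun u => / (1 - Cexp (w0 - (R1, (2 * PI * u)%R))))%C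
     (fun u => / (1 - Cexp (w0 - (R1, 0)) * Eu (- u)))%C).
  2:{ intros u _; do 2 f_equal; unfold Eu; rewrite <- Cexp_plus; f_equal.
      apply injective_projections; simpl; ring. }
  rewrite (CInt_ext (fun u => / (1 - Cexp (w0 - (L, (2 * PI * u)%R))))%C
     (fun u => 1 - / (1 - Cexp ((L, 0) - w0) * Eu u))%C).
  2:{ intros u _.
      assert (E : Cexp (w0 - (L, (2 * PI * u)%R)) = (/ (Cexp ((L, 0%R) - w0) * Eu u))%C).
      { unfold Eu; rewrite <- Cexp_plus, <- Cexp_opp; f_equal.
        apply injective_projections; simpl; ring. }
      assert (H1 := Hne L (2 * PI * u) (or_introl eq_refl)).
      rewrite E in *.
      assert (H2 : (Cexp ((L, 0%R) - w0) * Eu u <> 0)%C).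
      { apply Cmult_neq_0; apply Cexp_neq_0. }
      set (q := (Cexp ((L, 0%R) - w0) * Eu u)%C) in *.
      assert (H3 : (1 - q <> 0)%C).
      { intros E3; apply H1. replace q with (RtoC 1) by (apply Csub_eq_0; exact E3).
        field. }
      assert (H4 : (q - 1 <> 0)%C).
      { intros E4; apply H3; replace (1 - q)%C with (- (q - 1))%C by ring. rewrite E4; ring. }
      field; repeat split; assumption. }
  assert (HA1 : Cmod (Cexp (w0 - (R1, 0))) < 1).
  { rewrite Hmod, <- exp_0; apply exp_increasing; lra. }
  assert (HA2 : Cmod (Cexp ((L, 0) - w0)) < 1).
  { rewrite Cmod_Cexp, <- exp_0; apply exp_increasing; simpl; unfold Re; simpl; lra. }
  rewrite CInt_minus.
  - rewrite CInt_const.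
    replace (CInt (fun u => / (1 - Cexp ((L, 0%R) - w0) * Eu u))%C (- (1 / 2)) (1 / 2)) with (RtoC 1).
    2:{ replace (1/2) with (- (1/2) + 1) at 2 by field. symmetry; apply CInt_geom; exact HA2. }
    replace (CInt (fun u => / (1 - Cexp (w0 - (R1, 0%R)) * Eu (- u)))%C (- (1 / 2)) (1 / 2)) with (RtoC 1).
    2:{ replace (1/2) with (- (1/2) + 1) at 2 by field. symmetry; apply CInt_geom_conj; exact HA1. }
    replace (1 / 2 - - (1 / 2)) with 1 by field. ring.
  - intros t _; apply ccont_const.
  - intros t _; apply ccont_inv; [unfold Eu; ccs|].
    apply Cmod_pos_neq. eapply Rlt_le_trans; [|apply Cmod_one_minus].
    rewrite Cmod_mult, Cmod_Eu; lra.
Qed.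

(** Subtracting psi w0 from psi makes the singularity removable, which reduces the formula to the
    kernel itself. Points with |Im w| < pi are exactly those seen by the principal logarithm. *)
Lemma cauchy_formula (psi psi' : C -> C) x0 t0 L R1 :
  (forall w, cderiv psi w (psi' w) /\ ccont psi' w) ->
  L < x0 < R1 -> - PI < t0 < PI ->
  bdint (fun w => psi w * ckern (x0, t0) w)%C L R1 (- PI) PI =
  ((2 * PI)%R * Ci * psi (x0, t0))%C.
Proof.
  intros Hpsi Hx Ht.
  set (w0 := ((x0, t0) : C)).
  assert (Hne : forall x t, Rabs (t0 - t) < 2 * PI -> (x, t) <> w0 -> Cexp (w0 - (x, t)) <> 1).
  { intros x t Htt Hn E.
    replace (w0 - (x, t))%C with ((x0 - x, t0 - t) : C) in E
      by (apply injective_projections; simpl; ring).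
    apply Cexp_eq_1 in E; [|assumption]. apply Hn; unfold w0; f_equal; lra. }
  assert (HK : forall x t, Rabs (t0 - t) < 2 * PI -> (x, t) <> w0 ->
     cderiv (ckern w0) (x, t) (ckern' w0 (x, t)) /\ ccont (ckern' w0) (x, t)).
  { intros; apply cderiv_ckern, Hne; assumption. }
  set (F := fun w => ((psi w - psi w0) * ckern w0 w)%C).
  set (F' := fun w => ((psi' w - 0) * ckern w0 w + (psi w - psi w0) * ckern' w0 w)%C).
  assert (Hpc : forall w, ccont psi w) by (intros w; apply (cderiv_ccont _ _ _ (proj1 (Hpsi w)))).
  assert (Z : bdint F L R1 (- PI) PI = 0).
  { destruct (Hpsi w0) as [[k [Hk1 [Hk2 Hk3]]] _].
    destruct (Cexp_near_0 (1 / 2)) as [d1 [Hd1 Hd2]]; [lra|].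
    destruct (locally_C_ball w0 _ (ccont_Cmod k w0 Hk2 1 ltac:(lra))) as [d2 [Hd3 Hd4]].
    set (eps := Rmin (PI - t0) (PI + t0)).
    assert (Heps : 0 < eps /\ eps <= PI - t0 /\ eps <= PI + t0).
    { unfold eps; split; [apply Rmin_glb_lt; lra|split; [apply Rmin_l|apply Rmin_r]]. }
    apply (bdint_removable F F' L R1 (- PI) PI x0 t0 eps (Rmin (d1 / 4) (d2 / 2))
             (2 * (Cmod (k w0) + 1))); try lra.
    - intros x t Hx1 Ht1 Hn.
      assert (Hab : Rabs (t0 - t) < 2 * PI) by (apply Rabs_def1; lra).
      destruct (HK x t Hab Hn) as [D1 D2]; destruct (Hpsi (x, t)) as [D3 D4].
      split.
      + apply (cderiv_mult (fun w => psi w - psi w0)%C (ckern w0)); [|exact D1].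
        apply (cderiv_minus psi (fun _ => psi w0)); [exact D3|apply cderiv_const].
      + unfold F'; apply ccont_plus; apply ccont_mult; ccs.
        * exact (cderiv_ccont _ _ _ D1).
        * apply Hpc.
    - apply Rmin_glb_lt; lra.
    - intros x t Hx1 Ht1 Hn.
      assert (Rmin (d1 / 4) (d2 / 2) <= d1 / 4) by apply Rmin_l.
      assert (Rmin (d1 / 4) (d2 / 2) <= d2 / 2) by apply Rmin_r.
      assert (Hkb : Cmod (k (x, t)) <= Cmod (k w0) + 1).
      { assert (Hlt : Cmod (k (x, t) - k w0) < 1).
        { apply Hd4; unfold w0, Re, Im; simpl; lra. }
        pose proof (Cmod_triangle (k (x, t) - k w0) (k w0)) as Tr.
        replace (k (x, t) - k w0 + k w0)%C with (k (x, t)) in Tr by ring. lra. }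
      set (h := (w0 - (x, t))%C).
      assert (Hh : Cmod h < d1).
      { eapply Rle_lt_trans; [apply Cmod_le_abs|]; unfold h, w0, Re, Im; simpl.
        replace (x0 + - x) with (- (x - x0)) by ring. replace (t0 + - t) with (- (t - t0)) by ring.
        rewrite !Rabs_Ropp; lra. }
      assert (Hhn : h <> 0).
      { intros E; apply Hn. symmetry; apply Csub_eq_0; exact E. }
      assert (Hhp : 0 < Cmod h) by (apply Cmod_gt_0; exact Hhn).
      assert (Hlow : Cmod h / 2 <= Cmod (1 - Cexp h)).
      { specialize (Hd2 h Hh).
        pose proof (Cmod_triangle (1 - Cexp h) (Cexp h - 1 - h)) as Tr.
        replace (1 - Cexp h + (Cexp h - 1 - h))%C with (- h)%C in Tr by ring.
        rewrite Cmod_opp in Tr. lra. }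
      assert (H1h : (1 - Cexp h <> 0)%C) by (apply Cmod_pos_neq; lra).
      unfold F, ckern; fold h.
      rewrite (Hk1 (x, t)).
      replace (psi w0 + ((x, t) - w0) * k (x, t) - psi w0)%C with (- h * k (x, t))%C
        by (unfold h; ring).
      rewrite !Cmod_mult, Cmod_opp, Cmod_inv by assumption.
      apply Rle_trans with (Cmod h * (Cmod (k w0) + 1) * / (Cmod h / 2)).
      + apply Rmult_le_compat.
        * apply Rmult_le_pos; apply Cmod_ge_0.
        * left; apply Rinv_0_lt_compat; lra.
        * apply Rmult_le_compat_l; lra.
        * apply Rinv_le_contravar; lra.
      + apply Req_le; field; lra. }
  assert (HcK : forall x t, L <= x <= R1 -> - PI <= t <= PI ->
      (x = L \/ x = R1 \/ t = - PI \/ t = PI) -> ccont (ckern w0) (x, t)).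
  { intros x t Hx1 Ht1 Hor.
    destruct (HK x t) as [D _].
    - apply Rabs_def1; lra.
    - intros E; injection E; intros; subst; lra.
    - exact (cderiv_ccont _ _ _ D). }
  transitivity (bdint (fun w => F w + psi w0 * ckern w0 w)%C L R1 (- PI) PI).
  { apply bdint_ext; intros; unfold F; ring. }
  rewrite ccont_bdint_scal.
  - rewrite Z. unfold w0; rewrite bdint_ckern by assumption. ring.
  - lra.
  - lra.
  - intros x t Hx1 Ht1 Hor; split; [|apply HcK; assumption].
    apply ccont_mult; [ccs; apply Hpc|apply HcK; assumption].
Qed.

(** * Poisson summation in Abel's form *)

(** The sum over all integers k of rho^|k| exp (2 pi i k u). *)
Definition poissonk (rho u : R) : R := (1 - rho ^ 2) / Cmod (1 - rho * Eu u) ^ 2.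

Lemma one_minus_rhoE_pos (rho u : R) : 0 <= rho < 1 -> 0 < Cmod (1 - rho * Eu u).
Proof.
  intros H; eapply Rlt_le_trans; [|apply Cmod_one_minus].
  rewrite Cmod_mult, Cmod_Eu, Cmod_R, Rabs_right; lra.
Qed.

Lemma poissonk_pos (rho u : R) : 0 <= rho < 1 -> 0 <= poissonk rho u.
Proof.
  intros H; unfold poissonk; apply Rle_div_r.
  - apply pow_lt, one_minus_rhoE_pos; assumption.
  - nra.
Qed.

(** Splitting into k >= 0 and k <= 0: each half is holomorphic in one half plane, which allows moving
    the path of integration. *)
Lemma poissonkE (rho u : R) : 0 <= rho < 1 ->
  RtoC (poissonk rho u) = (/ (1 - rho * Eu u) + / (1 - rho * Eu (- u)) - 1)%C.
Proof.
  intros H.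
  pose proof (one_minus_rhoE_pos rho u H) as Hp.
  pose proof (Cmod_pos_neq _ Hp) as Hn.
  assert (HE : (Eu u * Eu (- u) = 1)%C).
  { unfold Eu; rewrite <- Cexp_plus.
    replace ((0, (2 * PI * u)%R) + (0, (2 * PI * - u)%R))%C with (RtoC 0) by ceq. apply Cexp_0. }
  assert (Hcj : (1 - rho * Eu (- u) = Cconj (1 - rho * Eu u))%C).
  { rewrite Cconj_minus, Cconj_mult, !Cconj_RtoC, Eu_opp; reflexivity. }
  assert (Hn' : (1 - rho * Eu (- u) <> 0)%C).
  { apply Cmod_pos_neq; rewrite Hcj, Cmod_conj; exact Hp. }
  unfold poissonk.
  assert (H2 : Cmod (1 - rho * Eu u) ^ 2 <> 0) by (apply pow_nonzero; lra).
  rewrite RtoC_div, Cmod2_conj, <- Hcj by assumption.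
  rewrite RtoC_minus, RtoC_pow.
  replace (RtoC rho ^ 2)%C with (rho * rho * (Eu u * Eu (- u)))%C by (rewrite HE; simpl; ring).
  field_simplify; [|split; assumption|split; assumption].
  f_equal; ring.
Qed.

Lemma ccont_Eu u : ccont Eu u.
Proof. unfold Eu; ccs. Qed.

Lemma ccont_inv_Eu (rho u : R) : 0 <= rho < 1 -> ccont (fun u => / (1 - rho * Eu u))%C u.
Proof.
  intros H; apply ccont_inv; [ccs; apply ccont_Eu|].
  apply Cmod_pos_neq, one_minus_rhoE_pos; assumption.
Qed.

Lemma ccont_inv_Eu_opp (rho u : R) : 0 <= rho < 1 -> ccont (fun u => / (1 - rho * Eu (- u)))%C u.
Proof.
  intros H; apply ccont_inv; [unfold Eu; ccs|].
  apply Cmod_pos_neq, one_minus_rhoE_pos; assumption.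
Qed.

Lemma ccont_poissonk (rho u : R) : 0 <= rho < 1 -> ccont (fun u => RtoC (poissonk rho u)) u.
Proof.
  intros H; apply (ccont_ext (fun u => / (1 - rho * Eu u) + / (1 - rho * Eu (- u)) - 1)%C).
  - intros t; symmetry; apply poissonkE; assumption.
  - apply ccont_minus; [apply ccont_plus|apply ccont_const].
    + apply ccont_inv_Eu; assumption.
    + apply ccont_inv_Eu_opp; assumption.
Qed.

Lemma CInt_poissonk (rho a : R) : 0 <= rho < 1 ->
  CInt (fun u => RtoC (poissonk rho u)) a (a + 1) = 1.
Proof.
  intros H.
  rewrite (CInt_ext _ (fun u => / (1 - rho * Eu u) + / (1 - rho * Eu (- u)) - 1)%C)
    by (intros; apply poissonkE; assumption).
  assert (Hr : Cmod rho < 1) by (rewrite Cmod_R, Rabs_right; lra).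
  rewrite CInt_minus, CInt_plus, CInt_geom, CInt_geom_conj, CInt_const; try assumption.
  - replace (a + 1 - a) with 1 by ring. ring.
  - intros t _; apply ccont_inv_Eu; assumption.
  - intros t _; apply ccont_inv_Eu_opp; assumption.
  - intros t _; apply ccont_plus; [apply ccont_inv_Eu|apply ccont_inv_Eu_opp]; assumption.
  - intros t _; apply ccont_const.
Qed.

Lemma RInt_poissonk (rho a : R) : 0 <= rho < 1 -> RInt (poissonk rho) a (a + 1) = 1.
Proof.
  intros H; pose proof (f_equal fst (CInt_poissonk rho a H)) as E; exact E.
Qed.

Lemma Eu_shift (u : R) (j : nat) : Eu (u + INR j) = Eu u.
Proof.
  unfold Eu. replace (2 * PI * (u + INR j)) with (2 * PI * u + 2 * INR j * PI) by ring.
  apply Cexp_period.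
Qed.

Lemma poissonk_far (rho t del : R) (j : nat) : 1 / 2 <= rho < 1 -> 0 < del -> del <= Rabs t <= 1 / 2 ->
  poissonk rho (t + INR j) <= (1 - rho ^ 2) / (1 - cos (2 * PI * del)).
Proof.
  intros Hr Hd Ht; unfold poissonk; rewrite Eu_shift.
  pose proof PI_RGT_0 as HP.
  assert (Hcos : cos (2 * PI * t) <= cos (2 * PI * del)).
  { replace (cos (2 * PI * t)) with (cos (2 * PI * Rabs t)).
    - apply cos_decr_1; nra.
    - unfold Rabs; destruct Rcase_abs; [|reflexivity].
      replace (2 * PI * - t) with (- (2 * PI * t)) by ring. apply cos_neg. }
  assert (Hc1 : cos (2 * PI * del) < 1).
  { rewrite <- cos_0; apply cos_decreasing_1; nra. }
  assert (E : Cmod (1 - rho * Eu t) ^ 2 =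
              (1 - rho) ^ 2 + 2 * rho * (1 - cos (2 * PI * t))).
  { rewrite Cmod2_alt; unfold Eu, Cexp; simpl; rewrite exp_0.
    pose proof (sin2_cos2 (2 * PI * t)) as S; unfold Rsqr in S.
    set (c := cos (2 * PI * t)) in *; set (s := sin (2 * PI * t)) in *.
    transitivity (1 - 2 * rho * c + rho * rho * (s * s + c * c)); [ring|rewrite S; ring]. }
  rewrite E.
  apply Rmult_le_compat_l; [nra|].
  apply Rinv_le_contravar; [lra|].
  assert (0 <= (1 - rho) ^ 2) by apply pow2_ge_0. nra.
Qed.

Lemma abel_term {I : Type} (F : I -> R -> C) (j : nat) (B : R) :
  (forall i u, INR j - 1 / 2 <= u <= INR j + 1 / 2 -> ccont (F i) u) ->
  (forall i u, INR j - 1 / 2 <= u <= INR j + 1 / 2 -> Cmod (F i u) <= B) ->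
  (forall eps, 0 < eps -> exists del, 0 < del /\ forall i u, Rabs (u - INR j) < del ->
     Cmod (F i u - F i (INR j)) <= eps) ->
  forall eps, 0 < eps -> exists rho0, rho0 < 1 /\ forall rho, rho0 < rho < 1 -> 0 <= rho -> forall i,
    Cmod (CInt (fun u => F i u * poissonk rho u)%C (INR j - 1 / 2) (INR j + 1 / 2) - F i (INR j))
      <= eps.
Proof.
  intros Hc HB He eps Heps.
  destruct (He (eps / 4)) as [del0 [Hd0 Hdel0]]; [lra|].
  set (del := Rmin del0 (1 / 2)).
  assert (Hd : 0 < del) by (apply Rmin_glb_lt; lra).
  assert (Hd2 : del <= 1 / 2) by apply Rmin_r.
  assert (Hd1 : del <= del0) by apply Rmin_l.
  pose proof PI_RGT_0 as HP.
  assert (Hc1 : cos (2 * PI * del) < 1).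
  { rewrite <- cos_0; apply cos_decreasing_1; nra. }
  set (m := 1 - cos (2 * PI * del)) in *.
  assert (Hm : 0 < m) by (unfold m; lra).
  set (B' := Rabs B + 1).
  assert (HB' : 0 < B' /\ B <= B').
  { unfold B'; pose proof (Rabs_pos B); pose proof (Rle_abs B); lra. }
  assert (Hx : 0 < eps * m / (16 * B')) by (apply Rdiv_lt_0_compat; nra).
  exists (Rmax (1 / 2) (1 - eps * m / (16 * B'))); split.
  { apply Rmax_lub_lt; lra. }
  intros rho [Hr1 Hr2] Hr0 i.
  assert (Hr3 : 1 / 2 <= rho) by (pose proof (Rmax_l (1 / 2) (1 - eps * m / (16 * B'))); lra).
  assert (Hr4 : 1 - rho < eps * m / (16 * B')).
  { pose proof (Rmax_r (1 / 2) (1 - eps * m / (16 * B'))); lra. }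
  assert (Hfar : (1 - rho ^ 2) / m <= eps / (8 * B')).
  { apply Rle_div_l; [assumption|].
    replace (eps / (8 * B') * m) with (2 * (eps * m / (16 * B'))) by (field; lra).
    nra. }
  assert (Hrr : 0 <= rho < 1) by lra.
  assert (Ej : INR j + 1 / 2 = INR j - 1 / 2 + 1) by field.
  assert (Cj : ccont_on (F i) (INR j - 1 / 2) (INR j + 1 / 2)).
  { intros u; rewrite Rmin_left, Rmax_right by lra; intros; apply Hc; assumption. }
  assert (Cp : forall u, ccont (fun u => RtoC (poissonk rho u)) u)
    by (intros; apply ccont_poissonk; assumption).
  assert (E1 : F i (INR j) = CInt (fun u => F i (INR j) * poissonk rho u)%C (INR j - 1 / 2) (INR j + 1 / 2)).
  { rewrite CInt_scal by (intros t _; apply Cp).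
    rewrite Ej, CInt_poissonk by assumption. ring. }
  rewrite E1 at 1.
  rewrite <- CInt_minus.
  2:{ intros u Hu; apply ccont_mult; [apply Cj; assumption|apply Cp]. }
  2:{ intros u Hu; apply ccont_mult; [apply ccont_const|apply Cp]. }
  assert (Exp : ex_RInt (poissonk rho) (INR j - 1 / 2) (INR j + 1 / 2)).
  { apply (ccont_on_ex (fun u => RtoC (poissonk rho u))). intros u _; apply Cp. }
  eapply Rle_trans.
  - apply (CInt_bound _ (fun u => eps / 4 * poissonk rho u + 2 * B' * (eps / (8 * B')))).
    + lra.
    + intros u Hu; apply ccont_minus; apply ccont_mult; try apply Cp; try apply ccont_const.
      apply Cj; assumption.
    + intros u Hu.
      replace (F i u * poissonk rho u - F i (INR j) * poissonk rho u)%C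
        with ((F i u - F i (INR j)) * poissonk rho u)%C by ring.
      rewrite Cmod_mult, Cmod_R, (Rabs_right (poissonk rho u))
        by (apply Rle_ge, poissonk_pos; assumption).
      pose proof (poissonk_pos rho u Hrr) as Pp.
      assert (Pos2 : 0 <= 2 * B' * (eps / (8 * B'))).
      { replace (2 * B' * (eps / (8 * B'))) with (eps / 4) by (field; lra). lra. }
      destruct (Rlt_le_dec (Rabs (u - INR j)) del) as [Hn|Hf].
      * assert (Cmod (F i u - F i (INR j)) <= eps / 4) by (apply Hdel0; lra).
        apply Rle_trans with (eps / 4 * poissonk rho u); [|lra].
        apply Rmult_le_compat_r; assumption.
      * assert (Hp : poissonk rho u <= eps / (8 * B')).
        { replace u with (u - INR j + INR j) by ring.
          eapply Rle_trans; [apply poissonk_far with (del := del)|exact Hfar]; try lra.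
          split; [assumption|]. apply Rabs_le; lra. }
        assert (Hb : Cmod (F i u - F i (INR j)) <= 2 * B').
        { eapply Rle_trans; [apply Cmod_triangle|]; rewrite Cmod_opp.
          assert (Cmod (F i u) <= B) by (apply HB; assumption).
          assert (Cmod (F i (INR j)) <= B) by (apply HB; lra). lra. }
        apply Rle_trans with (2 * B' * (eps / (8 * B'))).
        -- apply Rmult_le_compat; try assumption. apply Cmod_ge_0.
        -- assert (0 <= eps / 4 * poissonk rho u) by (apply Rmult_le_pos; lra). lra.
    + apply (ex_RInt_plus (V := R_NormedModule)).
      * apply (ex_RInt_scal (V := R_NormedModule)); exact Exp.
      * apply ex_RInt_const.
  - rewrite (RInt_plus (V := R_CompleteNormedModule) (fun u => eps / 4 * poissonk rho u)).
    + rewrite (RInt_scal (V := R_CompleteNormedModule)) by exact Exp.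
      rewrite RInt_const. unfold plus, scal; simpl; unfold mult; simpl.
      rewrite Ej, RInt_poissonk by assumption. 
      replace (2 * B' * (eps / (8 * B'))) with (eps / 4) by (field; lra). lra.
    + apply (ex_RInt_scal (V := R_NormedModule)); exact Exp.
    + apply ex_RInt_const.
Qed.

(** The Poisson kernel is an approximate identity at every integer. A whole family of functions is
    treated at once, since rho must be fixed before the point z of the sector: the polynomials of the
    approximation depend on rho. *)
Lemma abel_sum {I : Type} (F : I -> R -> C) (M : nat) (B : R) :
  (forall i u, 1 / 2 <= u <= INR M + 1 / 2 -> ccont (F i) u) ->
  (forall i u, 1 / 2 <= u <= INR M + 1 / 2 -> Cmod (F i u) <= B) ->
  (forall j, (1 <= j <= M)%nat -> forall eps, 0 < eps -> exists del, 0 < del /\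
     forall i u, Rabs (u - INR j) < del -> Cmod (F i u - F i (INR j)) <= eps) ->
  forall eps, 0 < eps -> exists rho0, rho0 < 1 /\ forall rho, rho0 < rho < 1 -> 0 <= rho -> forall i,
    Cmod (CInt (fun u => F i u * poissonk rho u)%C (1 / 2) (INR M + 1 / 2)
          - sum_n_m (fun j => F i (INR j)) 1 M) <= eps.
Proof.
  induction M as [|M IH]; intros Hc HB He eps Heps.
  - exists 0; split; [lra|]; intros rho _ _ i.
    rewrite sum_n_m_zero by lia. simpl. rewrite Rplus_0_l, CInt_point.
    change (zero : C) with (RtoC 0). replace (0 - 0)%C with (RtoC 0) by ring.
    rewrite Cmod_0; lra.
  - rewrite S_INR in Hc, HB.
    assert (HM : 0 <= INR M) by apply pos_INR.
    destruct (IH) with (eps := eps / 2) as [r1 [Hr1 H1]]; try lra.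
    { intros; apply Hc; lra. } { intros; apply HB; lra. }
    { intros; apply He; [lia|assumption]. }
    destruct (abel_term F (S M) B) with (eps := eps / 2) as [r2 [Hr2 H2]]; try lra.
    { rewrite S_INR; intros; apply Hc; lra. } { rewrite S_INR; intros; apply HB; lra. }
    { apply He; lia. }
    exists (Rmax r1 r2); split; [apply Rmax_lub_lt; assumption|].
    intros rho Hrho Hr0 i.
    pose proof (Rmax_l r1 r2); pose proof (Rmax_r r1 r2).
    specialize (H1 rho ltac:(lra) Hr0 i); specialize (H2 rho ltac:(lra) Hr0 i).
    rewrite sum_n_Sm by lia. change (plus : C -> C -> C) with Cplus.
    rewrite S_INR in *.
    replace (INR M + 1 - 1 / 2) with (INR M + 1 / 2) in H2 by field.
    rewrite <- (CInt_Chasles _ (1 / 2) (INR M + 1 / 2) (INR M + 1 + 1 / 2)).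
    + match goal with |- Cmod ?e <= _ => match type of H1 with Cmod ?x <= _ =>
        match type of H2 with Cmod ?y <= _ => replace e with (x + y)%C end end end.
      * eapply Rle_trans; [apply Cmod_triangle|]; lra.
      * ring.
    + lra.
    + intros u; rewrite Rmin_left, Rmax_right by lra; intros; apply ccont_mult.
      * apply Hc; lra.
      * apply ccont_poissonk; lra.
Qed.

(** * Polynomial functions *)

(** Horner form of a polynomial function of degree at most n: it suits inductions, and [isPoly_coef]
    recovers the coefficients. *)
Fixpoint isPoly (n : nat) (P : C -> C) : Prop :=
  match n with
  | O => exists c, forall z, P z = c
  | S n => exists c Q, isPoly n Q /\ forall z, P z = (c + z * Q z)%C
  end.

Lemma isPoly_ext n P Q : (forall z, P z = Q z) -> isPoly n P -> isPoly n Q.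
Proof.
  destruct n as [|n]; simpl; intros E.
  - intros [c H]; exists c; intros z; rewrite <- E; apply H.
  - intros [c [R [H1 H2]]]; exists c, R; split; [assumption|]. intros z; rewrite <- E; apply H2.
Qed.

Lemma isPoly_const n c : isPoly n (fun _ => c).
Proof.
  revert c; induction n as [|n IH]; intros c; simpl.
  - exists c; reflexivity.
  - exists c, (fun _ => RtoC 0); split; [apply IH|intros; ring].
Qed.

Lemma isPoly_plus n P Q : isPoly n P -> isPoly n Q -> isPoly n (fun z => P z + Q z)%C.
Proof.
  revert P Q; induction n as [|n IH]; simpl; intros P Q.
  - intros [c H] [d K]; exists (c + d)%C; intros z; rewrite H, K; reflexivity.
  - intros [c [P1 [H1 H2]]] [d [Q1 [K1 K2]]]. exists (c + d)%C, (fun z => P1 z + Q1 z)%C.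
    split; [apply IH; assumption|]. intros z; rewrite H2, K2; ring.
Qed.

Lemma isPoly_scal n c P : isPoly n P -> isPoly n (fun z => c * P z)%C.
Proof.
  revert P; induction n as [|n IH]; simpl; intros P.
  - intros [d H]; exists (c * d)%C; intros z; rewrite H; reflexivity.
  - intros [d [P1 [H1 H2]]]. exists (c * d)%C, (fun z => c * P1 z)%C.
    split; [apply IH; assumption|]. intros z; rewrite H2; ring.
Qed.

Lemma isPoly_S n P : isPoly n P -> isPoly (S n) P.
Proof.
  revert P; induction n as [|n IH]; intros P.
  - intros [c H]; exists c, (fun _ => RtoC 0); split; [apply isPoly_const|].
    intros z; rewrite H; ring.
  - intros [c [Q [H1 H2]]]; exists c, Q; split; [apply IH; assumption|assumption].
Qed.

Lemma isPoly_le n m P : (n <= m)%nat -> isPoly n P -> isPoly m P.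
Proof. intros H HP; induction H; [assumption|apply isPoly_S; assumption]. Qed.

Lemma isPoly_mulX n P : isPoly n P -> isPoly (S n) (fun z => z * P z)%C.
Proof. intros H; exists (RtoC 0), P; split; [assumption|intros; ring]. Qed.

Lemma isPoly_mult n m P Q : isPoly n P -> isPoly m Q -> isPoly (n + m) (fun z => P z * Q z)%C.
Proof.
  revert P; induction n as [|n IH]; intros P HP HQ.
  - destruct HP as [c H]. apply (isPoly_ext _ (fun z => c * Q z)%C).
    + intros z; rewrite H; reflexivity.
    + apply isPoly_scal; assumption.
  - destruct HP as [c [P1 [H1 H2]]].
    apply (isPoly_ext _ (fun z => c * Q z + z * (P1 z * Q z))%C).
    + intros z; rewrite H2; ring.
    + apply isPoly_plus.
      * apply (isPoly_le m); [lia|]. apply isPoly_scal; assumption.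
      * apply (isPoly_mulX (n + m)), IH; assumption.
Qed.

Lemma isPoly_pow D P n : isPoly D P -> isPoly (D * n) (fun z => P z ^ n)%C.
Proof.
  intros H; induction n as [|n IH].
  - exact (isPoly_const (D * 0) 1).
  - replace (D * S n)%nat with (D + D * n)%nat by lia. simpl.
    apply isPoly_mult; assumption.
Qed.

(** In Horner form the quotient by z - b is obtained by induction. *)
Lemma isPoly_div n P b : isPoly n P ->
  exists Q, isPoly n Q /\ forall z, (P z - P b = (z - b) * Q z)%C.
Proof.
  revert P; induction n as [|n IH]; intros P HP.
  - destruct HP as [c H]. exists (fun _ => RtoC 0); split; [apply isPoly_const|].
    intros z; rewrite !H; ring.
  - destruct HP as [c [P1 [H1 H2]]]. destruct (IH P1 H1) as [R [HR1 HR2]].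
    exists (fun z => P1 z + b * R z)%C; split.
    + apply isPoly_S, isPoly_plus; [assumption|apply isPoly_scal; assumption].
    + intros z; rewrite !H2.
      replace (c + z * P1 z - (c + b * P1 b))%C
        with ((z - b) * P1 z + b * (P1 z - P1 b))%C by ring.
      rewrite HR2; ring.
Qed.

Lemma isPoly_conj n P : isPoly n P -> isPoly n (fun z => Cconj (P (Cconj z))).
Proof.
  revert P; induction n as [|n IH]; simpl; intros P.
  - intros [c H]; exists (Cconj c); intros z; rewrite H; reflexivity.
  - intros [c [Q [H1 H2]]]; exists (Cconj c), (fun z => Cconj (Q (Cconj z))).
    split; [apply IH; assumption|].
    intros z; rewrite H2, Cconj_plus, Cconj_mult.
    replace (Cconj (Cconj z)) with z by (unfold Cconj; ceq). reflexivity.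
Qed.

Lemma isPoly_coef n P : isPoly n P ->
  exists c : nat -> C, forall z, P z = sum_n (fun k => (c k * z ^ k)%C) n.
Proof.
  revert P; induction n as [|n IH]; intros P.
  - intros [c H]; exists (fun _ => c); intros z; rewrite sum_O, H; simpl; ring.
  - intros [c [Q [H1 H2]]]. destruct (IH Q H1) as [q Hq].
    exists (fun k => match k with O => c | S k => q k end).
    intros z; rewrite H2, Hq.
    unfold sum_n; rewrite (sum_Sn_m _ 0 (S n)) by lia.
    rewrite <- sum_n_m_S.
    rewrite <- (sum_n_m_mult_l (K := C_Ring) z).
    change (plus : C -> C -> C) with Cplus; simpl.
    f_equal; [ring|].
    apply sum_n_m_ext; intros k; change (mult : C -> C -> C) with Cmult; simpl. ring.
Qed.

(** If the coefficient of z ^ n vanishes, a tiny one is put in its place. *)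
Lemma isPoly_exact n P eps : isPoly n P -> 0 < eps ->
  exists P', polynomial_of_degree n P' /\
    forall z, Cmod z <= 1 -> Cmod (P' z - P z) <= eps.
Proof.
  intros HP He; destruct (isPoly_coef n P HP) as [c Hc].
  destruct (Ceq_dec (c n) 0) as [E|NE].
  - exists (fun z => sum_n (fun k => ((if Nat.eq_dec k n then RtoC eps else c k) * z ^ k)%C) n).
    split.
    + eexists; split; [|intros z; reflexivity]. cbv beta.
      destruct (Nat.eq_dec n n); [|congruence].
      apply Cmod_pos_neq; rewrite Cmod_R, Rabs_right; lra.
    + intros z Hz; rewrite Hc.
      replace (_ - _)%C with (RtoC eps * z ^ n)%C.
      * rewrite Cmod_mult, Cmod_pow, Cmod_R, Rabs_right by lra.
        assert (Cmod z ^ n <= 1 ^ n) by (apply pow_incr; split; [apply Cmod_ge_0|assumption]).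
        rewrite pow1 in *. nra.
      * destruct n as [|n].
        -- rewrite !sum_O, E; simpl. ring.
        -- rewrite !sum_Sn; change (plus : C -> C -> C) with Cplus.
           destruct (Nat.eq_dec (S n) (S n)); [|congruence]. rewrite E.
           rewrite (sum_n_ext_loc _ (fun k => c k * z ^ k)%C n).
           ++ ring.
           ++ intros k Hk; destruct (Nat.eq_dec k (S n)); [lia|reflexivity].
  - exists P; split; [exists c; split; assumption|].
    intros z _; replace (P z - P z)%C with (RtoC 0) by ring. rewrite Cmod_0; lra.
Qed.

(** * Taylor approximation of Cauchy integrals *)

(** The truncated geometric series in Horner form, which makes its integrals polynomials in Horner form. *)
Fixpoint geoC (n : nat) (x : C) : C :=
  match n with O => 1 | S n => (1 + x * geoC n x)%C end.

Lemma geoC_eq n x : ((1 - x) * geoC n x = 1 - x ^ S n)%C.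
Proof.
  induction n as [|n IH]; simpl; [ring|].
  replace ((1 - x) * (1 + x * geoC n x))%C with (1 - x + x * ((1 - x) * geoC n x))%C by ring.
  rewrite IH; simpl; ring.
Qed.

Lemma ccont_geoC {T : UniformSpace} (f : T -> C) n (x : T) :
  ccont f x -> ccont (fun t => geoC n (f t)) x.
Proof.
  intros H; induction n as [|n IH]; simpl; ccs.
Qed.

Lemma isPoly_CInt_geoC n (m om : R -> C) a b :
  ccont_on m a b -> ccont_on om a b ->
  isPoly n (fun z => CInt (fun t => m t * geoC n (z * om t))%C a b).
Proof.
  revert m; induction n as [|n IH]; intros m Hm Ho.
  - exists (CInt m a b); intros z; apply CInt_ext; intros; simpl; ring.
  - exists (CInt m a b), (fun z => CInt (fun t => (m t * om t) * geoC n (z * om t))%C a b).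
    assert (Hmo : ccont_on (fun t => m t * om t)%C a b)
      by (intros t Ht; apply ccont_mult; [apply Hm|apply Ho]; assumption).
    split; [apply IH; assumption|].
    intros z. rewrite <- CInt_scal, <- CInt_plus; try assumption.
    + apply CInt_ext; intros; simpl; ring.
    + intros t Ht; apply ccont_mult; [apply ccont_const|]; apply ccont_mult; [apply Hmo, Ht|].
      apply ccont_geoC, ccont_mult; [apply ccont_const|apply Ho, Ht].
    + intros t Ht; apply ccont_mult; [apply Hmo, Ht|].
      apply ccont_geoC, ccont_mult; [apply ccont_const|apply Ho, Ht].
Qed.

(** A Cauchy type integral whose poles 1 / om t lie outside the disc of radius 2: truncating the
    geometric series of the kernel leaves a remainder of order 2^(-n) on the unit disc. *)
Lemma taylor_approx (m om : R -> C) a b B n : a <= b ->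
  ccont_on m a b -> ccont_on om a b ->
  (forall t, a <= t <= b -> Cmod (m t) <= B) ->
  (forall t, a <= t <= b -> Cmod (om t) <= 1 / 2) ->
  exists Q, isPoly n Q /\ forall z, Cmod z <= 1 ->
    Cmod (CInt (fun t => m t / (1 - z * om t))%C a b - Q z) <= 2 * ((b - a) * (B * (1 / 2) ^ n)).
Proof.
  intros Hab Hm Ho HB Hom.
  exists (fun z => CInt (fun t => m t * geoC n (z * om t))%C a b).
  split; [apply isPoly_CInt_geoC; assumption|].
  intros z Hz.
  assert (Hzo : forall t, a <= t <= b -> Cmod (z * om t) <= 1 / 2).
  { intros t Ht; rewrite Cmod_mult. specialize (Hom t Ht).
    pose proof (Cmod_ge_0 z); pose proof (Cmod_ge_0 (om t)). nra. }
  assert (Hd : forall t, a <= t <= b -> 1 / 2 <= Cmod (1 - z * om t)).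
  { intros t Ht; eapply Rle_trans; [|apply Cmod_one_minus]. specialize (Hzo t Ht); lra. }
  assert (Hn : forall t, a <= t <= b -> (1 - z * om t <> 0)%C).
  { intros t Ht; apply Cmod_pos_neq; specialize (Hd t Ht); lra. }
  assert (C1 : ccont_on (fun t => m t / (1 - z * om t))%C a b).
  { intros t Ht. apply ccont_div; [apply Hm, Ht| |].
    - apply ccont_minus; [apply ccont_const|apply ccont_mult; [apply ccont_const|apply Ho, Ht]].
    - rewrite Rmin_left, Rmax_right in Ht by lra. apply Hn; assumption. }
  assert (C2 : ccont_on (fun t => m t * geoC n (z * om t))%C a b).
  { intros t Ht; apply ccont_mult; [apply Hm, Ht|].
    apply ccont_geoC, ccont_mult; [apply ccont_const|apply Ho, Ht]. }
  rewrite <- CInt_minus by assumption.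
  apply CInt_bound_const; try assumption.
  - intros t Ht; apply ccont_minus; [apply C1|apply C2]; assumption.
  - intros t Ht.
    replace (m t / (1 - z * om t) - m t * geoC n (z * om t))%C
      with (m t * ((z * om t) ^ S n / (1 - z * om t)))%C.
    + specialize (Hn t Ht); specialize (Hd t Ht); specialize (Hzo t Ht); specialize (HB t Ht).
      rewrite Cmod_mult, Cmod_div, Cmod_pow by assumption.
      apply Rmult_le_compat; [apply Cmod_ge_0| |assumption|].
      * apply Rle_div_r; [lra|]. rewrite Rmult_0_l; apply pow_le, Cmod_ge_0.
      * apply Rle_div_l; [lra|].
        assert (P1 : Cmod (z * om t) ^ n <= (1 / 2) ^ n)
          by (apply pow_incr; split; [apply Cmod_ge_0|assumption]).
        assert (P2 : 0 <= Cmod (z * om t) ^ n) by (apply pow_le, Cmod_ge_0).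
        assert (P3 : 0 <= (1 / 2) ^ n) by (apply pow_le; lra).
        simpl. pose proof (Cmod_ge_0 (z * om t)). nra.
    + replace ((z * om t) ^ S n)%C with (1 - (1 - z * om t) * geoC n (z * om t))%C
        by (rewrite geoC_eq; ring).
      field; apply Hn; assumption.
Qed.

(** * Runge approximation of simple poles *)

(** The same set as [S_], with a signed angle. *)
Definition sector (beta : R) (z : C) : Prop :=
  exists x t, 0 <= x <= 1 /\ Rabs t <= beta * PI / 2 /\ z = (x * Cexp (0, t))%C.

Lemma sector_le_1 beta z : sector beta z -> Cmod z <= 1.
Proof.
  intros [x [t [Hx [_ ->]]]]; rewrite Cmod_mult, Cmod_Cexp, Cmod_R, Rabs_right by lra.
  simpl; rewrite exp_0; lra.
Qed.

(** The cosine of half the half-opening of the sector; it bounds the distance from the sector to the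
    negative axis ([sector_lower]). *)
Definition opening (beta : R) : R := cos (beta * PI / 4).

Lemma opening_bound beta : 0 <= beta < 2 -> 0 < opening beta <= 1.
Proof.
  intros H; pose proof PI_RGT_0; unfold opening; split; [|apply COS_bound].
  apply cos_gt_0; nra.
Qed.

(** Since cos t >= cos th = 2 cos (th / 2)^2 - 1, the squares of the two sides differ by at least
    (1 - cos th) / 2 * (s - x)^2. *)
Lemma polar_lower x t s th : 0 <= x -> 0 <= s -> Rabs t <= th -> th <= PI ->
  cos (th / 2) * (s + x) <= Cmod (s + x * Cexp (0, t)).
Proof.
  intros Hx Hs Ht Hth.
  pose proof PI_RGT_0 as HP. pose proof (Rabs_pos t).
  assert (Hc : cos th <= cos t).
  { replace (cos t) with (cos (Rabs t)).
    - apply cos_decr_1; lra.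
    - unfold Rabs; destruct Rcase_abs; [apply cos_neg|reflexivity]. }
  assert (E : cos th = 2 * cos (th / 2) * cos (th / 2) - 1).
  { rewrite <- cos_2a_cos; f_equal; field. }
  apply Rsqr_incr_0_var; [|apply Cmod_ge_0].
  unfold Rsqr. replace (Cmod (s + x * Cexp (0, t)) * Cmod (s + x * Cexp (0, t)))
    with (Cmod (s + x * Cexp (0, t)) ^ 2) by ring.
  rewrite Cmod2_alt; unfold Cexp; simpl; rewrite exp_0.
  pose proof (sin2_cos2 t) as S; unfold Rsqr in S.
  match goal with |- _ <= ?r => replace r with (s * s + 2 * (s * x) * cos t +
     x * x * (sin t * sin t + cos t * cos t)) by ring end.
  rewrite S.
  set (k := cos (th / 2)) in *; set (g := cos th) in *.
  assert (0 <= s * x) by (apply Rmult_le_pos; assumption).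
  assert (g <= 1) by (apply COS_bound).
  replace (k * (s + x) * (k * (s + x))) with ((g + 1) / 2 * ((s + x) * (s + x))) by (rewrite E; field).
  assert (2 * (s * x) * g <= 2 * (s * x) * cos t) by (apply Rmult_le_compat_l; lra).
  assert (0 <= (1 - g) * ((s - x) * (s - x))) by (apply Rmult_le_pos; [lra|apply Rle_0_sqr]).
  lra.
Qed.

Lemma sector_lower beta s z : 0 <= beta < 2 -> 0 <= s -> sector beta z ->
  opening beta * (s + Cmod z) <= Cmod (s + z).
Proof.
  intros Hb Hs [x [t [Hx [Ht ->]]]].
  rewrite Cmod_mult, Cmod_Cexp, Cmod_R, Rabs_right by lra. simpl; rewrite exp_0, Rmult_1_r.
  unfold opening. replace (beta * PI / 4) with (beta * PI / 2 / 2) by field.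
  apply polar_lower; try lra. pose proof PI_RGT_0; nra.
Qed.

(** For every pole -s with s >= a there is a polynomial of bounded degree, equal to 1 at the pole and
    uniformly smaller on the sector and on most of the segment from the vertex to the pole. The segment
    is included so that the pole can be pushed along it. *)
Definition peaked (beta kap a : R) : Prop :=
  exists (D : nat) (rho : R), 0 <= rho < 1 /\ forall s, a <= s -> 0 < s ->
    exists p, isPoly D p /\ p (RtoC (- s)) = 1 /\
      (forall z, sector beta z -> Cmod (p z) <= rho) /\
      (forall y, 0 <= y <= (1 - kap) * s -> Cmod (p (RtoC (- y))) <= rho).

Lemma peaked_base beta kap : 0 < kap <= 1 / 2 -> peaked beta kap 2.
Proof.
  intros Hk; exists 1%nat, (1 - kap); split; [lra|].
  intros s Hs Hs0; exists (fun z => RtoC (- / s) * z)%C; repeat split.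
  - exists (RtoC 0), (fun _ => RtoC (- / s)); split; [apply isPoly_const|intros; ring].
  - rewrite <- RtoC_mult; f_equal; field; lra.
  - intros z Hz; apply sector_le_1 in Hz.
    rewrite Cmod_mult, Cmod_R, Rabs_Ropp, Rabs_right by (left; apply Rinv_0_lt_compat; lra).
    assert (/ s <= / 2) by (apply Rinv_le_contravar; lra).
    pose proof (Cmod_ge_0 z). assert (0 < / s) by (apply Rinv_0_lt_compat; lra). nra.
  - intros y Hy; rewrite <- RtoC_mult, Cmod_R.
    replace (- / s * - y) with (y / s) by (field; lra).
    rewrite Rabs_right.
    + apply Rle_div_l; lra.
    + apply Rle_ge, Rle_div_r; lra.
Qed.

(** 1 - p^n vanishes at -s, so s + z divides it; the quotient is close to the simple pole wherever
    p is small. *)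
Lemma peaked_quotient D p s n : isPoly D p -> p (RtoC (- s)) = 1 ->
  exists Q, isPoly (D * n) Q /\ forall z, (s + z <> 0)%C ->
    (Q z - / (s + z) = - (p z ^ n / (s + z)))%C.
Proof.
  intros HD H1.
  destruct (isPoly_div (D * n) (fun z => p z ^ n)%C (RtoC (- s))) as [Q [HQ1 HQ2]].
  { apply isPoly_pow; assumption. }
  exists (fun z => (-(1)) * Q z)%C; split; [apply isPoly_scal; assumption|].
  intros z Hz; specialize (HQ2 z); cbv beta in HQ2.
  rewrite H1 in HQ2.
  assert (E1 : (RtoC 1 ^ n = 1)%C).
  { clear; induction n as [|n IH]; simpl; [reflexivity|rewrite IH; ring]. }
  rewrite E1 in HQ2.
  replace (p z ^ n)%C with (1 + (z - RtoC (- s)) * Q z)%C by (rewrite <- HQ2; ring).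
  rewrite RtoC_opp. field; exact Hz.
Qed.

Lemma pow_small rho eps : 0 <= rho < 1 -> 0 < eps -> exists n : nat, rho ^ n <= eps.
Proof.
  intros Hr He; destruct (pow_lt_1_zero rho) with (y := eps) as [n Hn].
  - rewrite Rabs_right; lra.
  - lra.
  - exists n; specialize (Hn n (Nat.le_refl _)); rewrite Rabs_right in Hn; [lra|].
    apply Rle_ge, pow_le; lra.
Qed.

(** Pushing the pole from -s' to -s with s = (1 - kap) s'. The function (s' - s) / (s' + z) equals 1 at -s;
    it is at most 1/2 on the sector, whose distance to -s' is at least opening * s', and at most
    2/3 on the segment. By [peaked_quotient] a polynomial is close to it; normalized at -s it is peaked. *)
Lemma peaked_step beta a : 0 <= beta < 2 -> 0 < a ->
  peaked beta (opening beta / 2) a ->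
  peaked beta (opening beta / 2) ((1 - opening beta / 2) * a).
Proof.
  intros Hb Ha [D [rho [Hr H]]].
  pose proof (opening_bound beta Hb) as Hc; set (c := opening beta) in *.
  set (kap := c / 2) in *.
  assert (Hk : 0 < kap <= 1 / 2) by (unfold kap; lra).
  (* 9/11 = (2/3 + 1/12) / (1 - 1/12). *)
  destruct (pow_small rho (1 / 12) Hr ltac:(lra)) as [n Hn].
  exists (D * n)%nat, (9 / 11); split; [lra|].
  intros s Hs Hs0.
  set (s' := s / (1 - kap)).
  assert (Es : s = (1 - kap) * s') by (unfold s'; field; lra).
  assert (Hs' : 0 < s') by (apply Rdiv_lt_0_compat; lra).
  destruct (H s') as [p [P1 [P2 [P3 P4]]]]; [|assumption|].
  { unfold s'; apply Rle_div_r; lra. }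
  destruct (peaked_quotient D p s' n P1 P2) as [Q [Q1 Q2]].
  assert (Hpow : forall w, Cmod (p w) <= rho -> Cmod (p w ^ n) <= 1 / 12).
  { intros w Hw; rewrite Cmod_pow; eapply Rle_trans; [|exact Hn].
    apply pow_incr; split; [apply Cmod_ge_0|assumption]. }
  (* Up to rho ^ n the scaled quotient is (s' - s) / (s' + z), with s' - s = kap * s'. *)
  assert (Hq : forall w m, 0 < m -> m <= Cmod (s' + w) -> kap * s' <= m -> Cmod (p w) <= rho ->
    Cmod (RtoC (kap * s') * Q w - RtoC (kap * s') / (s' + w)) <= 1 / 12 /\
    Cmod (RtoC (kap * s') * Q w) <= kap * s' / m + 1 / 12).
  { intros w m Hm0 Hm1 Hm2 Hw.
    assert (Hne : (s' + w <> 0)%C) by (apply Cmod_pos_neq; lra).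
    assert (B1 : Cmod (RtoC (kap * s') * Q w - RtoC (kap * s') / (s' + w)) <= 1 / 12).
    { replace (RtoC (kap * s') * Q w - RtoC (kap * s') / (s' + w))%C
        with (RtoC (kap * s') * (Q w - / (s' + w)))%C by (unfold Cdiv; ring).
      rewrite Q2 by assumption.
      rewrite Cmod_mult, Cmod_opp, Cmod_div, Cmod_R, Rabs_right by (assumption || nra).
      specialize (Hpow w Hw).
      assert (Cmod (p w ^ n) / Cmod (s' + w) <= 1 / 12 / m).
      { apply Rmult_le_compat; [apply Cmod_ge_0| |assumption|].
        - left; apply Rinv_0_lt_compat; lra.
        - apply Rinv_le_contravar; lra. }
      apply Rle_trans with (m * (1 / 12 / m)).
      - apply Rmult_le_compat; try assumption; try nra.
        apply Rle_div_r; [lra|]. rewrite Rmult_0_l; apply Cmod_ge_0.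
      - apply Req_le; field; lra. }
    split; [exact B1|].
    replace (RtoC (kap * s') * Q w)%C with
      (RtoC (kap * s') / (s' + w) + (RtoC (kap * s') * Q w - RtoC (kap * s') / (s' + w)))%C by ring.
    eapply Rle_trans; [apply Cmod_triangle|].
    apply Rplus_le_compat; [|exact B1].
    rewrite Cmod_div, Cmod_R, Rabs_right by (assumption || nra).
    apply Rmult_le_compat_l; [nra|]. apply Rinv_le_contravar; assumption. }
  assert (Hreal : forall y, 0 <= y <= s -> s' - y <= Cmod (s' + RtoC (- y))).
  { intros y Hy. rewrite <- RtoC_plus, Cmod_R. apply Rle_abs. }
  assert (Hss : s' - s = kap * s') by (rewrite Es; ring).
  destruct (Hq (RtoC (- s)) (kap * s')) as [A1 _]; try lra.
  { nra. } { rewrite <- Hss; apply Hreal; lra. } { apply P4; lra. }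
  set (q0 := (RtoC (kap * s') * Q (RtoC (- s)))%C) in *.
  assert (A2 : (RtoC (kap * s') / (s' + RtoC (- s)) = 1)%C).
  { rewrite <- RtoC_plus. replace (s' + - s) with (kap * s') by lra.
    unfold Cdiv; apply Cinv_r. apply Cmod_pos_neq; rewrite Cmod_R, Rabs_right; nra. }
  rewrite A2 in A1.
  assert (A3 : 11 / 12 <= Cmod q0).
  { pose proof (Cmod_triangle q0 (1 - q0)) as Tr.
    replace (q0 + (1 - q0))%C with (RtoC 1) in Tr by ring. rewrite Cmod_1 in Tr.
    replace (1 - q0)%C with (- (q0 - 1))%C in Tr by ring. rewrite Cmod_opp in Tr. lra. }
  assert (A4 : q0 <> 0) by (apply Cmod_pos_neq; lra).
  assert (Hfin : forall w, Cmod (RtoC (kap * s') * Q w) <= 3 / 4 ->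
    Cmod (/ q0 * (RtoC (kap * s') * Q w)) <= 9 / 11).
  { intros w Hw; rewrite Cmod_mult, Cmod_inv by assumption.
    apply Rle_trans with (/ (11 / 12) * (3 / 4)); [|lra].
    apply Rmult_le_compat; try assumption.
    - left; apply Rinv_0_lt_compat; lra.
    - apply Cmod_ge_0.
    - apply Rinv_le_contravar; lra. }
  exists (fun z => / q0 * (RtoC (kap * s') * Q z))%C; repeat split.
  - apply isPoly_scal, isPoly_scal; exact Q1.
  - fold q0. rewrite Cmult_comm; apply Cinv_r; assumption.
  - intros z Hz; apply Hfin.
    pose proof (sector_lower beta s' z Hb ltac:(lra) Hz) as L; fold c in L.
    pose proof (Cmod_ge_0 z).
    destruct (Hq z (c * s')) as [_ B]; try (unfold kap; nra).
    { apply P3; assumption. }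
    replace (kap * s' / (c * s')) with (1 / 2) in B by (unfold kap; field; lra). lra.
  - intros y Hy; apply Hfin.
    assert (Hys : 0 <= y <= s) by nra.
    destruct (Hq (RtoC (- y)) (s' - (1 - kap) * s)) as [_ B].
    + nra.
    + eapply Rle_trans; [|apply Hreal; assumption]; lra.
    + nra.
    + apply P4; lra.
    + assert (kap * s' / (s' - (1 - kap) * s) <= 2 / 3).
      { apply Rle_div_l; [nra|].
        replace (s' - (1 - kap) * s) with (kap * (2 - kap) * s') by (rewrite Es; ring).
        assert (0 <= kap * s' * (1 / 2 - kap)) by (apply Rmult_le_pos; [apply Rmult_le_pos|]; lra). lra. }
      lra.
Qed.

Lemma peaked_mono beta kap a b : a <= b -> peaked beta kap a -> peaked beta kap b.
Proof.
  intros Hab [D [rho [Hr H]]]; exists D, rho; split; [assumption|].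
  intros s Hs; apply H; lra.
Qed.

Lemma peaked_all beta a : 0 <= beta < 2 -> 0 < a -> peaked beta (opening beta / 2) a.
Proof.
  intros Hb Ha.
  pose proof (opening_bound beta Hb) as Hc.
  set (r := 1 - opening beta / 2).
  assert (Hr : 0 < r < 1) by (unfold r; lra).
  assert (K : forall n, peaked beta (opening beta / 2) (r ^ n * 2)).
  { induction n as [|n IH].
    - simpl; rewrite Rmult_1_l; apply peaked_base; lra.
    - simpl. rewrite Rmult_assoc. apply peaked_step; [assumption| |assumption].
      assert (0 < r ^ n) by (apply pow_lt; lra). lra. }
  destruct (pow_small r (a / 2)) as [n Hn]; try lra.
  apply (peaked_mono _ _ (r ^ n * 2)); [lra|apply K].
Qed.

(** The poles may lie inside the unit disc, where expansion in powers of z is of no use. *)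
Lemma runge_pole beta a : 0 <= beta < 2 -> 0 < a ->
  exists (D : nat) (rho : R), 0 <= rho < 1 /\ forall n s, a <= s ->
    exists Q, isPoly (D * n) Q /\ forall z, sector beta z ->
      Cmod (Q z - / (s + z)) <= rho ^ n / (opening beta * a).
Proof.
  intros Hb Ha; destruct (peaked_all beta a Hb Ha) as [D [rho [Hr H]]].
  exists D, rho; split; [assumption|]; intros n s Hs.
  destruct (H s Hs ltac:(lra)) as [p [P1 [P2 [P3 _]]]].
  destruct (peaked_quotient D p s n P1 P2) as [Q [Q1 Q2]].
  exists Q; split; [assumption|]; intros z Hz.
  pose proof (opening_bound beta Hb) as Hc.
  pose proof (sector_lower beta s z Hb ltac:(lra) Hz) as L.
  pose proof (Cmod_ge_0 z).
  assert (Hl : opening beta * a <= Cmod (s + z)) by nra.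
  assert (Hp : 0 < opening beta * a) by nra.
  assert (Hne : (s + z <> 0)%C) by (apply Cmod_pos_neq; lra).
  rewrite Q2, Cmod_opp, Cmod_div, Cmod_pow by assumption.
  apply Rmult_le_compat.
  - apply pow_le, Cmod_ge_0.
  - left; apply Rinv_0_lt_compat; lra.
  - apply pow_incr; split; [apply Cmod_ge_0|apply P3; assumption].
  - apply Rinv_le_contravar; assumption.
Qed.

(** * Holomorphic functions *)

(** The hypothesis of Cauchy's theorem [cauchy_graph]. *)
Definition hol (f f' : C -> C) (z : C) : Prop := cderiv f z (f' z) /\ ccont f' z.

Lemma hol_ccont f f' z : hol f f' z -> ccont f z.
Proof. intros [H _]; exact (cderiv_ccont _ _ _ H). Qed.

Lemma hol_const c z : hol (fun _ => c) (fun _ => 0) z.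
Proof. split; [apply cderiv_const|apply ccont_const]. Qed.

Lemma hol_id z : hol (fun w => w) (fun _ => 1) z.
Proof. split; [apply cderiv_id|apply ccont_const]. Qed.

Lemma hol_plus f f' g g' z : hol f f' z -> hol g g' z ->
  hol (fun w => f w + g w)%C (fun w => f' w + g' w)%C z.
Proof. intros [A B] [D E]; split; [apply cderiv_plus|apply ccont_plus]; assumption. Qed.

Lemma hol_minus f f' g g' z : hol f f' z -> hol g g' z ->
  hol (fun w => f w - g w)%C (fun w => f' w - g' w)%C z.
Proof. intros [A B] [D E]; split; [apply cderiv_minus|apply ccont_minus]; assumption. Qed.

Lemma hol_mult f f' g g' z : hol f f' z -> hol g g' z ->
  hol (fun w => f w * g w)%C (fun w => f' w * g w + f w * g' w)%C z.
Proof.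
  intros H K; pose proof (hol_ccont _ _ _ H); pose proof (hol_ccont _ _ _ K).
  destruct H as [A B], K as [D E]; split.
  - apply cderiv_mult; assumption.
  - apply ccont_plus; apply ccont_mult; assumption.
Qed.

Lemma hol_inv f f' z : hol f f' z -> f z <> 0 ->
  hol (fun w => / f w)%C (fun w => - / (f w * f w) * f' w)%C z.
Proof.
  intros H Hn; pose proof (hol_ccont _ _ _ H).
  destruct H as [A B]; split.
  - apply (cderiv_comp Cinv f); [apply cderiv_inv|]; assumption.
  - apply ccont_mult; [|assumption].
    apply ccont_opp, ccont_inv; [apply ccont_mult; assumption|].
    apply Cmult_neq_0; assumption.
Qed.

Lemma hol_Cexp f f' z : hol f f' z ->
  hol (fun w => Cexp (f w)) (fun w => Cexp (f w) * f' w)%C z.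
Proof.
  intros H; pose proof (hol_ccont _ _ _ H).
  destruct H as [A B]; split.
  - apply (cderiv_comp Cexp f); [apply cderiv_Cexp|assumption].
  - apply ccont_mult; [|assumption]. apply (ccont_comp f Cexp); [assumption|apply Cexp_ccont].
Qed.

(** * The jump across the slit and the Abel factor *)

Definition jumplog (alpha : R) : R := sin (PI * alpha) / PI.
Definition jumpcst (alpha : R) : R := cos (PI * alpha).

(** Up to the factor 2 pi i, the jump of z^alpha log z across the negative axis at -exp w ([psi_jump]). *)
Definition phi (alpha : R) (w : C) : C := (Cexp (alpha * w) * (jumplog alpha * w + jumpcst alpha))%C.

(** Jump times Cauchy kernel at s = exp (l + v), for z = exp w0. In the application
    l = ln C0 - sigma sqrt N1, and v = sigma sqrt u measures the logarithmic distance to the smallest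
    scale. *)
Definition gker (alpha l : R) (w0 v : C) : C :=
  (phi alpha (l + v) * / (1 + Cexp (w0 - (l + v))))%C.

(** exp (2 pi i u) at u = (v / sigma)^2. *)
Definition Ev (sigma : R) (v : C) : C := Cexp ((0, (2 * PI / sigma ^ 2)%R) * (v * v)).

(** The sum over k >= 1 of rho^k exp (2 pi i k u). *)
Definition abelq (sigma rho : R) (v : C) : C :=
  (rho * Ev sigma v * / (1 - rho * Ev sigma v))%C.

(** For z in the sector, the imaginary parts of log z + i pi are at least this number. *)
Definition gap (beta : R) : R := (2 - beta) * PI / 2.
Definition decay (sigma : R) : R := 4 * PI / sigma ^ 2.

Lemma jumplog_bound alpha : Rabs (jumplog alpha) <= 1 / PI.
Proof.
  unfold jumplog; pose proof PI_RGT_0.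
  unfold Rdiv; rewrite Rabs_mult, (Rabs_right (/ PI)) by (left; apply Rinv_0_lt_compat; lra).
  apply Rmult_le_compat_r; [left; apply Rinv_0_lt_compat; lra|].
  apply Rabs_le; apply SIN_bound.
Qed.

Lemma jumplog_le_1 alpha : Rabs (jumplog alpha) <= 1.
Proof.
  eapply Rle_trans; [apply jumplog_bound|].
  apply Rle_div_l; [apply PI_RGT_0|]. pose proof PI2_1; lra.
Qed.

Lemma Cmod_phi alpha x t : Rabs t <= 2 * PI ->
  Cmod (phi alpha (x, t)) <= exp (alpha * x) * (Rabs (jumplog alpha) * Rabs x + 3).
Proof.
  intros Ht; unfold phi; rewrite Cmod_mult, Cmod_Cexp.
  replace (Re (alpha * (x, t))) with (alpha * x) by (simpl; ring).
  apply Rmult_le_compat_l; [left; apply exp_pos|].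
  eapply Rle_trans; [apply Cmod_triangle|]; rewrite Cmod_mult, !Cmod_R.
  assert (Rabs (jumpcst alpha) <= 1) by (apply Rabs_le, COS_bound).
  assert (Cmod (x, t) <= Rabs x + Rabs t) by apply (Cmod_le_abs (x, t)).
  pose proof (jumplog_bound alpha) as Ha; pose proof (Rabs_pos (jumplog alpha)) as Hp.
  pose proof PI_RGT_0 as HP.
  assert (Rabs (jumplog alpha) * (2 * PI) <= 2).
  { replace 2 with (1 / PI * (2 * PI)) at 2 by (field; lra). apply Rmult_le_compat_r; lra. }
  assert (Rabs (jumplog alpha) * Cmod (x, t) <= Rabs (jumplog alpha) * (Rabs x + 2 * PI))
    by (apply Rmult_le_compat_l; lra).
  lra.
Qed.

Lemma Cmod_Ev sigma x y : Cmod (Ev sigma (x, y)) = exp (- (decay sigma * x * y)).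
Proof.
  unfold Ev; rewrite Cmod_Cexp; f_equal; unfold decay, Re; simpl. unfold Rdiv; ring.
Qed.

Lemma abelq_bound_far sigma rho x y m0 : 0 <= rho <= 1 -> 0 < m0 -> m0 <= decay sigma * x * y ->
  Cmod (abelq sigma rho (x, y)) <= / (1 - exp (- m0)) * exp (- (decay sigma * x * y)).
Proof.
  intros Hr Hm H.
  assert (He : exp (- m0) < 1) by (rewrite <- exp_0; apply exp_increasing; lra).
  assert (HE : Cmod (Ev sigma (x, y)) <= exp (- m0)).
  { rewrite Cmod_Ev. destruct (Rle_lt_or_eq_dec _ _ H) as [H1|H1].
    - left; apply exp_increasing; lra.
    - rewrite H1; lra. }
  assert (Hlow : 1 - exp (- m0) <= Cmod (1 - rho * Ev sigma (x, y))).
  { eapply Rle_trans; [|apply Cmod_one_minus]. rewrite Cmod_mult, Cmod_R, Rabs_right by lra.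
    pose proof (Cmod_ge_0 (Ev sigma (x, y))). nra. }
  unfold abelq; rewrite !Cmod_mult, Cmod_inv, Cmod_R, (Rabs_right rho) by (try apply Cmod_pos_neq; lra).
  rewrite Rmult_comm; apply Rmult_le_compat.
  - left; apply Rinv_0_lt_compat; lra.
  - apply Rmult_le_pos; [lra|apply Cmod_ge_0].
  - apply Rinv_le_contravar; lra.
  - rewrite Cmod_Ev. pose proof (exp_pos (- (decay sigma * x * y))). nra.
Qed.

(** The vertical lines through the points where u is a half-integer: near the real axis
    exp (2 pi i u) is close to the negative axis, and higher up it is small. *)
Lemma one_minus_Ev_vertical sigma rho x y (j : nat) :
  0 < sigma -> 0 <= rho <= 1 -> 0 < x -> x ^ 2 = sigma ^ 2 * (INR j + 1 / 2) -> 0 <= y ->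
  1 / 2 <= Cmod (1 - rho * Ev sigma (x, y)).
Proof.
  intros Hs Hr Hx Hj Hy.
  pose proof PI_RGT_0 as HP.
  assert (Hs2 : 0 < sigma ^ 2) by (apply pow_lt; assumption).
  destruct (Rle_lt_dec (y ^ 2) (sigma ^ 2 / 4)) as [H|H].
  - apply Rle_trans with 1; [lra|].
    assert (Q : Re (Ev sigma (x, y)) <= 0).
    { unfold Ev, Cexp; simpl.
      match goal with |- exp ?a * cos ?b <= 0 =>
        replace b with (PI - 2 * PI * (y ^ 2 / sigma ^ 2) + 2 * INR j * PI) end.
      2:{ unfold Re, Im; simpl.
          transitivity (2 * PI / sigma ^ 2 * (x ^ 2 - y ^ 2)); [rewrite Hj; field; lra|].
          unfold Rdiv; simpl; ring. }
      rewrite cos_period.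
      set (r := y ^ 2 / sigma ^ 2).
      assert (Hr1 : 0 <= r) by (apply Rle_div_r; [assumption|rewrite Rmult_0_l; apply pow2_ge_0]).
      assert (Hr2 : r <= 1 / 4) by (apply Rle_div_l; [assumption|lra]).
      assert (cos (PI - 2 * PI * r) <= 0).
      { apply cos_le_0; nra. }
      match goal with |- exp ?a * _ <= 0 => pose proof (exp_pos a) end. nra. }
    apply Rle_trans with (Rabs (Re (1 - rho * Ev sigma (x, y)))); [|apply re_le_Cmod].
    eapply Rle_trans; [|apply Rle_abs].
    replace (Re (1 - rho * Ev sigma (x, y))) with (1 - rho * Re (Ev sigma (x, y)))
      by (unfold Re; simpl; ring).
    assert (0 <= rho * - Re (Ev sigma (x, y))) by (apply Rmult_le_pos; lra). lra.
  - eapply Rle_trans; [|apply Cmod_one_minus].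
    rewrite Cmod_mult, Cmod_R, Rabs_right, Cmod_Ev by lra.
    assert (E : exp (- (decay sigma * x * y)) <= 1 / 2).
    { assert (Hxy : sigma ^ 2 / 3 <= x * y).
      { assert (0 <= INR j) by apply pos_INR.
        assert (Hx2 : sigma ^ 2 / 2 <= x ^ 2) by nra.
        apply Rnot_lt_le; intros L.
        assert ((x * y) ^ 2 < (sigma ^ 2 / 3) ^ 2) by (assert (0 <= x * y) by nra; simpl in *; nra).
        assert (sigma ^ 2 / 2 * (sigma ^ 2 / 4) <= x ^ 2 * y ^ 2) by (apply Rmult_le_compat; lra).
        nra. }
      assert (Hk : 1 <= decay sigma * x * y).
      { unfold decay. replace (4 * PI / sigma ^ 2 * x * y) with (4 * PI / sigma ^ 2 * (x * y)) by ring.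
        apply Rle_trans with (4 * PI / sigma ^ 2 * (sigma ^ 2 / 3)).
        - replace (4 * PI / sigma ^ 2 * (sigma ^ 2 / 3)) with (4 * PI / 3) by (field; lra).
          pose proof PI2_1; lra.
        - apply Rmult_le_compat_l; [|assumption].
          apply Rle_div_r; [assumption|lra]. }
      apply Rle_trans with (exp (- (1))).
      - destruct (Rle_lt_or_eq_dec _ _ Hk) as [L|L]; [left; apply exp_increasing; lra|rewrite <- L; lra].
      - rewrite exp_Ropp. replace (1 / 2) with (/ 2) by field.
        apply Rinv_le_contravar; [lra|]. pose proof (exp_ineq1 1 ltac:(lra)); lra. }
    pose proof (exp_pos (- (decay sigma * x * y))). nra.
Qed.

Lemma abelq_bound_vertical sigma rho x y (j : nat) :
  0 < sigma -> 0 <= rho <= 1 -> 0 < x -> x ^ 2 = sigma ^ 2 * (INR j + 1 / 2) -> 0 <= y ->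
  Cmod (abelq sigma rho (x, y)) <= 2 * exp (- (decay sigma * x * y)).
Proof.
  intros Hs Hr Hx Hj Hy.
  pose proof (one_minus_Ev_vertical sigma rho x y j Hs Hr Hx Hj Hy) as L.
  unfold abelq; rewrite !Cmod_mult, Cmod_inv, Cmod_R, (Rabs_right rho) by (try apply Cmod_pos_neq; lra).
  rewrite Rmult_comm; apply Rmult_le_compat.
  - left; apply Rinv_0_lt_compat; lra.
  - apply Rmult_le_pos; [lra|apply Cmod_ge_0].
  - replace 2 with (/ (1 / 2)) by field. apply Rinv_le_contravar; lra.
  - rewrite Cmod_Ev. pose proof (exp_pos (- (decay sigma * x * y))). nra.
Qed.

(** * Lower bounds for the denominator of the kernel *)

Lemma one_plus_exp_lower a b : Rabs (1 - exp a) <= Cmod (1 + Cexp (a, b)).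
Proof.
  pose proof (Cmod_Cexp (a, b)) as E; simpl in E.
  apply Rabs_le; split.
  - pose proof (Cmod_triangle (1 + Cexp (a, b)) (- (1))) as T.
    replace (1 + Cexp (a, b) + - (1))%C with (Cexp (a, b)) in T by ring.
    rewrite Cmod_opp, Cmod_1, E in T; unfold Re in T; simpl in T; lra.
  - pose proof (Cmod_triangle (1 + Cexp (a, b)) (- Cexp (a, b))) as T.
    replace (1 + Cexp (a, b) + - Cexp (a, b))%C with (RtoC 1) in T by ring.
    rewrite Cmod_opp, Cmod_1, E in T; unfold Re in T; simpl in T; lra.
Qed.

Lemma one_minus_exp_lower a : Rabs a <= 1 -> Rabs a / 2 <= Rabs (1 - exp a).
Proof.
  intros H; apply Rabs_le_between in H.
  destruct (Rle_lt_dec 0 a) as [Ha|Ha].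
  - rewrite (Rabs_right a), Rabs_left1; pose proof (exp_ineq1_le a); lra.
  - assert (E : exp a <= 1 + a / 2).
    { replace a with (- - a) at 1 by ring. rewrite exp_Ropp.
      pose proof (exp_ineq1_le (- a)).
      apply Rle_trans with (/ (1 + - a)); [apply Rinv_le_contravar; lra|].
      apply Rmult_le_reg_r with (1 + - a); [lra|]. rewrite Rinv_l by lra. nra. }
    rewrite (Rabs_left a), (Rabs_right (1 - exp a)) by lra. lra.
Qed.

Lemma one_minus_exp_lower_far a : 1 <= Rabs a -> 1 / 2 <= Rabs (1 - exp a).
Proof.
  intros H; destruct (Rle_lt_dec 0 a) as [Ha|Ha].
  - rewrite Rabs_right in H by lra. rewrite Rabs_left1; pose proof (exp_ineq1_le a); lra.
  - rewrite Rabs_left in H by lra.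
    assert (E : exp a <= / 2).
    { replace a with (- - a) at 1 by ring. rewrite exp_Ropp.
      pose proof (exp_ineq1_le (- a)). apply Rinv_le_contravar; lra. }
    rewrite Rabs_right; lra.
Qed.

Lemma sin_lower x : 0 <= x <= 1 -> x / 2 <= sin x.
Proof.
  intros Hx.
  assert (Hc : forall t, 0 <= t <= 1 -> 1 / 2 <= cos t).
  { intros t Ht; rewrite <- cos_PI3. apply cos_decr_1; pose proof PI2_3_2; lra. }
  destruct (MVT_gen (fun t => sin t - t / 2) 0 x (fun t => cos t - 1 / 2)) as [c [Hc1 Hc2]].
  - intros t _. auto_derive; trivial; field.
  - intros t _. apply continuity_pt_filterlim.
    change (continuous (fun t => sin t - t / 2) t). cont_real.
  - rewrite Rmin_left, Rmax_right in Hc1 by lra.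
    rewrite sin_0 in Hc2. specialize (Hc c ltac:(lra)).
    assert (0 <= (cos c - 1 / 2) * (x - 0)) by (apply Rmult_le_pos; lra). lra.
Qed.

Lemma one_plus_exp_angle a b mu : 0 <= mu <= 1 -> Rabs b <= PI - mu ->
  mu / 4 <= Cmod (1 + Cexp (a, b)).
Proof.
  intros Hm Hb.
  assert (E : Cexp (a, b) = (exp a * Cexp (0, b))%C).
  { unfold Cexp; simpl; rewrite exp_0. apply injective_projections; simpl; ring. }
  rewrite E.
  pose proof (exp_pos a).
  eapply Rle_trans; [|apply (polar_lower (exp a) b 1 (PI - mu))]; try lra.
  replace ((PI - mu) / 2) with (PI / 2 - mu / 2) by field.
  rewrite cos_shift. pose proof (sin_lower (mu / 2) ltac:(lra)). nra.
Qed.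

(** * The shifted contour *)

(** The contour dips to height about h - d at the abscissa xp of the pole, and climbs above h at distance
    one on both sides. The square root and the quotient keep the profile smooth, of slope at most 1, and
    bounded. *)
Definition cheight (h d xp x : R) : R :=
  h - d + 1 / 2 * (sqrt (d ^ 2 + (x - xp) ^ 2) / (1 + sqrt (d ^ 2 + (x - xp) ^ 2))).

Definition cslope (d xp x : R) : R :=
  1 / 2 * ((x - xp) / sqrt (d ^ 2 + (x - xp) ^ 2)) / (1 + sqrt (d ^ 2 + (x - xp) ^ 2)) ^ 2.

Lemma croot_pos d xp x (Hd : 0 < d) : 0 < d ^ 2 + (x - xp) ^ 2.
Proof. pose proof (pow_lt d 2 Hd); pose proof (pow2_ge_0 (x - xp)); lra. Qed.

Lemma croot_bounds d xp x (Hd : 0 < d) :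
  Rabs (x - xp) <= sqrt (d ^ 2 + (x - xp) ^ 2) <= d + Rabs (x - xp) /\
  0 < sqrt (d ^ 2 + (x - xp) ^ 2).
Proof.
  pose proof (croot_pos d xp x Hd) as Hp. pose proof (Rabs_pos (x - xp)) as Ha.
  repeat split.
  - rewrite <- sqrt_Rsqr_abs. apply sqrt_le_1_alt.
    pose proof (pow_lt d 2 Hd). replace (Rsqr (x - xp)) with ((x - xp) ^ 2) by (unfold Rsqr; ring). lra.
  - apply Rsqr_incr_0_var; [|lra]. rewrite Rsqr_sqrt by lra.
    assert (E : (x - xp) ^ 2 = Rabs (x - xp) ^ 2) by (rewrite pow2_abs; reflexivity).
    rewrite E; unfold Rsqr; nra.
  - apply sqrt_lt_R0; assumption.
Qed.

Lemma cheight_derive h d xp (x : R) (Hd : 0 < d) : is_derive (cheight h d xp) x (cslope d xp x).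
Proof.
  pose proof (croot_pos d xp x Hd) as Hp. destruct (croot_bounds d xp x Hd) as [_ Hq].
  unfold cheight, cslope; auto_derive;
    change (d * (d * 1) + (x + - xp) * ((x + - xp) * 1)) with (d ^ 2 + (x - xp) ^ 2).
  - repeat split; try assumption; lra.
  - set (q := sqrt _) in *. field. split; lra.
Qed.

Lemma cslope_continuous d xp (x : R) (Hd : 0 < d) : continuous (cslope d xp) x.
Proof.
  pose proof (croot_pos d xp x Hd) as Hp. destruct (croot_bounds d xp x Hd) as [_ Hq].
  unfold cslope.
  cont_der; auto_derive;
    change (d * (d * 1) + (x + - xp) * ((x + - xp) * 1)) with (d ^ 2 + (x - xp) ^ 2).
  repeat split; try assumption; try lra.
  set (q := sqrt _) in *. apply Rgt_not_eq; nra.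
Qed.

Lemma cslope_bound d xp x (Hd : 0 < d) : Rabs (cslope d xp x) <= 1.
Proof.
  destruct (croot_bounds d xp x Hd) as [[H1 _] Hq]. unfold cslope.
  set (q := sqrt _) in *.
  assert (A : Rabs ((x - xp) / q) <= 1).
  { unfold Rdiv; rewrite Rabs_mult, (Rabs_right (/ q)) by (left; apply Rinv_0_lt_compat; lra).
    apply Rle_div_l; lra. }
  assert (B : 1 <= (1 + q) ^ 2) by (simpl; nra).
  assert (D : / (1 + q) ^ 2 <= 1) by (rewrite <- Rinv_1; apply Rinv_le_contravar; lra).
  assert (E : 0 < / (1 + q) ^ 2) by (apply Rinv_0_lt_compat; lra).
  unfold Rdiv at 1. rewrite !Rabs_mult, (Rabs_right (/ (1 + q) ^ 2)) by lra.
  rewrite (Rabs_right (1 / 2)) by lra. pose proof (Rabs_pos ((x - xp) / q)). nra.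
Qed.

Lemma cheight_bounds h d xp x (Hd : 0 < d) :
  - d + 1 / 2 * (Rabs (x - xp) / (1 + Rabs (x - xp))) <= cheight h d xp x - h
  /\ cheight h d xp x - h <= - d + 1 / 2 * (d + Rabs (x - xp))
  /\ cheight h d xp x <= h + 1 / 2 /\ h - d <= cheight h d xp x.
Proof.
  destruct (croot_bounds d xp x Hd) as [[H1 H2] Hq]. unfold cheight.
  set (q := sqrt _) in *. set (t := Rabs (x - xp)) in *.
  assert (Ht : 0 <= t) by apply Rabs_pos.
  assert (E : forall s, 0 <= s -> s / (1 + s) = 1 - / (1 + s)) by (intros; field; lra).
  assert (A : t / (1 + t) <= q / (1 + q)).
  { rewrite !E by lra. assert (/ (1 + q) <= / (1 + t)) by (apply Rinv_le_contravar; lra). lra. }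
  assert (B : q / (1 + q) <= q) by (apply Rle_div_l; nra).
  assert (D : q / (1 + q) <= 1) by (apply Rle_div_l; lra).
  assert (F : 0 <= q / (1 + q)) by (apply Rle_div_r; lra).
  repeat split; lra.
Qed.

(** * The integral over the contour *)

Lemma exp_mono (x y : R) : x <= y -> exp x <= exp y.
Proof. intros [H|H]; [left; apply exp_increasing; assumption|rewrite H; lra]. Qed.

Lemma le_div (a b c : R) : 0 < c -> a * c <= b -> a <= b / c.
Proof. intros H; apply (Rle_div_r a b c H). Qed.

Definition integrand (alpha sigma l rho : R) (w0 v : C) : C :=
  (gker alpha l w0 v * abelq sigma rho v)%C.

Lemma integrand_hol (alpha sigma l rho : R) (w0 : C) :
  exists F' : C -> C, forall v, (1 + Cexp (w0 - (l + v)) <> 0)%C -> (1 - rho * Ev sigma v <> 0)%C ->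
    hol (integrand alpha sigma l rho w0) F' v.
Proof.
  eexists; intros v H1 H2. unfold integrand, gker, abelq, phi, Ev in *.
  repeat first [apply hol_const | apply hol_id | apply hol_mult | apply hol_minus | apply hol_plus
    | apply hol_Cexp | apply hol_inv; [|assumption]].
Qed.

Lemma gap_bounds beta : 0 <= beta < 2 -> 0 < gap beta <= PI.
Proof. intros H; unfold gap; pose proof PI_RGT_0; split; nra. Qed.

Lemma decay_pos sigma : 0 < sigma -> 0 < decay sigma.
Proof.
  intros H; unfold decay; apply Rdiv_lt_0_compat; [pose proof PI_RGT_0; lra|apply pow_lt; assumption].
Qed.

Definition dipmax (beta : R) : R := Rmin (gap beta / 2) (1 / 8).
(** Inversely proportional to the abscissa of the pole, so that the dip changes exp (- decay * x * y) by a
    bounded factor only. *)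
Definition dip (beta xp : R) : R := dipmax beta / (1 + Rmax xp 0).

Lemma dipmax_bounds beta : 0 <= beta < 2 -> 0 < dipmax beta /\ dipmax beta <= gap beta / 2 /\ dipmax beta <= 1 / 8.
Proof.
  intros H; pose proof (gap_bounds beta H); unfold dipmax; split; [apply Rmin_glb_lt; lra|].
  split; [apply Rmin_l|apply Rmin_r].
Qed.

Lemma dip_bounds beta xp : 0 <= beta < 2 -> 0 < dip beta xp <= dipmax beta.
Proof.
  intros H; destruct (dipmax_bounds beta H) as [H0 _]. unfold dip.
  pose proof (Rmax_r xp 0); split.
  - apply Rdiv_lt_0_compat; lra.
  - apply Rle_div_l; [lra|]. nra.
Qed.

Lemma arg_shift (x0 th l x t : R) :
  ((x0, th) - (RtoC l + (x, t)))%C = (x0 - l - x, th - t).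
Proof. apply injective_projections; simpl; ring. Qed.

Lemma kernel_far (x0 th l x t : R) : 1 <= Rabs (x - (x0 - l)) ->
  1 / 2 <= Cmod (1 + Cexp ((x0, th) - (RtoC l + (x, t)))).
Proof.
  intros H; rewrite arg_shift.
  eapply Rle_trans; [|apply one_plus_exp_lower].
  apply one_minus_exp_lower_far.
  replace (x0 - l - x) with (- (x - (x0 - l))) by ring. rewrite Rabs_Ropp; assumption.
Qed.

(** Within half a dip of the abscissa of the pole, the contour is below the pole by a quarter of the dip;
    otherwise the difference of the abscissae is enough. *)
Lemma kernel_near (beta x0 th l x t : R) : 0 <= beta < 2 -> Rabs th <= beta * PI / 2 ->
  0 <= t <= cheight (gap beta) (dip beta (x0 - l)) (x0 - l) x ->
  dip beta (x0 - l) / 16 <= Cmod (1 + Cexp ((x0, th) - (RtoC l + (x, t)))).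
Proof.
  intros Hb Hth Ht.
  destruct (dip_bounds beta (x0 - l) Hb) as [Hd1 Hd2].
  destruct (dipmax_bounds beta Hb) as [Hd0 [Hd3 Hd4]].
  pose proof (gap_bounds beta Hb) as Hh.
  set (d := dip beta (x0 - l)) in *. set (xp := x0 - l) in *.
  destruct (cheight_bounds (gap beta) d xp x Hd1) as [_ [B2 _]].
  rewrite arg_shift; fold xp.
  assert (Eh : beta * PI / 2 = PI - gap beta) by (unfold gap; field).
  apply Rabs_le_between in Hth.
  destruct (Rle_lt_dec (Rabs (x - xp)) (d / 2)) as [Hn|Hf].
  - replace (d / 16) with (d / 4 / 4) by field.
    apply one_plus_exp_angle; [lra|]. apply Rabs_le; lra.
  - destruct (Rle_lt_dec 1 (Rabs (x - xp))) as [H1|H1].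
    + apply Rle_trans with (1 / 2); [lra|].
      pose proof (kernel_far x0 th l x t H1) as K. rewrite arg_shift in K; exact K.
    + eapply Rle_trans; [|apply one_plus_exp_lower].
      assert (E : Rabs (xp - x) = Rabs (x - xp)) by apply Rabs_minus_sym.
      pose proof (one_minus_exp_lower (xp - x)) as L. rewrite E in L. specialize (L ltac:(lra)). lra.
Qed.

Lemma kernel_nonzero (beta x0 th l x t : R) : 0 <= beta < 2 -> Rabs th <= beta * PI / 2 ->
  - (dip beta (x0 - l) / 4) < t < cheight (gap beta) (dip beta (x0 - l)) (x0 - l) x + dip beta (x0 - l) / 4 ->
  (1 + Cexp ((x0, th) - (RtoC l + (x, t))) <> 0)%C.
Proof.
  intros Hb Hth Ht E.
  destruct (dip_bounds beta (x0 - l) Hb) as [Hd1 Hd2].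
  destruct (dipmax_bounds beta Hb) as [Hd0 [Hd3 Hd4]].
  pose proof (gap_bounds beta Hb) as Hh.
  set (d := dip beta (x0 - l)) in *. set (xp := x0 - l) in *.
  destruct (cheight_bounds (gap beta) d xp x Hd1) as [_ [B2 _]].
  rewrite arg_shift in E; fold xp in E.
  assert (Eh : beta * PI / 2 = PI - gap beta) by (unfold gap; field).
  apply Rabs_le_between in Hth.
  apply (f_equal Cmod) in E; rewrite Cmod_0 in E.
  pose proof (one_plus_exp_lower (xp - x) (th - t)) as L1; rewrite E in L1.
  assert (Hx : xp - x = 0).
  { assert (E2 : 1 - exp (xp - x) = 0) by (pose proof (Rabs_pos (1 - exp (xp - x)));
      destruct (Req_dec (1 - exp (xp - x)) 0); [assumption|];
      pose proof (Rabs_pos_lt _ H0); lra).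
    apply exp_inv; rewrite exp_0; lra. }
  assert (Rabs (x - xp) = 0) by (replace (x - xp) with (-(xp - x)) by ring; rewrite Hx, Ropp_0, Rabs_R0; reflexivity).
  pose proof (one_plus_exp_angle (xp - x) (th - t) (d / 8)) as L2; rewrite E in L2.
  assert (d / 8 / 4 <= 0).
  { apply L2; [lra|]. apply Rabs_le; lra. }
  lra.
Qed.

(** The Lorentzian has an elementary primitive and no kink at 0, unlike exp (- |u|). *)
Lemma exp_neg_le_lorentz u : 0 <= u -> exp (- u) <= / (1 + (u / 2) ^ 2).
Proof.
  intros Hu. rewrite exp_Ropp. apply Rinv_le_contravar.
  - pose proof (pow2_ge_0 (u / 2)); lra.
  - replace (exp u) with (exp (u / 2) * exp (u / 2)) by (rewrite <- exp_plus; f_equal; field).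
    pose proof (exp_ineq1_le (u / 2)). nra.
Qed.

(** The abscissa where u = 1/2, half a step before the first node. *)
Definition vstart (sigma : R) : R := sigma * sqrt (1 / 2).

Lemma vstart_pos sigma : 0 < sigma -> 0 < vstart sigma.
Proof. intros H; unfold vstart; apply Rmult_lt_0_compat; [assumption|apply sqrt_lt_R0; lra]. Qed.

Lemma vstart_sq sigma : vstart sigma ^ 2 = sigma ^ 2 * (INR 0 + 1 / 2).
Proof.
  unfold vstart. simpl INR. replace ((sigma * sqrt (1 / 2)) ^ 2) with (sigma ^ 2 * (sqrt (1 / 2) * sqrt (1 / 2))) by ring.
  rewrite sqrt_sqrt by lra. ring.
Qed.

(** On the part of the contour within distance 1 of the pole, x is at least reach * (1 + max (xp, 0)). *)
Definition reach (sigma : R) : R := Rmin (vstart sigma / 3) (1 / 3).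

(** An exponential for the part of the contour far from the pole, and near the pole a Lorentzian of
    height 1 / dip and width proportional to the dip, hence of bounded integral ([majorant_int]). *)
Definition contour_majorant (beta sigma xp x : R) : R :=
  2 * exp (- (decay sigma / 8 * x)) +
  16 * exp (decay sigma * dipmax beta) / dip beta xp *
   / (1 + (decay sigma * reach sigma * dipmax beta / 8 * (x - xp) / dip beta xp) ^ 2).

(** Below height gap the contour is within distance one of the pole, where the dip is at most
    dipmax / x. *)
Lemma contour_gain beta sigma xp x : 0 <= beta < 2 -> 0 < sigma -> vstart sigma <= x ->
  x * (gap beta - cheight (gap beta) (dip beta xp) xp x) <= dipmax beta.
Proof.
  intros Hb Hs Hx.
  pose proof (vstart_pos sigma Hs) as Hv.
  destruct (dip_bounds beta xp Hb) as [Hd1 Hd2].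
  destruct (dipmax_bounds beta Hb) as [Hd0 [Hd3 Hd4]].
  destruct (cheight_bounds (gap beta) (dip beta xp) xp x Hd1) as [B1 [B2 [B3 B4]]].
  set (y := cheight _ _ _ _) in *.
  pose proof (Rabs_pos (x - xp)) as Ha.
  destruct (Rle_lt_dec 1 (Rabs (x - xp))) as [H1|H1].
  - assert (1 / 2 <= Rabs (x - xp) / (1 + Rabs (x - xp))) by (apply le_div; lra).
    assert (0 <= y - gap beta) by lra. nra.
  - apply Rle_trans with (x * dip beta xp).
    + apply Rmult_le_compat_l; lra.
    + assert (x <= 1 + Rmax xp 0).
      { apply Rabs_def2 in H1. pose proof (Rmax_l xp 0); lra. }
      replace (dipmax beta) with ((1 + Rmax xp 0) * dip beta xp).
      * apply Rmult_le_compat_r; lra.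
      * unfold dip; field. pose proof (Rmax_r xp 0); lra.
Qed.

Lemma majorant_bound (beta sigma x0 th l x : R) : 0 <= beta < 2 -> 0 < sigma ->
  Rabs th <= beta * PI / 2 -> vstart sigma <= x ->
  let y := cheight (gap beta) (dip beta (x0 - l)) (x0 - l) x in
  / Cmod (1 + Cexp ((x0, th) - (RtoC l + (x, y)))) * exp (- (decay sigma * x * (y - gap beta)))
    <= contour_majorant beta sigma (x0 - l) x.
Proof.
  intros Hb Hs Hth Hx y.
  pose proof (vstart_pos sigma Hs) as Hv. pose proof (decay_pos sigma Hs) as Hk.
  pose proof (contour_gain beta sigma (x0 - l) x Hb Hs Hx) as Hgain.
  destruct (dip_bounds beta (x0 - l) Hb) as [Hd1 Hd2].
  destruct (dipmax_bounds beta Hb) as [Hd0 [Hd3 Hd4]].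
  pose proof (gap_bounds beta Hb) as Hh.
  destruct (cheight_bounds (gap beta) (dip beta (x0 - l)) (x0 - l) x Hd1) as [B1 [B2 [B3 B4]]].
  fold y in Hgain, B1, B2, B3, B4.
  unfold contour_majorant.
  set (d := dip beta (x0 - l)) in *. set (xp := x0 - l) in *.
  pose proof (Rabs_pos (x - xp)) as Ha.
  assert (HL : 0 < 16 * exp (decay sigma * dipmax beta) / d *
   / (1 + (decay sigma * reach sigma * dipmax beta / 8 * (x - xp) / d) ^ 2)).
  { apply Rmult_lt_0_compat.
    - apply Rdiv_lt_0_compat; [|assumption]. pose proof (exp_pos (decay sigma * dipmax beta)); lra.
    - apply Rinv_0_lt_compat. match goal with |- 0 < 1 + ?e ^ 2 => pose proof (pow2_ge_0 e) end. lra. }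
  destruct (Rle_lt_dec 1 (Rabs (x - xp))) as [H1|H1].
  - pose proof (kernel_far x0 th l x y H1) as K.
    assert (1 / 2 <= Rabs (x - xp) / (1 + Rabs (x - xp))) by (apply le_div; lra).
    assert (Hy : 1 / 8 <= y - gap beta) by lra.
    apply Rle_trans with (2 * exp (- (decay sigma / 8 * x))); [|lra].
    apply Rmult_le_compat.
    + left; apply Rinv_0_lt_compat; lra.
    + left; apply exp_pos.
    + replace 2 with (/ (1 / 2)) by field. apply Rinv_le_contravar; lra.
    + apply exp_mono. apply Ropp_le_contravar.
      assert (0 <= decay sigma * x) by nra.
      replace (decay sigma / 8 * x) with (decay sigma * x * (1 / 8)) by field.
      apply Rmult_le_compat_l; assumption.
  - assert (K : d / 16 <= Cmod (1 + Cexp ((x0, th) - (RtoC l + (x, y))))).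
    { apply kernel_near; try assumption. fold xp; fold d; fold y. lra. }
    set (c2 := decay sigma * reach sigma * dipmax beta / 8) in *.
    assert (Hc3 : 0 < reach sigma /\ reach sigma <= vstart sigma / 3 /\ reach sigma <= 1 / 3).
    { unfold reach; split; [apply Rmin_glb_lt; lra|split; [apply Rmin_l|apply Rmin_r]]. }
    destruct Hc3 as [Hc3 [Hc4 Hc5]].
    assert (Hxl : reach sigma * (1 + Rmax xp 0) <= x).
    { destruct (Rle_lt_dec xp 2) as [L|L].
      - assert (Rmax xp 0 <= 2) by (apply Rmax_lub; lra). nra.
      - rewrite Rmax_left by lra. apply Rabs_def2 in H1. nra. }
    assert (Ed : d * (1 + Rmax xp 0) = dipmax beta).
    { unfold d, dip; fold xp; field. pose proof (Rmax_r xp 0); lra. }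
    (* Near the pole x * d is at most dipmax, so the dip costs a constant; the climb of slope at
       least 1/4 gains in proportion to the distance measured in dips. *)
    assert (Hexp : - (decay sigma * x * (y - gap beta)) <=
       decay sigma * dipmax beta - 2 * (c2 * Rabs (x - xp) / d)).
    { assert (G1 : x * d <= dipmax beta).
      { rewrite <- Ed, Rmult_comm. apply Rmult_le_compat_l; [lra|].
        apply Rabs_def2 in H1; pose proof (Rmax_l xp 0); lra. }
      assert (G2 : 1 / 2 * Rabs (x - xp) <= Rabs (x - xp) / (1 + Rabs (x - xp))).
      { apply le_div; [lra|]. nra. }
      assert (G3 : - d + 1 / 4 * Rabs (x - xp) <= y - gap beta) by lra.
      assert (G4 : reach sigma * dipmax beta / d <= x).
      { rewrite <- Ed. replace (reach sigma * (d * (1 + Rmax xp 0)) / d)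
          with (reach sigma * (1 + Rmax xp 0)) by (field; lra). assumption. }
      assert (G5 : decay sigma * x * (- d + 1 / 4 * Rabs (x - xp)) <= decay sigma * x * (y - gap beta)).
      { apply Rmult_le_compat_l; [nra|assumption]. }
      assert (G6 : decay sigma * (x * d) <= decay sigma * dipmax beta) by (apply Rmult_le_compat_l; lra).
      assert (G7 : decay sigma * (1 / 4 * Rabs (x - xp)) * (reach sigma * dipmax beta / d) <=
                   decay sigma * (1 / 4 * Rabs (x - xp)) * x).
      { apply Rmult_le_compat_l; [|assumption]. nra. }
      replace (2 * (c2 * Rabs (x - xp) / d)) with
        (decay sigma * (1 / 4 * Rabs (x - xp)) * (reach sigma * dipmax beta / d)) by (unfold c2; field; lra).
      lra. }
    apply Rle_trans with (16 * exp (decay sigma * dipmax beta) / d * / (1 + (c2 * (x - xp) / d) ^ 2));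
      [|pose proof (exp_pos (- (decay sigma / 8 * x))); lra].
    apply Rle_trans with (16 / d * (exp (decay sigma * dipmax beta) * exp (- (2 * (c2 * Rabs (x - xp) / d))))).
    + apply Rmult_le_compat.
      * left; apply Rinv_0_lt_compat; lra.
      * left; apply exp_pos.
      * replace (16 / d) with (/ (d / 16)) by (field; lra). apply Rinv_le_contravar; lra.
      * rewrite <- exp_plus. apply exp_mono. lra.
    + replace (16 * exp (decay sigma * dipmax beta) / d) with (16 / d * exp (decay sigma * dipmax beta)) by (field; lra).
      rewrite <- Rmult_assoc. apply Rmult_le_compat_l.
      * apply Rmult_le_pos; [|left; apply exp_pos]. apply le_div; lra.
      * assert (0 <= c2) by (unfold c2; apply le_div; [lra|]; rewrite Rmult_0_l;
          apply Rmult_le_pos; [apply Rmult_le_pos|]; lra).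
        eapply Rle_trans; [apply exp_neg_le_lorentz|].
        -- assert (0 <= c2 * Rabs (x - xp) / d) by (apply le_div; [lra|]; nra). lra.
        -- apply Req_le; f_equal; f_equal.
           replace (2 * (c2 * Rabs (x - xp) / d) / 2) with (c2 / d * Rabs (x - xp)) by (field; lra).
           rewrite Rpow_mult_distr, pow2_abs. field; lra.
Qed.

Lemma majorant_int beta sigma : 0 <= beta < 2 -> 0 < sigma ->
  exists K, 0 < K /\ forall xp a b, 0 <= a <= b ->
    ex_RInt (contour_majorant beta sigma xp) a b /\ RInt (contour_majorant beta sigma xp) a b <= K.
Proof.
  intros Hb Hs.
  pose proof (vstart_pos sigma Hs) as Hv. pose proof (decay_pos sigma Hs) as Hk.
  destruct (dipmax_bounds beta Hb) as [Hd0 [Hd3 Hd4]].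
  set (c1 := decay sigma / 8). assert (Hc1 : 0 < c1) by (unfold c1; lra).
  assert (Hc3 : 0 < reach sigma) by (unfold reach; apply Rmin_glb_lt; lra).
  set (c2 := decay sigma * reach sigma * dipmax beta / 8).
  assert (Hc2 : 0 < c2).
  { unfold c2; apply Rdiv_lt_0_compat; [|lra].
    apply Rmult_lt_0_compat; [apply Rmult_lt_0_compat|]; assumption. }
  set (K2 := 16 * exp (decay sigma * dipmax beta)).
  assert (HK2 : 0 < K2) by (unfold K2; pose proof (exp_pos (decay sigma * dipmax beta)); lra).
  pose proof PI_RGT_0 as HP.
  exists (2 / c1 + K2 / c2 * PI); split.
  { apply Rplus_lt_0_compat; [apply Rdiv_lt_0_compat; lra|].
    apply Rmult_lt_0_compat; [apply Rdiv_lt_0_compat|]; assumption. }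
  intros xp a b Hab.
  destruct (dip_bounds beta xp Hb) as [Hd1 Hd2].
  set (A := fun x => - (2 / c1) * exp (- (c1 * x)) + K2 / c2 * atan (c2 * (x - xp) / dip beta xp)).
  assert (Hden : forall x, 0 < 1 + (c2 * (x - xp) / dip beta xp) ^ 2).
  { intros x; pose proof (pow2_ge_0 (c2 * (x - xp) / dip beta xp)); lra. }
  assert (HA : is_RInt (contour_majorant beta sigma xp) a b (A b - A a)).
  { apply (is_RInt_derive (V := R_CompleteNormedModule) A (contour_majorant beta sigma xp)).
    - intros x _; unfold A, contour_majorant; fold c1 c2 K2. specialize (Hden x).
      auto_derive; [trivial|]. unfold Rsqr.
      assert (Hne : 1 + c2 * (x + - xp) * / dip beta xp * (c2 * (x + - xp) * / dip beta xp) <> 0).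
      { replace (c2 * (x + - xp) * / dip beta xp * (c2 * (x + - xp) * / dip beta xp))
          with ((c2 * (x - xp) / dip beta xp) ^ 2) by (unfold Rdiv; ring). lra. }
      unfold Rdiv in *; simpl pow in *. unfold Rminus in *.
      field_simplify_eq; [ring|].
      repeat split; try lra.
      intros E0. apply Hne. 
      apply Rmult_eq_reg_r with (dip beta xp * dip beta xp); [|nra].
      rewrite Rmult_0_l. rewrite <- E0. field. lra.
    - intros x _; unfold contour_majorant; fold c1 c2 K2. specialize (Hden x).
      cont_der; auto_derive.
      unfold Rdiv in *; simpl pow in *; unfold Rminus in *. lra. }
  split; [eexists; exact HA|].
  rewrite (is_RInt_unique _ _ _ _ HA). unfold A.
  pose proof (atan_bound (c2 * (b - xp) / dip beta xp)) as T1.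
  pose proof (atan_bound (c2 * (a - xp) / dip beta xp)) as T2.
  pose proof (exp_pos (- (c1 * b))) as E1.
  assert (E2 : exp (- (c1 * a)) <= 1).
  { rewrite <- exp_0; apply exp_mono. nra. }
  assert (P1 : 0 < 2 / c1) by (apply Rdiv_lt_0_compat; lra).
  assert (P2 : 0 < K2 / c2) by (apply Rdiv_lt_0_compat; lra).
  set (t1 := atan _) in *. set (t2 := atan (c2 * (a - xp) / dip beta xp)) in *.
  assert (2 / c1 * exp (- (c1 * a)) <= 2 / c1 * 1) by (apply Rmult_le_compat_l; lra).
  assert (0 <= 2 / c1 * exp (- (c1 * b))) by (apply Rmult_le_pos; lra).
  assert (K2 / c2 * (t1 - t2) <= K2 / c2 * PI) by (apply Rmult_le_compat_l; lra).
  lra.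
Qed.

Lemma CInt_diff_bound (f : R -> C) a b M : 0 <= a -> 0 <= b ->
  (forall t, 0 <= t <= Rmax a b -> ccont f t) ->
  (forall t, Rmin a b <= t <= Rmax a b -> Cmod (f t) <= M) ->
  Cmod (CInt f 0 a - CInt f 0 b) <= 2 * (Rabs (a - b) * M).
Proof.
  intros Ha Hb Hc HM.
  assert (W : forall u v, 0 <= u <= v -> (forall t, 0 <= t <= v -> ccont f t) ->
     (forall t, u <= t <= v -> Cmod (f t) <= M) ->
     Cmod (CInt f 0 v - CInt f 0 u) <= 2 * ((v - u) * M)).
  { intros u v Huv Hcv HMv.
    rewrite <- (CInt_Chasles f 0 u v); [|lra|].
    - replace (CInt f 0 u + CInt f u v - CInt f 0 u)%C with (CInt f u v) by ring.
      apply CInt_bound_const; [lra| |assumption].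
      intros t; rewrite Rmin_left, Rmax_right by lra; intros; apply Hcv; lra.
    - intros t; rewrite Rmin_left, Rmax_right by lra; intros; apply Hcv; lra. }
  destruct (Rle_lt_dec a b) as [L|L].
  - rewrite Rmin_left, Rmax_right in * by lra.
    replace (CInt f 0 a - CInt f 0 b)%C with (- (CInt f 0 b - CInt f 0 a))%C by ring.
    rewrite Cmod_opp, Rabs_left1 by lra. replace (- (a - b)) with (b - a) by ring.
    apply W; [lra| |]; assumption.
  - rewrite Rmin_right, Rmax_left in * by lra.
    rewrite Rabs_right by lra. apply W; [lra| |]; assumption.
Qed.

(** Bounds phi on verticals of the strip |Im w| <= 2 pi ([Cmod_phi]). *)
Definition phisize (alpha x : R) : R := exp (alpha * x) * (Rabs (jumplog alpha) * Rabs x + 3).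

Lemma phisize_pos alpha x : 0 <= phisize alpha x.
Proof.
  unfold phisize; apply Rmult_le_pos; [left; apply exp_pos|].
  pose proof (Rmult_le_pos _ _ (Rabs_pos (jumplog alpha)) (Rabs_pos x)); lra.
Qed.

Lemma Cmod_integrand alpha sigma l rho w0 (x t L Q : R) :
  Rabs t <= 2 * PI -> 0 < L -> L <= Cmod (1 + Cexp (w0 - (RtoC l + (x, t)))) ->
  Cmod (abelq sigma rho (x, t)) <= Q ->
  Cmod (integrand alpha sigma l rho w0 (x, t)) <= phisize alpha (l + x) * / L * Q.
Proof.
  intros Ht HL Hk Hq. unfold integrand, gker.
  rewrite !Cmod_mult, Cmod_inv by (apply Cmod_pos_neq; lra).
  apply Rmult_le_compat; [|apply Cmod_ge_0| |assumption].
  - apply Rmult_le_pos; [apply Cmod_ge_0|left; apply Rinv_0_lt_compat; lra].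
  - apply Rmult_le_compat; [apply Cmod_ge_0|left; apply Rinv_0_lt_compat; lra| |].
    + replace (RtoC l + (x, t))%C with ((l + x, t) : C) by (apply injective_projections; simpl; ring).
      apply Cmod_phi; assumption.
    + apply Rinv_le_contravar; assumption.
Qed.

Lemma kernel_right (x0 th l x t : R) : ln 2 <= l + x - x0 ->
  1 / 2 <= Cmod (1 + Cexp ((x0, th) - (RtoC l + (x, t)))).
Proof.
  intros H; rewrite arg_shift.
  eapply Rle_trans; [|apply one_plus_exp_lower].
  eapply Rle_trans; [|apply Rle_abs].
  assert (E : exp (x0 - l - x) <= / 2).
  { rewrite <- (exp_ln 2) by lra. rewrite <- exp_Ropp. apply exp_mono; lra. }
  lra.
Qed.

Lemma one_minus_Ev_upper sigma rho x t : 0 <= rho -> rho * exp (- (decay sigma * x * t)) < 1 ->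
  (1 - rho * Ev sigma (x, t) <> 0)%C.
Proof.
  intros Hr H; apply Cmod_pos_neq. eapply Rlt_le_trans; [|apply Cmod_one_minus].
  rewrite Cmod_mult, Cmod_R, Rabs_right, Cmod_Ev by lra. lra.
Qed.

(** The path is moved from the real axis to the contour. The integral over the contour and the left
    column are bounded by Bd, which controls the jump at the left end and its product with the decay of
    the Abel factor along the scale. The right column is left aside: it is not small, but analytic
    in the unit disc, and it is cut at a height independent of z. *)
Lemma shift_estimate (alpha beta sigma : R) : 0 <= beta < 2 -> 0 < sigma ->
  exists K, 0 < K /\ forall (l Vr rho x0 th Bd : R) (M : nat),
    vstart sigma < Vr -> Vr ^ 2 = sigma ^ 2 * (INR M + 1 / 2) -> ln 2 <= l + Vr ->
    0 <= rho < 1 -> x0 <= 0 -> Rabs th <= beta * PI / 2 ->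
    phisize alpha (l + vstart sigma) <= Bd ->
    (forall x, vstart sigma <= x <= Vr ->
       phisize alpha (l + x) * exp (- (decay sigma * x * gap beta)) <= Bd) ->
    Cmod (CInt (fun x => integrand alpha sigma l rho (x0, th) (x, 0)) (vstart sigma) Vr
          + Ci * CInt (fun t => integrand alpha sigma l rho (x0, th) (Vr, t)) 0 (gap beta))
      <= K * Bd.
Proof.
  intros Hb Hs.
  pose proof (vstart_pos sigma Hs) as Hv. pose proof (decay_pos sigma Hs) as Hk.
  destruct (dipmax_bounds beta Hb) as [Hd0 [Hd3 Hd4]].
  pose proof (gap_bounds beta Hb) as Hh. pose proof PI_RGT_0 as HP.
  assert (HP3 : 3 < PI) by (pose proof PI2_3_2; lra).
  destruct (majorant_int beta sigma Hb Hs) as [KM [HKM Hint]].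
  set (m0 := decay sigma * vstart sigma * (gap beta / 2)).
  assert (Hm0 : 0 < m0) by (unfold m0; apply Rmult_lt_0_compat; [nra|lra]).
  assert (He0 : exp (- m0) < 1) by (rewrite <- exp_0; apply exp_increasing; lra).
  set (Kq := / (1 - exp (- m0))).
  assert (HKq : 0 < Kq) by (apply Rinv_0_lt_compat; lra).
  set (lw := dipmax beta / (16 * (2 + vstart sigma))).
  assert (Hlw : 0 < lw) by (apply Rdiv_lt_0_compat; lra).
  assert (Hlw2 : lw <= 1 / 2) by (apply Rle_div_l; lra).
  set (K1 := 2 * ((PI + 1 / 2) * (/ lw * 2))).
  set (K2 := 2 * (2 * Kq * KM)).
  set (K3 := 2 * ((PI + 1 / 2) * (2 * 2 * exp (decay sigma * dipmax beta)))).
  assert (HK1 : 0 < K1).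
  { unfold K1. assert (0 < / lw) by (apply Rinv_0_lt_compat; lra). nra. }
  assert (HK2 : 0 < K2) by (unfold K2; nra).
  assert (HK3 : 0 < K3) by (unfold K3; pose proof (exp_pos (decay sigma * dipmax beta)); nra).
  exists (K1 + K2 + K3); split; [lra|].
  intros l Vr rho x0 th Bd M HVr HM Hln Hrho Hx0 Hth HT1 HT3.
  assert (HBd : 0 <= Bd) by (eapply Rle_trans; [apply phisize_pos|exact HT1]).
  set (xp := x0 - l). set (d := dip beta xp).
  destruct (dip_bounds beta xp Hb) as [Hd1 Hd2]; fold d in Hd1, Hd2.
  set (y := cheight (gap beta) d xp).
  assert (HyB : forall x, gap beta / 2 <= y x <= gap beta + 1 / 2).
  { intros x; destruct (cheight_bounds (gap beta) d xp x Hd1) as [_ [_ [B3 B4]]]; fold (y x) in *; lra. }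
  destruct (integrand_hol alpha sigma l rho (x0, th)) as [F' HF].
  set (F := integrand alpha sigma l rho (x0, th)) in *.
  assert (Hnz : forall x t, - (d / 4) < t < y x + d / 4 ->
     (1 + Cexp ((x0, th) - (RtoC l + (x, t))) <> 0)%C).
  { intros x t Ht; apply (kernel_nonzero beta); assumption. }
  (* For rho < 1 the Abel factor has no pole on the real axis, hence none in a thin strip below it;
     the width e2 of the strip may depend on all the data. *)
  set (g := 1 - rho).
  set (e2 := g / (decay sigma * (Vr + 1) * 2)).
  assert (HVp : 0 < decay sigma * (Vr + 1) * 2) by (assert (0 < Vr + 1) by lra; nra).
  assert (He2 : 0 < e2) by (unfold e2; apply Rdiv_lt_0_compat; unfold g; lra).
  set (eps := Rmin (Rmin (d / 4) e2) (Rmin (vstart sigma / 2) 1)).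
  assert (Heps : 0 < eps /\ eps <= d / 4 /\ eps <= e2 /\ eps <= vstart sigma / 2 /\ eps <= 1).
  { unfold eps; split; [apply Rmin_glb_lt; apply Rmin_glb_lt; lra|].
    pose proof (Rmin_l (Rmin (d / 4) e2) (Rmin (vstart sigma / 2) 1)).
    pose proof (Rmin_r (Rmin (d / 4) e2) (Rmin (vstart sigma / 2) 1)).
    pose proof (Rmin_l (d / 4) e2); pose proof (Rmin_r (d / 4) e2).
    pose proof (Rmin_l (vstart sigma / 2) 1); pose proof (Rmin_r (vstart sigma / 2) 1). lra. }
  assert (HE : forall x t, vstart sigma - eps < x < Vr + eps -> - eps < t ->
     (1 - rho * Ev sigma (x, t) <> 0)%C).
  { intros x t Hx Ht; apply one_minus_Ev_upper; [lra|].
    assert (Hxt : - (decay sigma * x * t) <= g / 2).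
    { assert (A1 : decay sigma * x * (- t) <= decay sigma * (Vr + 1) * e2).
      { destruct (Rle_lt_dec 0 t) as [T|T].
        - assert (0 <= decay sigma * x) by nra. assert (0 <= decay sigma * (Vr + 1) * e2) by nra. nra.
        - apply Rmult_le_compat; try lra; nra. }
      replace (decay sigma * (Vr + 1) * e2) with (g / 2) in A1
        by (unfold e2; field; split; lra).
      lra. }
    assert (Hex : exp (- (decay sigma * x * t)) <= exp (g / 2)) by (apply exp_mono; assumption).
    assert (Hg : exp (g / 2) <= / (1 - g / 2)).
    { replace (g / 2) with (- - (g / 2)) at 1 by ring. rewrite exp_Ropp.
      pose proof (exp_ineq1_le (- (g / 2))). apply Rinv_le_contravar; unfold g in *; lra. }
    assert (Hlast : rho * / (1 - g / 2) < 1).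
    { replace rho with (1 - g) by (unfold g; ring).
      apply Rmult_lt_reg_r with (1 - g / 2); [unfold g; lra|].
      rewrite Rmult_assoc, Rinv_l by (unfold g; lra). unfold g; lra. }
    assert (rho * exp (- (decay sigma * x * t)) <= rho * / (1 - g / 2)) by (apply Rmult_le_compat_l; lra).
    lra. }
  assert (Hhol : forall x t, vstart sigma - eps < x < Vr + eps -> 0 - eps < t < y x + eps ->
     hol F F' (x, t)).
  { intros x t Hx Ht; apply HF; [apply Hnz; lra|apply HE; lra]. }
  pose proof (cauchy_graph F F' (vstart sigma) Vr 0 eps y (cslope d xp)) as CG.
  specialize (CG (proj1 Heps) HVr).
  assert (Hyd : forall x, vstart sigma - eps < x < Vr + eps ->
    0 <= y x /\ is_derive y x (cslope d xp x) /\ continuous (cslope d xp) x).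
  { intros x _; split; [specialize (HyB x); lra|split].
    - apply cheight_derive; assumption.
    - apply cslope_continuous; assumption. }
  specialize (CG Hyd Hhol).
  set (left := CInt (fun t => F (vstart sigma, t)) 0 (y (vstart sigma))) in *.
  set (main := CInt (fun x => F (x, y x) * (1, cslope d xp x))%C (vstart sigma) Vr) in *.
  (* Left column: either the pole is at distance at least 1, or its abscissa is bounded and then
     the dip is bounded below. *)
  assert (BL : Cmod left <= K1 * Bd).
  { unfold left, K1.
    apply Rle_trans with (2 * ((y (vstart sigma) - 0) * (Bd * / lw * 2))).
    - apply CInt_bound_const.
      + specialize (HyB (vstart sigma)); lra.
      + intros t Ht; rewrite Rmin_left, Rmax_right in Ht by (specialize (HyB (vstart sigma)); lra).
        apply ccont_slice_v. apply (hol_ccont F F'); apply Hhol; lra.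
      + intros t Ht. pose proof (HyB (vstart sigma)) as Hy0.
        eapply Rle_trans; [apply (Cmod_integrand alpha sigma l rho (x0, th) (vstart sigma) t lw 2)|].
        * rewrite Rabs_right; lra.
        * assumption.
        * destruct (Rle_lt_dec 1 (Rabs (vstart sigma - xp))) as [H1|H1].
          -- apply Rle_trans with (1 / 2); [assumption|]. apply kernel_far; exact H1.
          -- eapply Rle_trans; [|apply (kernel_near beta); try assumption].
             fold xp; fold d. unfold lw, d, dip.
             assert (Rmax xp 0 <= 1 + vstart sigma).
             { apply Rmax_lub; [apply Rabs_def2 in H1; lra|lra]. }
             pose proof (Rmax_r xp 0).
             replace (dipmax beta / (16 * (2 + vstart sigma))) with (dipmax beta / (2 + vstart sigma) / 16) by (field; lra).
             apply Rmult_le_compat_r; [lra|]. apply Rmult_le_compat_l; [lra|].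
             apply Rinv_le_contravar; lra.
        * eapply Rle_trans; [apply (abelq_bound_vertical sigma rho (vstart sigma) t 0); try lra|].
          -- apply vstart_sq.
          -- assert (exp (- (decay sigma * vstart sigma * t)) <= 1); [|lra].
             rewrite <- exp_0; apply exp_mono.
             assert (0 <= decay sigma * vstart sigma * t) by (apply Rmult_le_pos; nra). lra.
        * apply Rmult_le_compat_r; [lra|]. apply Rmult_le_compat_r; [|assumption].
          left; apply Rinv_0_lt_compat; lra.
    - assert (Q : 0 <= Bd * / lw * 2).
      { apply Rmult_le_pos; [|lra]. apply Rmult_le_pos; [assumption|]. left; apply Rinv_0_lt_compat; lra. }
      assert ((y (vstart sigma) - 0) * (Bd * / lw * 2) <= (PI + 1 / 2) * (Bd * / lw * 2)).
      { apply Rmult_le_compat_r; [assumption|]. specialize (HyB (vstart sigma)); lra. }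
      apply Rle_trans with (2 * ((PI + 1 / 2) * (Bd * / lw * 2))); [lra|].
      apply Req_le; ring. }
  (* On the contour exp (- decay * x * y) splits into its value at height gap, covered by the
     hypothesis on the scale, and the factor that the majorant absorbs. *)
  assert (BM : Cmod main <= K2 * Bd).
  { unfold main, K2.
    destruct (Hint xp (vstart sigma) Vr ltac:(lra)) as [Ex Ib].
    apply Rle_trans with (2 * RInt (fun x => 2 * Kq * Bd * contour_majorant beta sigma xp x) (vstart sigma) Vr).
    - apply CInt_bound.
      + lra.
      + intros x Hx; rewrite Rmin_left, Rmax_right in Hx by lra.
        destruct (Hyd x ltac:(lra)) as [Y1 [Y2 Y3]].
        apply ccont_mult.
        * apply (ccont_comp (fun x => (x, y x)) F).
          -- apply ccont_real_pair; [apply continuous_id|]. eapply continuous_of_is_derive; exact Y2.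
          -- apply (hol_ccont F F'); apply Hhol; lra.
        * apply ccont_real_pair; [apply continuous_const|assumption].
      + intros x Hx. pose proof (HyB x) as Hyx.
        pose proof (majorant_bound beta sigma x0 th l x Hb Hs Hth (proj1 Hx)) as MB.
        cbv zeta in MB. fold xp in MB; fold d in MB; fold (y x) in MB.
        assert (Hnz' := Hnz x (y x) ltac:(lra)).
        assert (Hmp : 0 < Cmod (1 + Cexp ((x0, th) - (RtoC l + (x, y x))))) by (apply Cmod_gt_0; exact Hnz').
        rewrite Cmod_mult.
        assert (S2 : Cmod (1, cslope d xp x) <= 2).
        { eapply Rle_trans; [apply Cmod_le_abs|]. simpl. rewrite Rabs_R1.
          pose proof (cslope_bound d xp x Hd1). unfold Im; simpl; lra. }
        assert (S1 : Cmod (F (x, y x)) <= Kq * Bd * contour_majorant beta sigma xp x).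
        { eapply Rle_trans.
          - apply (Cmod_integrand alpha sigma l rho (x0, th) x (y x)
              (Cmod (1 + Cexp ((x0, th) - (RtoC l + (x, y x)))))
              (Kq * exp (- (decay sigma * x * y x))) ); [| exact Hmp|apply Rle_refl|].
            + rewrite Rabs_right; lra.
            + apply abelq_bound_far; try lra. unfold m0.
              apply Rmult_le_compat; try lra; nra.
          - replace (exp (- (decay sigma * x * y x))) with
              (exp (- (decay sigma * x * gap beta)) * exp (- (decay sigma * x * (y x - gap beta))))
              by (rewrite <- exp_plus; f_equal; ring).
            match goal with |- ?p * ?i * (Kq * (?e1 * ?e2)) <= _ =>
              replace (p * i * (Kq * (e1 * e2))) with (Kq * (p * e1) * (i * e2)) by ring end.
            apply Rmult_le_compat.
            + apply Rmult_le_pos; [lra|]. apply Rmult_le_pos; [apply phisize_pos|left; apply exp_pos].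
            + apply Rmult_le_pos; [left; apply Rinv_0_lt_compat; assumption|left; apply exp_pos].
            + apply Rmult_le_compat_l; [lra|]. apply HT3; lra.
            + exact MB. }
        replace (2 * Kq * Bd * contour_majorant beta sigma xp x) with (Kq * Bd * contour_majorant beta sigma xp x * 2) by ring.
        apply Rmult_le_compat; try apply Cmod_ge_0; assumption.
      + apply (ex_RInt_scal (V := R_NormedModule)); exact Ex.
    - rewrite (RInt_scal (V := R_CompleteNormedModule)) by exact Ex.
      unfold scal; simpl; unfold mult; simpl.
      assert (2 * Kq * Bd * RInt (contour_majorant beta sigma xp) (vstart sigma) Vr <= 2 * Kq * Bd * KM).
      { apply Rmult_le_compat_l; [|assumption]. apply Rmult_le_pos; lra. }
      replace (2 * (2 * Kq * KM) * Bd) with (2 * (2 * Kq * Bd * KM)) by ring. lra. }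
  (* The contour meets the right column at a height different from gap; the piece in between is
     harmless, since the kernel is bounded on the whole column. *)
  assert (BR : Cmod (CInt (fun t => F (Vr, t)) 0 (y Vr) - CInt (fun t => F (Vr, t)) 0 (gap beta))
               <= K3 * Bd).
  { unfold K3. pose proof (HyB Vr) as HyV.
    assert (HMx : 0 <= Rmax (y Vr) (gap beta) <= PI + 1 / 2).
    { split; [|apply Rmax_lub; lra]. pose proof (Rmax_r (y Vr) (gap beta)); lra. }
    assert (HrEv : forall t, 0 <= t -> (1 - rho * Ev sigma (Vr, t) <> 0)%C).
    { intros t Ht; apply Cmod_pos_neq.
      pose proof (one_minus_Ev_vertical sigma rho Vr t M Hs ltac:(lra) ltac:(lra) HM Ht); lra. }
    assert (Hkr : forall t, 1 / 2 <= Cmod (1 + Cexp ((x0, th) - (RtoC l + (Vr, t))))).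
    { intros t; apply kernel_right; lra. }
    eapply Rle_trans.
    - apply (CInt_diff_bound _ _ _ (Bd * (2 * 2 * exp (decay sigma * dipmax beta)))).
      + lra.
      + lra.
      + intros t Ht; apply ccont_slice_v; apply (hol_ccont F F'); apply HF.
        * apply Cmod_pos_neq; specialize (Hkr t); lra.
        * apply HrEv; lra.
      + intros t Ht.
        assert (Ht0 : 0 <= t) by (pose proof (Rmin_glb (y Vr) (gap beta) 0); lra).
        eapply Rle_trans; [apply (Cmod_integrand alpha sigma l rho (x0, th) Vr t (1 / 2)
              (2 * exp (- (decay sigma * Vr * t))))|].
        * rewrite Rabs_right; lra.
        * lra.
        * apply Hkr.
        * apply (abelq_bound_vertical sigma rho Vr t M); try lra.
        * assert (Hdrop : exp (- (decay sigma * Vr * t)) <=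
            exp (- (decay sigma * Vr * gap beta)) * exp (decay sigma * dipmax beta)).
          { rewrite <- exp_plus; apply exp_mono.
            pose proof (contour_gain beta sigma xp Vr Hb Hs ltac:(lra)) as CGn.
            fold d in CGn; fold (y Vr) in CGn.
            assert (Vr * (gap beta - t) <= dipmax beta).
            { unfold Rmin in Ht; destruct (Rle_dec (y Vr) (gap beta)).
              - apply Rle_trans with (Vr * (gap beta - y Vr)); [|assumption].
                apply Rmult_le_compat_l; lra.
              - nra. }
            assert (decay sigma * (Vr * (gap beta - t)) <= decay sigma * dipmax beta)
              by (apply Rmult_le_compat_l; lra).
            lra. }
          specialize (HT3 Vr ltac:(lra)).
          replace (/ (1 / 2)) with 2 by field.
          apply Rle_trans with (phisize alpha (l + Vr) * 2 *
             (2 * (exp (- (decay sigma * Vr * gap beta)) * exp (decay sigma * dipmax beta)))).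
          -- apply Rmult_le_compat_l; [|lra]. pose proof (phisize_pos alpha (l + Vr)); lra.
          -- match goal with |- ?p * 2 * (2 * (?e1 * ?e2)) <= _ =>
               replace (p * 2 * (2 * (e1 * e2))) with (p * e1 * (2 * 2 * e2)) by ring end.
             apply Rmult_le_compat_r; [|assumption].
             pose proof (exp_pos (decay sigma * dipmax beta)); lra.
    - assert (Rabs (y Vr - gap beta) <= PI + 1 / 2) by (apply Rabs_le; lra).
      assert (0 <= Bd * (2 * 2 * exp (decay sigma * dipmax beta))).
      { apply Rmult_le_pos; [assumption|]. pose proof (exp_pos (decay sigma * dipmax beta)); lra. }
      assert (Rabs (y Vr - gap beta) * (Bd * (2 * 2 * exp (decay sigma * dipmax beta))) <=
              (PI + 1 / 2) * (Bd * (2 * 2 * exp (decay sigma * dipmax beta))))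
        by (apply Rmult_le_compat_r; assumption).
      lra. }
  match goal with |- Cmod ?e <= _ =>
    replace e with (main + Ci * left
      - Ci * (CInt (fun t => F (Vr, t)) 0 (y Vr) - CInt (fun t => F (Vr, t)) 0 (gap beta)))%C end.
  - eapply Rle_trans; [apply Cmod_triangle|]; rewrite Cmod_opp.
    eapply Rle_trans; [apply Rplus_le_compat_r, Cmod_triangle|].
    rewrite !Cmod_mult, Cmod_Ci, !Rmult_1_l. lra.
  - replace (main + Ci * left)%C with
      (CInt (fun x => F (x, 0%R)) (vstart sigma) Vr + Ci * CInt (fun t => F (Vr, t)) 0 (y Vr))%C
      by (rewrite CG; reflexivity).
    ring.
Qed.

(** * The slit representation of z^alpha log z *)

(** z^alpha log z as a function of w = log z. *)
Definition psi (alpha : R) (w : C) : C := (Cexp (alpha * w) * w)%C.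

Lemma psi_hol alpha : exists psi', forall w, hol (psi alpha) psi' w.
Proof.
  eexists; intros w. unfold psi.
  repeat first [apply hol_const | apply hol_id | apply hol_mult | apply hol_Cexp].
Qed.

Lemma psi_jump alpha (x : R) :
  (psi alpha (x, PI) - psi alpha (x, (- PI)%R) = (2 * PI)%R * Ci * phi alpha (RtoC x))%C.
Proof.
  pose proof PI_RGT_0 as HP. unfold psi, phi, jumplog, jumpcst.
  assert (E1 : Cexp (alpha * (x, PI)) = (Cexp (alpha * x) * Cexp (0, (PI * alpha)%R))%C).
  { rewrite <- Cexp_plus; f_equal; ceq. }
  assert (E2 : Cexp (alpha * (x, (- PI)%R)) = (Cexp (alpha * x) * Cexp (0, (- (PI * alpha))%R))%C).
  { rewrite <- Cexp_plus; f_equal; ceq. }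
  rewrite E1, E2.
  replace (Cexp (alpha * x) * Cexp (0, (PI * alpha)%R) * (x, PI) -
    Cexp (alpha * x) * Cexp (0, (- (PI * alpha))%R) * (x, (- PI)%R))%C
    with (Cexp (alpha * x) * (Cexp (0, (PI * alpha)%R) * (x, PI) - Cexp (0, (- (PI * alpha))%R) * (x, (- PI)%R)))%C
    by ring.
  replace ((2 * PI)%R * Ci * (Cexp (alpha * x) * ((sin (PI * alpha) / PI)%R * x + cos (PI * alpha))))%C
    with (Cexp (alpha * x) * ((2 * PI)%R * Ci * ((sin (PI * alpha) / PI)%R * x + cos (PI * alpha))))%C by ring.
  f_equal.
  unfold Cexp; simpl; rewrite exp_0, cos_neg, sin_neg.
  apply injective_projections; simpl; field; lra.
Qed.

Definition gline (alpha : R) (w0 : C) (x : R) : C :=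
  (phi alpha (RtoC x) * / (1 + Cexp (w0 - RtoC x)))%C.

Lemma gker_gline alpha l w0 v : gker alpha l w0 (v, 0) = gline alpha w0 (l + v).
Proof.
  unfold gker, gline. replace (RtoC l + (v, 0))%C with (RtoC (l + v)) by ceq. reflexivity.
Qed.

Lemma line_lower beta x0 th x : 0 <= beta < 2 -> Rabs th <= beta * PI / 2 ->
  opening beta <= Cmod (1 + Cexp ((x0, th) - RtoC x)).
Proof.
  intros Hb Hth. pose proof (opening_bound beta Hb) as Ho. pose proof PI_RGT_0 as HP.
  assert (E : Cexp ((x0, th) - RtoC x) = (exp (x0 - x) * Cexp (0, th))%C).
  { rewrite <- Cexp_RtoC, <- Cexp_plus; f_equal; ceq. }
  rewrite E. pose proof (exp_pos (x0 - x)).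
  eapply Rle_trans; [|apply (polar_lower (exp (x0 - x)) th 1 (beta * PI / 2))]; try lra.
  - unfold opening in *. replace (beta * PI / 2 / 2) with (beta * PI / 4) by field. nra.
  - nra.
Qed.

Lemma gline_ccont beta alpha x0 th x : 0 <= beta < 2 -> Rabs th <= beta * PI / 2 ->
  ccont (gline alpha (x0, th)) x.
Proof.
  intros Hb Hth; unfold gline, phi; apply ccont_mult; [ccs|].
  apply ccont_inv; [ccs|]. apply Cmod_pos_neq.
  pose proof (line_lower beta x0 th x Hb Hth). pose proof (opening_bound beta Hb); lra.
Qed.

Lemma gline_bound beta alpha x0 th x : 0 <= beta < 2 -> Rabs th <= beta * PI / 2 ->
  Cmod (gline alpha (x0, th) x) <= phisize alpha x / opening beta.
Proof.
  intros Hb Hth; unfold gline. pose proof PI_RGT_0.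
  pose proof (line_lower beta x0 th x Hb Hth). pose proof (opening_bound beta Hb).
  rewrite Cmod_mult, Cmod_inv by (apply Cmod_pos_neq; lra).
  apply Rmult_le_compat; try apply Cmod_ge_0.
  - left; apply Rinv_0_lt_compat; lra.
  - apply (Cmod_phi alpha x 0). rewrite Rabs_R0; lra.
  - apply Rinv_le_contravar; lra.
Qed.

Lemma ckern_edge x0 th x : ckern (x0, th) (x, PI) = (/ (1 + Cexp ((x0, th) - RtoC x)))%C /\
  ckern (x0, th) (x, - PI) = (/ (1 + Cexp ((x0, th) - RtoC x)))%C.
Proof.
  unfold ckern.
  assert (E0 : forall s, cos s = -1 -> sin s = 0 -> Cexp (0, s) = (- (1))%C).
  { intros s H1 H2; unfold Cexp; simpl; rewrite exp_0, H1, H2; ceq. }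
  split; f_equal.
  - replace ((x0, th) - (x, PI))%C with ((x0, th) - RtoC x + (0, (- PI)%R))%C by ceq.
    rewrite Cexp_plus, E0; [ring| |].
    + rewrite cos_neg; apply cos_PI.
    + rewrite sin_neg, sin_PI; ring.
  - replace ((x0, th) - (x, (- PI)%R))%C with ((x0, th) - RtoC x + (0, PI))%C by ceq.
    rewrite Cexp_plus, E0; [ring|apply cos_PI|apply sin_PI].
Qed.

Definition circle_part (alpha : R) (w0 : C) (x : R) : C :=
  (/ (2 * PI)%R * CInt (fun t => psi alpha (x, t) * ckern w0 (x, t)) (- PI) PI)%C.

(** On the two sides Im w = pi and Im w = - pi the kernel takes the same values, so that only the jump of
    psi remains. *)
Lemma keyhole alpha beta x0 th L Rr : 0 <= beta < 2 -> Rabs th <= beta * PI / 2 -> L < x0 < Rr ->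
  psi alpha (x0, th) =
  (circle_part alpha (x0, th) Rr - circle_part alpha (x0, th) L
   - CInt (gline alpha (x0, th)) L Rr)%C.
Proof.
  intros Hb Hth HL. pose proof PI_RGT_0 as HP.
  destruct (psi_hol alpha) as [psi' Hpsi].
  assert (Hth2 : - PI < th < PI) by (apply Rabs_le_between in Hth; nra).
  pose proof (cauchy_formula (psi alpha) psi' x0 th L Rr Hpsi HL Hth2) as CF.
  unfold bdint in CF.
  assert (Hg : ccont_on (gline alpha (x0, th)) L Rr).
  { intros t _; apply (gline_ccont beta); assumption. }
  assert (Hpc : forall w, ccont (psi alpha) w) by (intros; apply (hol_ccont _ _ _ (Hpsi w))).
  assert (Hk : forall x, ccont (fun x => / (1 + Cexp ((x0, th) - RtoC x)))%C x).
  { intros x; apply ccont_inv; [ccs|]. apply Cmod_pos_neq.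
    pose proof (line_lower beta x0 th x Hb Hth). pose proof (opening_bound beta Hb); lra. }
  assert (E : (CInt (fun x => psi alpha (x, (- PI)%R) * ckern (x0, th) (x, (- PI)%R)) L Rr -
     CInt (fun x => psi alpha (x, PI) * ckern (x0, th) (x, PI)) L Rr =
     - ((2 * PI)%R * Ci) * CInt (gline alpha (x0, th)) L Rr)%C).
  { rewrite <- CInt_scal by assumption. rewrite <- CInt_minus.
    - apply CInt_ext; intros x _.
      destruct (ckern_edge x0 th x) as [K1 K2]; rewrite K1, K2.
      unfold gline. pose proof (psi_jump alpha x) as J.
      match goal with |- ?l = ?r => 
        transitivity (- ((psi alpha (x, PI) - psi alpha (x, (- PI)%R)) * / (1 + Cexp ((x0, th) - RtoC x))))%C end.
      + ring.
      + rewrite J; ring.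
    - intros x _. apply (ccont_ext (fun x => psi alpha (x, (- PI)%R) * / (1 + Cexp ((x0, th) - RtoC x)))%C).
      + intros t; rewrite (proj2 (ckern_edge x0 th t)); reflexivity.
      + apply ccont_mult; [|apply Hk]. apply ccont_slice_h, Hpc.
    - intros x _. apply (ccont_ext (fun x => psi alpha (x, PI) * / (1 + Cexp ((x0, th) - RtoC x)))%C).
      + intros t; rewrite (proj1 (ckern_edge x0 th t)); reflexivity.
      + apply ccont_mult; [|apply Hk]. apply ccont_slice_h, Hpc. }
  unfold circle_part.
  assert (Hn : RtoC (2 * PI) <> 0) by (apply Cmod_pos_neq; rewrite Cmod_R, Rabs_right; lra).
  assert (Hi : Ci <> 0) by (apply Cmod_pos_neq; rewrite Cmod_Ci; lra).
  assert (Hc : ((2 * PI)%R * Ci <> 0)%C) by (apply Cmult_neq_0; assumption).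
  set (bot := CInt (fun x => psi alpha (x, (- PI)%R) * ckern (x0, th) (x, (- PI)%R))%C L Rr) in *.
  set (top := CInt (fun x => psi alpha (x, PI) * ckern (x0, th) (x, PI))%C L Rr) in *.
  set (rt := CInt (fun t => psi alpha (Rr, t) * ckern (x0, th) (Rr, t))%C (- PI) PI) in *.
  set (lf := CInt (fun t => psi alpha (L, t) * ckern (x0, th) (L, t))%C (- PI) PI) in *.
  set (G := CInt (gline alpha (x0, th)) L Rr) in *.
  assert (CF2 : ((2 * PI)%R * Ci * psi alpha (x0, th) =
     (bot - top) + Ci * rt - Ci * lf)%C) by (rewrite <- CF; ring).
  rewrite E in CF2.
  transitivity (/ ((2 * PI)%R * Ci) * ((2 * PI)%R * Ci * psi alpha (x0, th)))%C.
  - field; split; assumption.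
  - rewrite CF2. field; split; assumption.
Qed.

Lemma phisize_tail alpha X x : 0 < alpha -> x <= X ->
  phisize alpha x <= phisize alpha X * (1 + 2 / alpha) * exp (alpha / 2 * (x - X)).
Proof.
  intros Ha Hx; unfold phisize.
  pose proof (jumplog_le_1 alpha) as A1; pose proof (Rabs_pos (jumplog alpha)) as A2.
  set (a := Rabs (jumplog alpha)) in *.
  set (t := X - x). assert (Ht : 0 <= t) by (unfold t; lra).
  assert (B1 : a * Rabs x + 3 <= (a * Rabs X + 3) * (1 + t)).
  { assert (Rabs x <= Rabs X + t).
    { replace x with (X - t) by (unfold t; ring).
      eapply Rle_trans; [apply Rabs_triang|]. rewrite Rabs_Ropp, (Rabs_right t) by lra. lra. }
    assert (0 <= a * Rabs X) by (apply Rmult_le_pos; [assumption|apply Rabs_pos]).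
    assert (a * Rabs x <= a * (Rabs X + t)) by (apply Rmult_le_compat_l; assumption).
    nra. }
  assert (B2 : 1 + t <= (1 + 2 / alpha) * exp (alpha / 2 * t)).
  { pose proof (exp_ineq1_le (alpha / 2 * t)) as E.
    assert (0 < 2 / alpha) by (apply Rdiv_lt_0_compat; lra).
    assert (0 <= alpha / 2 * t) by (apply Rmult_le_pos; lra).
    assert ((1 + 2 / alpha) * (1 + alpha / 2 * t) <= (1 + 2 / alpha) * exp (alpha / 2 * t))
      by (apply Rmult_le_compat_l; lra).
    replace ((1 + 2 / alpha) * (1 + alpha / 2 * t)) with (1 + t + (2 / alpha + alpha / 2 * t)) in * by (field; lra).
    lra. }
  replace (exp (alpha * x)) with (exp (alpha * X) * exp (alpha / 2 * (x - X)) * exp (alpha / 2 * (x - X)))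
    by (rewrite <- !exp_plus; f_equal; field).
  assert (E3 : exp (alpha / 2 * (x - X)) * exp (alpha / 2 * t) = 1).
  { rewrite <- exp_plus. replace (alpha / 2 * (x - X) + alpha / 2 * t) with 0 by (unfold t; field). apply exp_0. }
  set (e1 := exp (alpha / 2 * (x - X))) in *. set (e2 := exp (alpha / 2 * t)) in *.
  pose proof (exp_pos (alpha * X)) as P1. set (e3 := exp (alpha * X)) in *.
  assert (P2 : 0 < e1) by apply exp_pos.
  set (m := a * Rabs X + 3) in *.
  assert (Hm : 0 < m).
  { unfold m. pose proof (Rmult_le_pos _ _ A2 (Rabs_pos X)); lra. }
  apply Rle_trans with (e3 * e1 * e1 * (m * (1 + t))).
  - apply Rmult_le_compat_l; [|assumption]. apply Rmult_le_pos; [apply Rmult_le_pos|]; lra.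
  - replace (e3 * e1 * e1 * (m * (1 + t))) with (e3 * m * e1 * (e1 * (1 + t))) by ring.
    replace (e3 * m * (1 + 2 / alpha) * e1) with (e3 * m * e1 * (1 + 2 / alpha)) by ring.
    apply Rmult_le_compat_l.
    + apply Rmult_le_pos; [apply Rmult_le_pos|]; lra.
    + replace (1 + 2 / alpha) with (e1 * ((1 + 2 / alpha) * e2)).
      * apply Rmult_le_compat_l; lra.
      * replace (e1 * ((1 + 2 / alpha) * e2)) with ((1 + 2 / alpha) * (e1 * e2)) by ring.
        rewrite E3; ring.
Qed.

(** The integrand decays exponentially towards the branch point. *)
Lemma near_cut_bound alpha beta : 0 < alpha -> 0 <= beta < 2 ->
  exists K, 0 < K /\ forall x0 th L X, Rabs th <= beta * PI / 2 -> L <= X ->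
    Cmod (CInt (gline alpha (x0, th)) L X) <= K * phisize alpha X.
Proof.
  intros Ha Hb. pose proof (opening_bound beta Hb) as Ho.
  assert (P2 : 0 < 2 / alpha) by (apply Rdiv_lt_0_compat; lra).
  set (K0 := (1 + 2 / alpha) / opening beta).
  assert (HK0 : 0 < K0) by (apply Rdiv_lt_0_compat; lra).
  exists (2 * (K0 * (2 / alpha))); split.
  { assert (0 < K0 * (2 / alpha)) by (apply Rmult_lt_0_compat; assumption). lra. }
  intros x0 th L X Hth HLX.
  set (B := phisize alpha X * K0).
  assert (HB : 0 <= B) by (apply Rmult_le_pos; [apply phisize_pos|lra]).
  set (A := fun x => B * (2 / alpha) * exp (alpha / 2 * (x - X))).
  assert (HA : is_RInt (fun x => B * exp (alpha / 2 * (x - X))) L X (A X - A L)).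
  { apply (is_RInt_derive (V := R_CompleteNormedModule) A).
    - intros x _; unfold A; auto_derive; [trivial|]. unfold Rminus. field. lra.
    - intros x _. cont_real. }
  eapply Rle_trans; [apply (CInt_bound _ (fun x => B * exp (alpha / 2 * (x - X))))|].
  - assumption.
  - intros t _; apply (gline_ccont beta); assumption.
  - intros x Hx. eapply Rle_trans; [apply (gline_bound beta); assumption|].
    apply Rle_trans with (phisize alpha X * (1 + 2 / alpha) * exp (alpha / 2 * (x - X)) / opening beta).
    + apply Rmult_le_compat_r; [left; apply Rinv_0_lt_compat; lra|].
      apply phisize_tail; lra.
    + apply Req_le; unfold B, K0; field; lra.
  - eexists; exact HA.
  - rewrite (is_RInt_unique _ _ _ _ HA). unfold A.
    replace (alpha / 2 * (X - X)) with 0 by ring. rewrite exp_0.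
    assert (0 <= B * (2 / alpha) * exp (alpha / 2 * (L - X))).
    { apply Rmult_le_pos; [apply Rmult_le_pos; lra|left; apply exp_pos]. }
    replace (2 * (K0 * (2 / alpha)) * phisize alpha X) with (2 * (B * (2 / alpha) * 1)) by (unfold B; ring).
    lra.
Qed.

Lemma Cmod_psi alpha x t : Rabs t <= PI ->
  Cmod (psi alpha (x, t)) <= exp (alpha * x) * (Rabs x + PI).
Proof.
  intros Ht; unfold psi; rewrite Cmod_mult, Cmod_Cexp.
  replace (Re (alpha * (x, t))) with (alpha * x) by (simpl; ring).
  apply Rmult_le_compat_l; [left; apply exp_pos|].
  eapply Rle_trans; [apply (Cmod_le_abs (x, t))|]. simpl; lra.
Qed.

Lemma exp_lin_small alpha eps : 0 < alpha -> 0 < eps ->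
  exists L0, forall L, L <= L0 -> exp (alpha * L) * (Rabs L + PI) <= eps.
Proof.
  intros Ha He. pose proof PI_RGT_0 as HP.
  set (K := 2 / alpha + PI).
  assert (P2 : 0 < 2 / alpha) by (apply Rdiv_lt_0_compat; lra).
  assert (HK : 0 < K) by (unfold K; lra).
  exists (Rmin 0 (2 / alpha * ln (eps / K))).
  intros L HL.
  pose proof (Rmin_l 0 (2 / alpha * ln (eps / K))).
  pose proof (Rmin_r 0 (2 / alpha * ln (eps / K))).
  rewrite Rabs_left1 by lra.
  assert (E1 : exp (alpha / 2 * L) <= eps / K).
  { assert (Hq : 0 < eps / K) by (apply Rdiv_lt_0_compat; lra).
    rewrite <- (exp_ln _ Hq). apply exp_mono.
    apply Rle_trans with (alpha / 2 * (2 / alpha * ln (eps / K))).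
    - apply Rmult_le_compat_l; lra.
    - apply Req_le; field; lra. }
  assert (E2 : - L + PI <= K * exp (- (alpha / 2 * L))).
  { pose proof (exp_ineq1_le (- (alpha / 2 * L))) as E.
    assert (K * (1 + - (alpha / 2 * L)) <= K * exp (- (alpha / 2 * L))) by (apply Rmult_le_compat_l; lra).
    assert (- L + PI <= K * (1 + - (alpha / 2 * L))).
    { unfold K. replace ((2 / alpha + PI) * (1 + - (alpha / 2 * L)))
        with (- L + PI + (2 / alpha + PI * (alpha / 2) * - L)) by (field; lra).
      assert (0 <= PI * (alpha / 2) * - L) by (apply Rmult_le_pos; [apply Rmult_le_pos|]; lra). lra. }
    lra. }
  replace (exp (alpha * L)) with (exp (alpha / 2 * L) * exp (alpha / 2 * L))
    by (rewrite <- exp_plus; f_equal; field).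
  assert (E3 : exp (alpha / 2 * L) * exp (- (alpha / 2 * L)) = 1).
  { rewrite <- exp_plus. replace (alpha / 2 * L + - (alpha / 2 * L)) with 0 by ring. apply exp_0. }
  pose proof (exp_pos (alpha / 2 * L)) as Pe. set (e := exp (alpha / 2 * L)) in *.
  apply Rle_trans with (e * (e * (K * exp (- (alpha / 2 * L))))).
  - rewrite Rmult_assoc. apply Rmult_le_compat_l; [lra|]. apply Rmult_le_compat_l; lra.
  - replace (e * (e * (K * exp (- (alpha / 2 * L))))) with (e * K * (e * exp (- (alpha / 2 * L)))) by ring.
    rewrite E3. replace eps with (eps / K * K) by (field; lra).
    rewrite Rmult_1_r. apply Rmult_le_compat_r; lra.
Qed.

Lemma small_circle alpha x0 th eps : 0 < alpha -> 0 < eps ->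
  exists L0, forall L, L <= L0 -> Cmod (circle_part alpha (x0, th) L) <= eps.
Proof.
  intros Ha He. pose proof PI_RGT_0 as HP.
  destruct (psi_hol alpha) as [psi' Hpsi].
  destruct (exp_lin_small alpha (eps / 2) Ha ltac:(lra)) as [L1 HL1].
  exists (Rmin L1 (x0 - 1)). intros L HL.
  pose proof (Rmin_l L1 (x0 - 1)); pose proof (Rmin_r L1 (x0 - 1)).
  assert (Hexp : exp (alpha * L) * (Rabs L + PI) <= eps / 2) by (apply HL1; lra).
  assert (Hlow : forall t, 1 <= Cmod (1 - Cexp ((x0, th) - (L, t)))).
  { intros t. pose proof (Cmod_triangle (1 - Cexp ((x0, th) - (L, t))) (- (1))) as T.
    replace (1 - Cexp ((x0, th) - (L, t)) + - (1))%C with (- Cexp ((x0, th) - (L, t)))%C in T by ring.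
    rewrite !Cmod_opp, Cmod_1, Cmod_Cexp in T. unfold Re in T; simpl in T.
    pose proof (exp_ineq1_le (x0 + - L)).
    assert (2 <= exp (x0 + - L)) by lra. lra. }
  unfold circle_part. rewrite Cmod_mult, Cmod_inv, Cmod_R, Rabs_right;
    [|lra|apply Cmod_pos_neq; rewrite Cmod_R, Rabs_right; lra].
  apply Rle_trans with (/ (2 * PI) * (2 * ((PI - - PI) * (eps / 2)))).
  - apply Rmult_le_compat_l; [left; apply Rinv_0_lt_compat; lra|].
    apply CInt_bound_const; [lra| |].
    + intros t _; apply ccont_mult.
      * apply ccont_slice_v, (hol_ccont _ _ _ (Hpsi _)).
      * unfold ckern; apply ccont_inv; [ccs|]. apply Cmod_pos_neq; specialize (Hlow t); lra.
    + intros t Ht. unfold ckern. specialize (Hlow t).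
      rewrite Cmod_mult, Cmod_inv by (apply Cmod_pos_neq; lra).
      assert (/ Cmod (1 - Cexp ((x0, th) - (L, t))) <= 1).
      { eapply Rle_trans; [apply Rinv_le_contravar; [|exact Hlow]; lra|]. rewrite Rinv_1; lra. }
      assert (Cmod (psi alpha (L, t)) <= eps / 2).
      { eapply Rle_trans; [apply Cmod_psi; apply Rabs_le; lra|assumption]. }
      rewrite <- (Rmult_1_r (eps / 2)).
      apply Rmult_le_compat; try assumption; [apply Cmod_ge_0|left; apply Rinv_0_lt_compat; lra].
  - apply Req_le; field; lra.
Qed.

(** * The quadrature formula *)

Lemma ccont_comp_R {T : UniformSpace} (g : T -> R) (f : R -> C) (x : T) :
  continuous g x -> ccont f (g x) -> ccont (fun t => f (g t)) x.
Proof.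
  intros Hg [H1 H2]; split.
  - apply (continuous_comp g (fun s => Re (f s))); assumption.
  - apply (continuous_comp g (fun s => Im (f s))); assumption.
Qed.

Lemma CInt_subst (f : R -> C) (g dg : R -> R) a b :
  (forall x, Rmin a b <= x <= Rmax a b -> ccont f (g x)) ->
  (forall x, Rmin a b <= x <= Rmax a b -> is_derive g x (dg x) /\ continuous dg x) ->
  CInt (fun x => dg x * f (g x))%C a b = CInt f (g a) (g b).
Proof.
  intros Hf Hg; unfold CInt; apply injective_projections; simpl.
  - rewrite <- (RInt_comp (V := R_CompleteNormedModule) (fun t => Re (f t)) g dg a b).
    + apply RInt_ext; intros; unfold scal; simpl; unfold mult; simpl; unfold Re; ring.
    + intros x Hx; apply (Hf x Hx).
    + assumption.
  - rewrite <- (RInt_comp (V := R_CompleteNormedModule) (fun t => Im (f t)) g dg a b).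
    + apply RInt_ext; intros; unfold scal; simpl; unfold mult; simpl; unfold Re, Im; ring.
    + intros x Hx; apply (Hf x Hx).
    + assumption.
Qed.

Lemma Ev_real sigma v : 0 < sigma -> Ev sigma (v, 0) = Eu (v ^ 2 / sigma ^ 2).
Proof.
  intros Hs; unfold Ev, Eu; f_equal. apply injective_projections; simpl; field; lra.
Qed.

Lemma poissonk_split sigma rho v : 0 < sigma -> 0 <= rho < 1 ->
  RtoC (poissonk rho (v ^ 2 / sigma ^ 2)) =
  (1 + abelq sigma rho (v, 0) + Cconj (abelq sigma rho (v, 0)))%C.
Proof.
  intros Hs Hr. rewrite poissonkE by assumption. unfold abelq.
  rewrite Ev_real, Eu_opp by assumption.
  set (E := Eu (v ^ 2 / sigma ^ 2)).
  assert (Hp : 0 < Cmod (1 - rho * E)) by (apply one_minus_rhoE_pos; assumption).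
  assert (Hn : (1 - rho * E <> 0)%C) by (apply Cmod_pos_neq; assumption).
  assert (Hc : Cconj (1 - rho * E) = (1 - rho * Cconj E)%C).
  { rewrite Cconj_minus, Cconj_mult, !Cconj_RtoC; reflexivity. }
  assert (Hn' : (1 - rho * Cconj E <> 0)%C).
  { apply Cmod_pos_neq; rewrite <- Hc, Cmod_conj; assumption. }
  rewrite !Cconj_mult, Cconj_inv, Cconj_RtoC, Hc. field; split; assumption.
Qed.

Lemma abelq_real_ccont sigma rho v : 0 < sigma -> 0 <= rho < 1 -> ccont (fun v => abelq sigma rho (v, 0)) v.
Proof.
  intros Hs Hr; unfold abelq, Ev; apply ccont_mult; [ccs|].
  apply ccont_inv; [ccs|].
  apply Cmod_pos_neq. change (0 < Cmod (1 - rho * Ev sigma (v, 0))).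
  rewrite Ev_real by assumption. apply one_minus_rhoE_pos; assumption.
Qed.

Lemma gline_conj alpha x0 th x : gline alpha (x0, - th) x = Cconj (gline alpha (x0, th) x).
Proof.
  unfold gline, phi.
  rewrite !Cconj_mult, Cconj_inv, !Cconj_plus, !Cconj_Cexp, Cconj_minus, !Cconj_mult, !Cconj_RtoC.
  reflexivity.
Qed.

(** The summand of the rule as a function of real u; sigma / (2 sqrt u) is dv / du. *)
Definition node_term (alpha sigma l : R) (w0 : C) (u : R) : C :=
  (RtoC (sigma / (2 * sqrt u)) * gline alpha w0 (l + sigma * sqrt u))%C.

(** The right column left aside in [shift_estimate]. *)
Definition column (alpha beta sigma l rho Vr : R) (w0 : C) : C :=
  CInt (fun t => integrand alpha sigma l rho w0 (Vr, t)) 0 (gap beta).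

Lemma node_term_ccont alpha beta sigma l x0 th u : 0 <= beta < 2 -> Rabs th <= beta * PI / 2 ->
  0 < u -> ccont (node_term alpha sigma l (x0, th)) u.
Proof.
  intros Hb Hth Hu. pose proof (sqrt_lt_R0 u Hu) as Hsq.
  unfold node_term; apply ccont_mult.
  - apply ccont_RtoC. cont_der.
    auto_derive. repeat split; try assumption; lra.
  - apply (ccont_comp_R (fun u => l + sigma * sqrt u) (gline alpha (x0, th))).
    + cont_der. auto_derive. assumption.
    + apply (gline_ccont beta); assumption.
Qed.

(** Uniformity in z comes from the lower bound of [line_lower], which holds on the whole slit. *)
Lemma node_term_equicont alpha beta sigma l u : 0 <= beta < 2 -> 0 < u ->
  forall eps, 0 < eps -> exists del, 0 < del /\ forall x0 th s,
    x0 <= 0 -> Rabs th <= beta * PI / 2 -> Rabs (s - u) < del ->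
    Cmod (node_term alpha sigma l (x0, th) s - node_term alpha sigma l (x0, th) u) <= eps.
Proof.
  intros Hb Hu eps He.
  pose proof (opening_bound beta Hb) as Ho. set (c := opening beta) in *.
  set (p := fun s => (RtoC (sigma / (2 * sqrt s)) * phi alpha (RtoC (l + sigma * sqrt s)))%C).
  set (E := fun s => exp (- (l + sigma * sqrt s))).
  pose proof (sqrt_lt_R0 u Hu) as Hsq.
  assert (Hp : ccont p u).
  { unfold p; apply ccont_mult.
    - apply ccont_RtoC. cont_der.
      auto_derive. repeat split; try assumption; lra.
    - apply (ccont_comp_R (fun s => l + sigma * sqrt s) (fun x => phi alpha (RtoC x))).
      + cont_der. auto_derive. assumption.
      + unfold phi; ccs. }
  assert (HE : ccont (fun s => RtoC (E s)) u).
  { apply ccont_RtoC; unfold E. cont_der.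
    auto_derive. assumption. }
  set (m := Cmod (p u) + 1). assert (Hm : 0 < m) by (unfold m; pose proof (Cmod_ge_0 (p u)); lra).
  assert (He1 : 0 < eps / 2 * c) by (apply Rmult_lt_0_compat; lra).
  assert (He2 : 0 < eps / 2 * (c * c) / m).
  { apply Rdiv_lt_0_compat; [|assumption]. apply Rmult_lt_0_compat; [lra|nra]. }
  destruct (filter_and _ _ (ccont_Cmod p u Hp _ He1) (ccont_Cmod _ u HE _ He2)) as [d Hd].
  exists d; split; [apply cond_pos|].
  intros x0 th s Hx0 Hth Hs. destruct (Hd s Hs) as [D1 D2]. cbv beta in D1, D2.
  set (z := Cexp (x0, th)).
  assert (Hz : Cmod z <= 1).
  { unfold z; rewrite Cmod_Cexp, <- exp_0; apply exp_mono. exact Hx0. }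
  assert (HzE : forall x, Cexp ((x0, th) - RtoC x) = (z * RtoC (exp (- x)))%C).
  { intros x; unfold z; rewrite <- Cexp_RtoC, <- Cexp_plus; f_equal; ceq. }
  assert (L : forall s, c <= Cmod (1 + z * RtoC (E s))).
  { intros s'; unfold E; rewrite <- HzE. apply line_lower; assumption. }
  assert (Nz : forall s, (1 + z * RtoC (E s) <> 0)%C).
  { intros s'; apply Cmod_pos_neq; specialize (L s'); lra. }
  assert (EqF : forall s, node_term alpha sigma l (x0, th) s = (p s * / (1 + z * RtoC (E s)))%C).
  { intros s'; unfold node_term, gline, p, E. rewrite HzE. ring. }
  rewrite !EqF.
  replace (p s * / (1 + z * RtoC (E s)) - p u * / (1 + z * RtoC (E u)))%C with
    ((p s - p u) * / (1 + z * RtoC (E s)) -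
     p u * z * (RtoC (E s) - RtoC (E u)) * (/ (1 + z * RtoC (E s)) * / (1 + z * RtoC (E u))))%C.
  2:{ field; split; apply Nz. }
  eapply Rle_trans; [apply Cmod_triangle|]; rewrite Cmod_opp, !Cmod_mult, !Cmod_inv by apply Nz.
  assert (I : forall s, 0 < / Cmod (1 + z * RtoC (E s)) <= / c).
  { intros s'; specialize (L s'); split; [apply Rinv_0_lt_compat; lra|apply Rinv_le_contravar; lra]. }
  pose proof (I s) as I1; pose proof (I u) as I2.
  set (i1 := / Cmod (1 + z * RtoC (E s))) in *. set (i2 := / Cmod (1 + z * RtoC (E u))) in *.
  assert (T1 : Cmod (p s - p u) * i1 <= eps / 2).
  { apply Rle_trans with (eps / 2 * c * / c).
    - apply Rmult_le_compat; try lra. apply Cmod_ge_0.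
    - apply Req_le; field; lra. }
  assert (T2 : Cmod (p u) * Cmod z * Cmod (RtoC (E s) - RtoC (E u)) * (i1 * i2) <= eps / 2).
  { apply Rle_trans with (m * 1 * (eps / 2 * (c * c) / m) * (/ c * / c)).
    - pose proof (Cmod_ge_0 (p u)); pose proof (Cmod_ge_0 z); pose proof (Cmod_ge_0 (RtoC (E s) - RtoC (E u))).
      apply Rmult_le_compat.
      + apply Rmult_le_pos; [apply Rmult_le_pos|]; assumption.
      + apply Rmult_le_pos; lra.
      + apply Rmult_le_compat; try lra; [apply Rmult_le_pos; assumption|].
        apply Rmult_le_compat; try lra. unfold m; lra.
      + apply Rmult_le_compat; lra.
    - apply Req_le; field; split; lra. }
  lra.
Qed.

Lemma node_term_bounded alpha beta sigma l (M : nat) : 0 <= beta < 2 -> 0 < sigma ->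
  exists B, forall x0 th u, Rabs th <= beta * PI / 2 -> 1 / 2 <= u <= INR M + 1 / 2 ->
    Cmod (node_term alpha sigma l (x0, th) u) <= B.
Proof.
  intros Hb Hs. pose proof (opening_bound beta Hb) as Ho.
  set (g := fun u => sigma / (2 * sqrt u) * (phisize alpha (l + sigma * sqrt u) / opening beta)).
  assert (HM : 0 <= INR M) by apply pos_INR.
  destruct (continuity_ab_maj g (1 / 2) (INR M + 1 / 2)) as [um [H1 H2]].
  - lra.
  - intros u Hu. assert (0 < sqrt u) by (apply sqrt_lt_R0; lra).
    apply continuity_pt_filterlim.
    apply (continuous_mult (K := R_AbsRing) (fun u => sigma / (2 * sqrt u))
      (fun u => phisize alpha (l + sigma * sqrt u) / opening beta)).
    + cont_der.
      auto_derive. repeat split; lra.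
    + assert (Cl : continuous (fun u => l + sigma * sqrt u) u).
      { cont_der. auto_derive. lra. }
      apply (continuous_comp (fun u => l + sigma * sqrt u) (fun x => phisize alpha x / opening beta)); [exact Cl|].
      unfold phisize, Rdiv.
      apply (continuous_mult (K := R_AbsRing) (fun x => exp (alpha * x) * (Rabs (jumplog alpha) * Rabs x + 3))
         (fun _ => / opening beta)); [|apply continuous_const].
      apply (continuous_mult (K := R_AbsRing) (fun x => exp (alpha * x))
        (fun x => (Rabs (jumplog alpha) * Rabs x + 3))); [cont_real|].
      apply (continuous_plus (fun x => Rabs (jumplog alpha) * Rabs x) (fun _ => 3)); [|apply continuous_const].
      apply (continuous_mult (K := R_AbsRing) (fun _ => Rabs (jumplog alpha)) Rabs); [apply continuous_const|].
      apply continuous_Rabs.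
  - exists (g um). intros x0 th u Hth Hu. eapply Rle_trans; [|apply (H1 u Hu)].
    assert (0 < sqrt u) by (apply sqrt_lt_R0; lra).
    unfold node_term, g. rewrite Cmod_mult, Cmod_R, Rabs_right.
    + apply Rmult_le_compat_l.
      * apply Rlt_le, Rdiv_lt_0_compat; lra.
      * apply gline_bound; assumption.
    + apply Rle_ge, Rlt_le, Rdiv_lt_0_compat; lra.
Qed.

(** The slit integral is split at the first half step: the part near 0 is an error term, and on the rest
    the Poisson kernel is 1 + q + conj q. The terms in q and conj q are shifted upwards and downwards;
    the downward shift is the conjugate of the upward one for the conjugate of z. *)
Lemma quadrature (alpha beta sigma : R) : 0 < alpha -> 0 <= beta < 2 -> 0 < sigma ->
  exists K, 0 < K /\ forall (l Vr Bd : R) (M : nat),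
    vstart sigma < Vr -> Vr ^ 2 = sigma ^ 2 * (INR M + 1 / 2) -> ln 2 <= l + Vr -> 0 < Bd ->
    phisize alpha (l + vstart sigma) <= Bd ->
    (forall x, vstart sigma <= x <= Vr ->
       phisize alpha (l + x) * exp (- (decay sigma * x * gap beta)) <= Bd) ->
    exists rho, 0 <= rho < 1 /\ forall x0 th, x0 <= 0 -> Rabs th <= beta * PI / 2 ->
    Cmod (psi alpha (x0, th) -
      (circle_part alpha (x0, th) (l + Vr) - sum_n_m (fun j => node_term alpha sigma l (x0, th) (INR j)) 1 M
       - Ci * column alpha beta sigma l rho Vr (x0, th)
       - Cconj (Ci * column alpha beta sigma l rho Vr (x0, (- th)%R))))
      <= K * Bd.
Proof.
  intros Ha Hb Hs.
  destruct (shift_estimate alpha beta sigma Hb Hs) as [K1 [HK1 SE]].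
  destruct (near_cut_bound alpha beta Ha Hb) as [K2 [HK2 NC]].
  exists (2 * K1 + K2 + 2); split; [lra|].
  intros l Vr Bd M HVr HM Hln HBd HT1 HT3.
  pose proof (vstart_pos sigma Hs) as Hv0.
  assert (Hs2 : 0 < sigma ^ 2) by (apply pow_lt; assumption).
  set (I := {w : R * R | fst w <= 0 /\ Rabs (snd w) <= beta * PI / 2}).
  set (Fam := fun (i : I) u => node_term alpha sigma l (proj1_sig i) u).
  destruct (node_term_bounded alpha beta sigma l M Hb Hs) as [B HB].
  destruct (abel_sum Fam M B) with (eps := Bd) as [rho0 [Hr0 HA]]; [| | |assumption|].
  { intros [[x0 th] [W1 W2]] u Hu; unfold Fam; simpl in *.
    apply (node_term_ccont alpha beta); try assumption; lra. }
  { intros [[x0 th] [W1 W2]] u Hu; unfold Fam; simpl in *. apply HB; assumption. }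
  { intros j Hj eps He.
    assert (Hj0 : 0 < INR j) by (apply lt_0_INR; lia).
    destruct (node_term_equicont alpha beta sigma l (INR j) Hb Hj0 eps He) as [del [D1 D2]].
    exists del; split; [assumption|].
    intros [[x0 th] [W1 W2]] u Hu; unfold Fam; simpl in *. apply D2; assumption. }
  set (rho := (1 + Rmax rho0 0) / 2).
  assert (Hrho : 0 <= rho < 1 /\ rho0 < rho < 1).
  { unfold rho; pose proof (Rmax_l rho0 0); pose proof (Rmax_r rho0 0).
    assert (Rmax rho0 0 < 1) by (apply Rmax_lub_lt; lra). lra. }
  destruct Hrho as [Hrho Hrho'].
  exists rho; split; [assumption|].
  intros x0 th Hx0 Hth.
  assert (Hth' : Rabs (- th) <= beta * PI / 2) by (rewrite Rabs_Ropp; assumption).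
  (* The inner radius may depend on z: it only has to make the inner circle negligible. *)
  destruct (small_circle alpha x0 th Bd Ha HBd) as [L0 HL0].
  set (L := Rmin L0 (Rmin (x0 - 1) (l + vstart sigma))).
  assert (HL : L <= L0 /\ L <= x0 - 1 /\ L <= l + vstart sigma).
  { unfold L; pose proof (Rmin_l L0 (Rmin (x0 - 1) (l + vstart sigma))).
    pose proof (Rmin_r L0 (Rmin (x0 - 1) (l + vstart sigma))).
    pose proof (Rmin_l (x0 - 1) (l + vstart sigma)); pose proof (Rmin_r (x0 - 1) (l + vstart sigma)). lra. }
  destruct HL as [HL1 [HL2 HL3]].
  assert (Hl2 : 0 < ln 2) by (rewrite <- ln_1; apply ln_increasing; lra).
  specialize (HL0 L HL1).
  rewrite (keyhole alpha beta x0 th L (l + Vr)) by (try assumption; lra).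
  specialize (NC x0 th L (l + vstart sigma) Hth HL3).
  assert (Hgc : forall t x, Rabs t <= beta * PI / 2 -> ccont (gline alpha (x0, t)) x).
  { intros; apply (gline_ccont beta); assumption. }
  rewrite <- (CInt_Chasles _ L (l + vstart sigma) (l + Vr)) by (try lra; intros x _; apply Hgc; assumption).
  pose proof (SE l Vr rho x0 th Bd M HVr HM Hln Hrho Hx0 Hth HT1 HT3) as S1.
  pose proof (SE l Vr rho x0 (- th) Bd M HVr HM Hln Hrho Hx0 Hth' HT1 HT3) as S2.
  fold (column alpha beta sigma l rho Vr (x0, th)) in S1.
  fold (column alpha beta sigma l rho Vr (x0, (- th)%R)) in S2.
  pose proof (HA rho Hrho' (proj1 Hrho) (exist _ (x0, th) (conj Hx0 Hth))) as HAb.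
  unfold Fam in HAb; simpl proj1_sig in HAb.
  (* The substitution u = (v / sigma)^2 turns the Abel means into integrals over the slit. *)
  assert (Ev0 : vstart sigma ^ 2 / sigma ^ 2 = 1 / 2) by (rewrite vstart_sq; simpl INR; field; lra).
  assert (EVr : Vr ^ 2 / sigma ^ 2 = INR M + 1 / 2) by (rewrite HM; field; lra).
  set (q := fun v => abelq sigma rho (v, 0)).
  set (gl := fun v => gline alpha (x0, th) (l + v)).
  assert (Hgl : forall v, ccont gl v).
  { intros v; unfold gl. apply (ccont_comp_R (fun v => l + v) (gline alpha (x0, th))).
    - cont_real. - apply Hgc; assumption. }
  assert (Hq : forall v, ccont q v) by (intros v; apply abelq_real_ccont; assumption).
  assert (Esub : CInt (fun u => node_term alpha sigma l (x0, th) u * poissonk rho u)%C (1 / 2) (INR M + 1 / 2)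
     = CInt (fun v => gl v * (1 + q v + Cconj (q v)))%C (vstart sigma) Vr).
  { rewrite <- EVr, <- Ev0.
    rewrite <- (CInt_subst _ (fun v => v ^ 2 / sigma ^ 2) (fun v => 2 * v / sigma ^ 2)).
    - apply CInt_ext; intros v Hv; rewrite Rmin_left, Rmax_right in Hv by lra.
      unfold q; rewrite <- poissonk_split by assumption.
      unfold node_term, gl.
      assert (Esq : sqrt (v ^ 2 / sigma ^ 2) = v / sigma).
      { replace (v ^ 2 / sigma ^ 2) with ((v / sigma) * (v / sigma)) by (field; lra).
        apply sqrt_square. apply Rlt_le, Rdiv_lt_0_compat; lra. }
      rewrite Esq. replace (l + sigma * (v / sigma)) with (l + v) by (field; lra).
      rewrite !Cmult_assoc. f_equal. rewrite <- RtoC_mult.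
      replace (2 * v / sigma ^ 2 * (sigma / (2 * (v / sigma)))) with 1 by (field; lra). ring.
    - intros v Hv; rewrite Rmin_left, Rmax_right in Hv by lra. apply ccont_mult.
      + apply (node_term_ccont alpha beta); try assumption.
        apply Rdiv_lt_0_compat; [apply pow_lt; lra|assumption].
      + apply ccont_poissonk; assumption.
    - intros v _; split; [auto_derive; [trivial|simpl; field; lra]|]. cont_real. }
  assert (Esplit : CInt (fun v => gl v * (1 + q v + Cconj (q v)))%C (vstart sigma) Vr =
    (CInt gl (vstart sigma) Vr + CInt (fun v => gl v * q v) (vstart sigma) Vr
     + Cconj (CInt (fun v => gline alpha (x0, (- th)%R) (l + v) * q v) (vstart sigma) Vr))%C).
  { assert (Hgl' : forall v, ccont (fun v => gline alpha (x0, (- th)%R) (l + v)) v).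
    { intros v; apply (ccont_comp_R (fun v => l + v) (gline alpha (x0, (- th)%R)));
        [cont_real|apply Hgc; assumption]. }
    rewrite <- CInt_conj.
    - rewrite <- !CInt_plus.
      + apply CInt_ext; intros v _; unfold gl; rewrite gline_conj, Cconj_mult;
        replace (Cconj (Cconj (gline alpha (x0, th) (l + v)))) with (gline alpha (x0, th) (l + v))
          by (unfold Cconj; ceq); ring.
      + intros v _; exact (ccont_plus _ _ _ (Hgl v) (ccont_mult _ _ _ (Hgl v) (Hq v))).
      + intros v _; exact (ccont_conj _ _ (ccont_mult _ _ _ (Hgl' v) (Hq v))).
      + intros v _; exact (Hgl v).
      + intros v _; exact (ccont_mult _ _ _ (Hgl v) (Hq v)).
    - intros v _; apply ccont_mult; [apply Hgl'|apply Hq]. }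
  assert (Eshift : CInt (gline alpha (x0, th)) (l + vstart sigma) (l + Vr) = CInt gl (vstart sigma) Vr).
  { rewrite <- (CInt_subst (gline alpha (x0, th)) (fun v => l + v) (fun _ => 1)).
    - apply CInt_ext; intros; unfold gl; ring.
    - intros; apply Hgc; assumption.
    - intros v _; split; [auto_derive; [trivial|ring]|apply continuous_const]. }
  assert (Eint : forall t, CInt (fun x => integrand alpha sigma l rho (x0, t) (x, 0)) (vstart sigma) Vr =
     CInt (fun v => gline alpha (x0, t) (l + v) * q v)%C (vstart sigma) Vr).
  { intros t; apply CInt_ext; intros v _; unfold integrand, q; rewrite gker_gline; reflexivity. }
  rewrite Eint in S1, S2. fold gl in S1.
  rewrite Esub, Esplit in HAb. rewrite Eshift.
  set (Sm := sum_n_m (fun j => node_term alpha sigma l (x0, th) (INR j)) 1 M) in *.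
  set (G := CInt gl (vstart sigma) Vr) in *.
  set (Gq := CInt (fun v => gl v * q v)%C (vstart sigma) Vr) in *.
  set (Gq' := CInt (fun v => gline alpha (x0, (- th)%R) (l + v) * q v)%C (vstart sigma) Vr) in *.
  change (CInt (fun v => gline alpha (x0, th) (l + v) * q v)%C (vstart sigma) Vr) with Gq in S1.
  set (D1 := column alpha beta sigma l rho Vr (x0, th)) in *.
  set (D2 := column alpha beta sigma l rho Vr (x0, (- th)%R)) in *.
  set (N0 := CInt (gline alpha (x0, th)) L (l + vstart sigma)) in *.
  match goal with |- Cmod ?e <= _ => replace e with
    (- circle_part alpha (x0, th) L - N0 - (G + Gq + Cconj Gq' - Sm) + (Gq + Ci * D1)
     + Cconj (Gq' + Ci * D2))%C end.
  - assert (NB : Cmod N0 <= K2 * Bd).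
    { eapply Rle_trans; [exact NC|]. apply Rmult_le_compat_l; lra. }
    assert (T1 : Cmod (- circle_part alpha (x0, th) L - N0 - (G + Gq + Cconj Gq' - Sm) + (Gq + Ci * D1)) <=
       Bd + K2 * Bd + Bd + K1 * Bd).
    { eapply Rle_trans; [apply Cmod_triangle|]. apply Rplus_le_compat; [|exact S1].
      eapply Rle_trans; [apply Cmod_triangle|]; rewrite Cmod_opp. apply Rplus_le_compat; [|exact HAb].
      eapply Rle_trans; [apply Cmod_triangle|]; rewrite !Cmod_opp. apply Rplus_le_compat; assumption. }
    eapply Rle_trans; [apply Cmod_triangle|]; rewrite Cmod_conj. lra.
  - rewrite Cconj_plus. ring.
Qed.

(** * Rational approximants *)

Lemma Carg_Cexp x t : - PI < t < PI -> Carg (Cexp (x, t)) = t.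
Proof.
  intros Ht; unfold Carg. rewrite Cmod_Cexp. pose proof (exp_pos x) as Hx.
  unfold Cexp; simpl.
  replace (exp x * cos t / exp x) with (cos t) by (field; lra).
  destruct (Rle_dec 0 (exp x * sin t)) as [H|H].
  - apply acos_cos. split; [|lra].
    apply Rnot_lt_le; intros N.
    assert (0 < sin (- t)) by (apply sin_gt_0; lra). rewrite sin_neg in *.
    assert (0 < exp x * - sin t) by (apply Rmult_lt_0_compat; lra). lra.
  - assert (t < 0).
    { apply Rnot_le_lt; intros N; apply H. apply Rmult_le_pos; [lra|]. apply sin_ge_0; lra. }
    replace (cos t) with (cos (- t)) by apply cos_neg.
    rewrite acos_cos by lra. ring.
Qed.

Lemma zalogz_Cexp alpha x t : - PI < t < PI -> zalogz alpha (Cexp (x, t)) = psi alpha (x, t).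
Proof.
  intros Ht; unfold zalogz, psi, Cpowr, Clog.
  destruct (Ceq_dec (Cexp (x, t)) 0) as [E|_]; [destruct (Cexp_neq_0 _ E)|].
  rewrite Carg_Cexp by assumption. rewrite Cmod_Cexp; simpl. rewrite ln_exp. reflexivity.
Qed.

Lemma S_sector beta z : S_ beta z -> sector beta z.
Proof.
  intros [x [th [Hx [Hth Hz]]]]. pose proof PI_RGT_0 as HP.
  destruct Hz as [->| ->].
  - exists x, (th * PI / 2); split; [assumption|split].
    + rewrite Rabs_right by nra. nra.
    + do 2 f_equal. ceq.
  - exists x, (- (th * PI / 2)); split; [assumption|split].
    + rewrite Rabs_Ropp, Rabs_right by nra. nra.
    + do 2 f_equal. ceq.
Qed.

Lemma sector_log beta z : sector beta z -> z <> 0 ->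
  exists x0 th, x0 <= 0 /\ Rabs th <= beta * PI / 2 /\ z = Cexp (x0, th).
Proof.
  intros [x [t [Hx [Ht ->]]]] Hz.
  assert (Hx0 : 0 < x).
  { destruct (Rlt_le_dec 0 x); [assumption|]. exfalso; apply Hz.
    replace x with 0 by lra. ring. }
  exists (ln x), t; split; [|split; [assumption|]].
  - rewrite <- ln_1. apply ln_le; lra.
  - rewrite <- (exp_ln x) at 1 by assumption.
    unfold Cexp; simpl; rewrite exp_0. apply injective_projections; simpl; ring.
Qed.

Lemma circle_part_poly alpha R1 n : ln 2 <= R1 ->
  exists Q, isPoly n Q /\ forall x0 th, x0 <= 0 ->
    Cmod (circle_part alpha (x0, th) R1 - Q (Cexp (x0, th))) <=
    2 * (exp (alpha * R1) * (R1 + PI)) * (1 / 2) ^ n.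
Proof.
  intros HR. pose proof PI_RGT_0 as HP.
  assert (Hl2 : 0 < ln 2) by (rewrite <- ln_1; apply ln_increasing; lra).
  destruct (psi_hol alpha) as [psi' Hpsi].
  set (om := fun t => Cexp (- (R1, t))).
  destruct (taylor_approx (fun t => psi alpha (R1, t)) om (- PI) PI (exp (alpha * R1) * (R1 + PI)) n)
    as [Q [HQ1 HQ2]].
  - lra.
  - intros t _. apply ccont_slice_v, (hol_ccont _ _ _ (Hpsi _)).
  - intros t _; unfold om; ccs.
  - intros t Ht. eapply Rle_trans; [apply Cmod_psi; apply Rabs_le; lra|].
    rewrite Rabs_right; lra.
  - intros t _; unfold om; rewrite Cmod_Cexp. simpl.
    rewrite exp_Ropp. replace (1 / 2) with (/ 2) by field. apply Rinv_le_contravar; [lra|].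
    rewrite <- (exp_ln 2) by lra. apply exp_mono; exact HR.
  - exists (fun z => / (2 * PI)%R * Q z)%C; split; [apply isPoly_scal; assumption|].
    intros x0 th Hx0. set (z := Cexp (x0, th)).
    assert (Hz : Cmod z <= 1).
    { unfold z; rewrite Cmod_Cexp, <- exp_0; apply exp_mono; exact Hx0. }
    specialize (HQ2 z Hz).
    unfold circle_part.
    replace (CInt (fun t => psi alpha (R1, t) * ckern (x0, th) (R1, t))%C (- PI) PI)
      with (CInt (fun t => psi alpha (R1, t) / (1 - z * om t))%C (- PI) PI).
    + match goal with |- Cmod (?c * ?a - ?c * ?b) <= _ =>
        replace (c * a - c * b)%C with (c * (a - b))%C by ring end.
      rewrite Cmod_mult, Cmod_inv, Cmod_R, Rabs_right;
        [|lra|apply Cmod_pos_neq; rewrite Cmod_R, Rabs_right; lra].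
      apply Rle_trans with (/ (2 * PI) *
        (2 * ((PI - - PI) * (exp (alpha * R1) * (R1 + PI) * (1 / 2) ^ n)))).
      * apply Rmult_le_compat_l; [left; apply Rinv_0_lt_compat; lra|exact HQ2].
      * apply Req_le; field; lra.
    + apply CInt_ext; intros t _; unfold ckern, z, om, Cdiv.
      rewrite <- Cexp_plus. reflexivity.
Qed.

Lemma column_poly alpha beta sigma l rho Vr (M n : nat) : 0 <= beta < 2 -> 0 < sigma -> 0 <= rho < 1 ->
  0 < Vr -> Vr ^ 2 = sigma ^ 2 * (INR M + 1 / 2) -> ln 2 <= l + Vr ->
  exists Q, isPoly n Q /\ forall x0 th, x0 <= 0 ->
    Cmod (column alpha beta sigma l rho Vr (x0, th) - Q (Cexp (x0, th))) <=
    4 * PI * phisize alpha (l + Vr) * (1 / 2) ^ n.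
Proof.
  intros Hb Hs Hr HVr HM Hln. pose proof PI_RGT_0 as HP. pose proof (gap_bounds beta Hb) as Hh.
  pose proof (decay_pos sigma Hs) as Hk.
  set (om := fun t => (- Cexp (- (RtoC l + (Vr, t))))%C).
  set (m := fun t => (phi alpha (RtoC l + (Vr, t)) * abelq sigma rho (Vr, t))%C).
  destruct (taylor_approx m om 0 (gap beta) (phisize alpha (l + Vr) * 2) n)
    as [Q [HQ1 HQ2]].
  - lra.
  - intros t Ht; rewrite Rmin_left, Rmax_right in Ht by lra.
    unfold m, phi, abelq, Ev; apply ccont_mult; [ccs|]. apply ccont_mult; [ccs|].
    apply ccont_inv; [ccs|]. apply Cmod_pos_neq.
    pose proof (one_minus_Ev_vertical sigma rho Vr t M Hs ltac:(lra) HVr HM ltac:(lra)) as L.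
    unfold Ev in L; lra.
  - intros t _; unfold om; ccs.
  - intros t Ht. unfold m; rewrite Cmod_mult. apply Rmult_le_compat; try apply Cmod_ge_0.
    + replace (RtoC l + (Vr, t))%C with ((l + Vr, t) : C) by (apply injective_projections; simpl; ring).
      apply Cmod_phi. rewrite Rabs_right; lra.
    + eapply Rle_trans; [apply (abelq_bound_vertical sigma rho Vr t M); try lra|].
      assert (exp (- (decay sigma * Vr * t)) <= 1); [|lra].
      rewrite <- exp_0; apply exp_mono.
      assert (0 <= decay sigma * Vr * t) by (apply Rmult_le_pos; [apply Rmult_le_pos|]; lra). lra.
  - intros t _; unfold om; rewrite Cmod_opp, Cmod_Cexp. simpl.
    rewrite exp_Ropp. replace (1 / 2) with (/ 2) by field. apply Rinv_le_contravar; [lra|].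
    rewrite <- (exp_ln 2) by lra. apply exp_mono; exact Hln.
  - exists Q; split; [assumption|]. intros x0 th Hx0. set (z := Cexp (x0, th)).
    assert (Hz : Cmod z <= 1).
    { unfold z; rewrite Cmod_Cexp, <- exp_0; apply exp_mono; exact Hx0. }
    specialize (HQ2 z Hz).
    unfold column.
    replace (CInt (fun t => integrand alpha sigma l rho (x0, th) (Vr, t)) 0 (gap beta))
      with (CInt (fun t => m t / (1 - z * om t))%C 0 (gap beta)).
    + eapply Rle_trans; [exact HQ2|].
      assert (0 <= phisize alpha (l + Vr) * (1 / 2) ^ n).
      { apply Rmult_le_pos; [apply phisize_pos|apply pow_le; lra]. }
      assert ((gap beta - 0) * (phisize alpha (l + Vr) * (1 / 2) ^ n) <= PI * (phisize alpha (l + Vr) * (1 / 2) ^ n))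
        by (apply Rmult_le_compat_r; lra).
      lra.
    + apply CInt_ext; intros t _; unfold integrand, gker, m, z, om, Cdiv.
      replace (1 - Cexp (x0, th) * - Cexp (- (RtoC l + (Vr, t))))%C
        with (1 + Cexp ((x0, th) - (RtoC l + (Vr, t))))%C; [ring|].
      unfold Cminus at 1; rewrite Cexp_plus. ring.
Qed.

(** The term of index j is this number over s_j + z, where -s_j is the j-th pole. *)
Definition node_coef (alpha sigma l : R) (j : nat) : C :=
  (RtoC (sigma / (2 * sqrt (INR j))) * phi alpha (RtoC (l + sigma * sqrt (INR j)))
   * RtoC (exp (l + sigma * sqrt (INR j))))%C.

Lemma node_term_pole beta alpha sigma l x0 th j : 0 <= beta < 2 -> Rabs th <= beta * PI / 2 ->
  node_term alpha sigma l (x0, th) (INR j) =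
  (node_coef alpha sigma l j * / (RtoC (exp (l + sigma * sqrt (INR j))) + Cexp (x0, th)))%C.
Proof.
  intros Hb Hth; unfold node_term, gline, node_coef.
  set (x := l + sigma * sqrt (INR j)).
  pose proof (line_lower beta x0 th x Hb Hth) as L. pose proof (opening_bound beta Hb) as Ho.
  assert (Hn : (1 + Cexp ((x0, th) - RtoC x) <> 0)%C) by (apply Cmod_pos_neq; lra).
  assert (He : RtoC (exp x) <> 0) by (rewrite <- Cexp_RtoC; apply Cexp_neq_0).
  assert (E : (RtoC (exp x) + Cexp (x0, th) = RtoC (exp x) * (1 + Cexp ((x0, th) - RtoC x)))%C).
  { rewrite Cexp_minus, Cexp_RtoC. field. exact He. }
  rewrite E. field. split; assumption.
Qed.

Lemma node_coef_bound alpha sigma l j : 0 < sigma -> (1 <= j)%nat ->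
  Cmod (node_coef alpha sigma l j) <=
  sigma * phisize alpha (l + sigma * sqrt (INR j)) * exp (l + sigma * sqrt (INR j)).
Proof.
  intros Hs Hj. unfold node_coef.
  assert (H1 : 1 <= sqrt (INR j)).
  { rewrite <- sqrt_1 at 1. apply sqrt_le_1_alt. apply (le_INR 1); assumption. }
  rewrite !Cmod_mult, !Cmod_R, (Rabs_right (exp _)) by (left; apply exp_pos).
  apply Rmult_le_compat_r; [left; apply exp_pos|].
  apply Rmult_le_compat; [apply Rabs_pos|apply Cmod_ge_0| |].
  - rewrite Rabs_right by (apply Rle_ge, Rlt_le, Rdiv_lt_0_compat; lra).
    apply Rle_div_l; nra.
  - apply (Cmod_phi alpha _ 0). rewrite Rabs_R0; pose proof PI_RGT_0; lra.
Qed.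

Lemma sum_n_m_isPoly n (f : nat -> C -> C) a k : (forall j, isPoly n (f j)) ->
  isPoly n (fun z => sum_n_m (fun j => f j z) a (a + k)).
Proof.
  intros H; induction k as [|k IH].
  - rewrite Nat.add_0_r. apply (isPoly_ext _ (f a)); [|apply H].
    intros z; rewrite sum_n_n; reflexivity.
  - apply (isPoly_ext _ (fun z => sum_n_m (fun j => f j z) a (a + k) + f (a + S k)%nat z)%C).
    + intros z. replace (a + S k)%nat with (S (a + k)) by lia.
      rewrite sum_n_Sm by lia. reflexivity.
    + apply isPoly_plus; [assumption|apply H].
Qed.

Lemma sum_n_m_Cmod (f g : nat -> C) e a k :
  (forall j, (a <= j <= a + k)%nat -> Cmod (f j - g j) <= e) ->
  Cmod (sum_n_m f a (a + k) - sum_n_m g a (a + k)) <= INR (S k) * e.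
Proof.
  induction k as [|k IH]; intros H.
  - rewrite Nat.add_0_r, !sum_n_n. simpl INR; rewrite Rmult_1_l. apply H; lia.
  - replace (a + S k)%nat with (S (a + k)) by lia.
    rewrite !sum_n_Sm by lia. change (plus : C -> C -> C) with Cplus.
    assert (IH' := IH ltac:(intros; apply H; lia)).
    assert (H' := H (S (a + k)) ltac:(lia)).
    replace (sum_n_m f a (a + k) + f (S (a + k)) - (sum_n_m g a (a + k) + g (S (a + k))))%C
      with ((sum_n_m f a (a + k) - sum_n_m g a (a + k)) + (f (S (a + k)) - g (S (a + k))))%C by ring.
    rewrite (S_INR (S k)).
    eapply Rle_trans; [apply Cmod_triangle|]. lra.
Qed.

Lemma phisize_le alpha x Rb : 0 < alpha -> Rabs x <= Rb -> phisize alpha x <= exp (alpha * Rb) * (Rb + 3).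
Proof.
  intros Ha Hx; unfold phisize.
  pose proof (jumplog_le_1 alpha); pose proof (Rabs_pos (jumplog alpha)); pose proof (Rabs_pos x).
  pose proof (Rle_abs x).
  apply Rmult_le_compat.
  - left; apply exp_pos.
  - nra.
  - apply exp_mono; apply Rmult_le_compat_l; lra.
  - nra.
Qed.

Lemma sum_n_m_opp (f : nat -> C) a b :
  @eq C (sum_n_m (fun j => - f j)%C a b) (- sum_n_m f a b)%C.
Proof.
  assert (E : @eq C (sum_n_m (fun j => - (1) * f j)%C a b) (- (1) * sum_n_m f a b)%C)
    by exact (sum_n_m_mult_l (K := C_Ring) (- (1))%C f a b).
  transitivity (- (1) * sum_n_m f a b)%C; [|ring].
  rewrite <- E; apply sum_n_m_ext; intros j.
  change (@eq C (- f j)%C (- (1) * f j)%C); ring.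
Qed.

(** The nodes j <= N1 are kept as poles. The other nodes, the circle integral and the two columns
    are replaced by polynomials. *)
Lemma approximants (alpha beta sigma C0 Rb : R) :
  0 < alpha -> 0 <= beta < 2 -> 0 < sigma -> 0 < C0 ->
  exists (K : R) (D : nat) (rho1 : R), 0 < K /\ (1 <= D)%nat /\ 0 < rho1 < 1 /\
  forall (N1 n M : nat) (Vr Bd : R), let l := ln C0 - sigma * sqrt (INR N1) in
    vstart sigma < Vr -> Vr ^ 2 = sigma ^ 2 * (INR M + 1 / 2) -> ln 2 <= l + Vr <= Rb ->
    (N1 < M)%nat -> 0 < Bd ->
    phisize alpha (l + vstart sigma) <= Bd ->
    (forall x, vstart sigma <= x <= Vr ->
       phisize alpha (l + x) * exp (- (decay sigma * x * gap beta)) <= Bd) ->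
    INR M * rho1 ^ n <= Bd ->
    exists (a : nat -> C) (P : C -> C), isPoly (D * n) P /\
      forall z, sector beta z -> z <> 0 ->
        Cmod (rational_approx N1 (pole C0 sigma N1) a P z - zalogz alpha z) <= K * Bd.
Proof.
  intros Ha Hb Hs HC0.
  pose proof PI_RGT_0 as HP. pose proof (vstart_pos sigma Hs) as Hv0.
  destruct (quadrature alpha beta sigma Ha Hb Hs) as [KQ [HKQ HQ]].
  destruct (runge_pole beta C0 Hb HC0) as [D [rR [HrR HRg]]].
  pose proof (opening_bound beta Hb) as Ho.
  set (Rc := Rmax (Rabs (ln C0)) (Rabs Rb)).
  assert (HRc : 0 <= Rc /\ Rabs (ln C0) <= Rc /\ Rabs Rb <= Rc).
  { unfold Rc; pose proof (Rmax_l (Rabs (ln C0)) (Rabs Rb)); pose proof (Rmax_r (Rabs (ln C0)) (Rabs Rb)).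
    pose proof (Rabs_pos Rb); lra. }
  set (PB := exp (alpha * Rc) * (Rc + 3)).
  assert (HPB : 0 < PB) by (unfold PB; apply Rmult_lt_0_compat; [apply exp_pos|lra]).
  set (K1 := 2 * (exp (alpha * Rc) * (Rc + PI))).
  assert (HK1 : 0 < K1).
  { unfold K1. apply Rmult_lt_0_compat; [lra|]. apply Rmult_lt_0_compat; [apply exp_pos|lra]. }
  set (K2 := 4 * PI * PB). assert (HK2 : 0 < K2) by (unfold K2; apply Rmult_lt_0_compat; lra).
  set (K3 := sigma * PB * exp Rc / (opening beta * C0)).
  assert (HK3 : 0 < K3).
  { unfold K3; apply Rdiv_lt_0_compat; [|apply Rmult_lt_0_compat; lra].
    apply Rmult_lt_0_compat; [apply Rmult_lt_0_compat; lra|apply exp_pos]. }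
  set (rho1 := Rmax rR (1 / 2)).
  assert (Hrho1 : 0 < rho1 < 1 /\ rR <= rho1 /\ 1 / 2 <= rho1).
  { unfold rho1; pose proof (Rmax_l rR (1 / 2)); pose proof (Rmax_r rR (1 / 2)).
    assert (Rmax rR (1 / 2) < 1) by (apply Rmax_lub_lt; lra). lra. }
  exists (KQ + K1 + 2 * K2 + K3), (S D), rho1.
  split; [lra|split; [lia|split; [lra|]]].
  intros N1 n M Vr Bd l HVr HM Hln HNM HBd HT1 HT3 HMn.
  destruct (HQ l Vr Bd M HVr HM (proj1 Hln) HBd HT1 HT3) as [rho [Hrho HQz]].
  assert (HM1 : 1 <= INR M) by (apply (le_INR 1); lia).
  assert (Hpow : forall r, 0 <= r <= rho1 -> r ^ n <= Bd).
  { intros r Hr'. apply Rle_trans with (rho1 ^ n).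
    - apply pow_incr; lra.
    - assert (0 <= rho1 ^ n) by (apply pow_le; lra). nra. }
  pose proof (Hpow (1 / 2) ltac:(lra)) as Hhalf.
  assert (Hl2 : 0 < ln 2) by (rewrite <- ln_1; apply ln_increasing; lra).
  assert (HRb : l + Vr <= Rc) by (pose proof (Rle_abs Rb); lra).
  destruct (circle_part_poly alpha (l + Vr) n (proj1 Hln)) as [QA [QA1 QA2]].
  destruct (column_poly alpha beta sigma l rho Vr M n Hb Hs Hrho ltac:(lra) HM (proj1 Hln)) as [QD [QD1 QD2]].
  set (xj := fun j : nat => l + sigma * sqrt (INR j)).
  assert (Hxj : forall j, (N1 <= j <= M)%nat -> ln C0 <= xj j <= Rc).
  { intros j Hj; unfold xj, l; split.
    - assert (sqrt (INR N1) <= sqrt (INR j)) by (apply sqrt_le_1_alt, le_INR; lia). nra.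
    - apply Rle_trans with (l + Vr); [|assumption]. unfold l.
      apply Rplus_le_compat_l. apply Rsqr_incr_0_var; [|lra]. unfold Rsqr.
      replace (Vr * Vr) with (sigma ^ 2 * (INR M + 1 / 2)) by (rewrite <- HM; ring).
      replace (sigma * sqrt (INR j) * (sigma * sqrt (INR j))) with
        (sigma ^ 2 * (sqrt (INR j) * sqrt (INR j))) by ring.
      rewrite sqrt_sqrt by apply pos_INR.
      apply Rmult_le_compat_l; [apply pow2_ge_0|].
      assert (INR j <= INR M) by (apply le_INR; lia). lra. }
  (* The nodes beyond N1 lie to the left of -C0, where a pole can be traded for a polynomial. *)
  assert (Hch : forall j : nat, exists Q, isPoly (D * n) Q /\ ((N1 <= j <= M)%nat ->
     forall z, sector beta z -> Cmod (Q z - / (RtoC (exp (xj j)) + z)) <= rR ^ n / (opening beta * C0))).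
  { intros j. destruct (Compare_dec.le_dec N1 j) as [H1|H1]; [destruct (Compare_dec.le_dec j M) as [H2|H2]|].
    - destruct (HRg n (exp (xj j))) as [Q [Q1 Q2]].
      + rewrite <- (exp_ln C0) by assumption. apply exp_mono. apply Hxj; lia.
      + exists Q; split; [assumption|intros _; exact Q2].
    - exists (fun _ => RtoC 0); split; [apply isPoly_const|lia].
    - exists (fun _ => RtoC 0); split; [apply isPoly_const|lia]. }
  destruct (functional_choice _ Hch) as [QR HQR].
  set (k := (M - S N1)%nat).
  set (tailP := fun z => sum_n_m (fun j => node_coef alpha sigma l j * QR j z)%C (S N1) (S N1 + k)).
  set (P := fun z => (QA z + (-(1)) * tailP z + (- Ci) * QD z + (-(1)) * Cconj (Ci * QD (Cconj z)))%C).
  exists (fun j => (- node_coef alpha sigma l j)%C), P; split.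
  { unfold P; repeat apply isPoly_plus.
    - apply (isPoly_le n); [lia|assumption].
    - apply isPoly_scal. apply (isPoly_le (D * n)); [lia|].
      unfold tailP; apply (sum_n_m_isPoly (D * n) (fun j z => node_coef alpha sigma l j * QR j z)%C).
      intros j; apply isPoly_scal, HQR.
    - apply isPoly_scal, (isPoly_le n); [lia|assumption].
    - apply isPoly_scal, (isPoly_le n); [lia|].
      apply (isPoly_conj n (fun z => Ci * QD z)%C), isPoly_scal; assumption. }
  intros z Hz Hz0.
  destruct (sector_log beta z Hz Hz0) as [x0 [th [Hx0 [Hth Ez]]]].
  specialize (HQz x0 th Hx0 Hth).
  assert (Hthpi : - PI < th < PI) by (apply Rabs_le_between in Hth; nra).
  rewrite Ez, zalogz_Cexp, <- Ez by assumption.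
  specialize (QA2 x0 th Hx0).
  pose proof (QD2 x0 th Hx0) as QDa. pose proof (QD2 x0 (- th) Hx0) as QDb.
  rewrite <- Ez in QA2, QDa.
  replace (Cexp (x0, (- th)%R)) with (Cconj z) in QDb by (rewrite Ez, Cconj_Cexp; reflexivity).
  set (Fj := fun j => (node_coef alpha sigma l j * / (RtoC (exp (xj j)) + z))%C).
  assert (EF : sum_n_m (fun j => node_term alpha sigma l (x0, th) (INR j)) 1 M =
     (sum_n_m Fj 1 N1 + sum_n_m Fj (S N1) (S N1 + k))%C).
  { rewrite (sum_n_m_ext _ Fj).
    - replace (S N1 + k)%nat with M by (unfold k; lia).
      rewrite (sum_n_m_Chasles Fj 1 N1 M) by lia. reflexivity.
    - intros j; rewrite (node_term_pole beta) by assumption. rewrite <- Ez. reflexivity. }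
  rewrite EF in HQz.
  assert (Etail : Cmod (sum_n_m Fj (S N1) (S N1 + k) - tailP z) <= K3 * Bd).
  { unfold tailP.
    eapply Rle_trans; [apply (sum_n_m_Cmod _ _ (sigma * PB * exp Rc * (rR ^ n / (opening beta * C0))))|].
    - intros j Hj. assert (Hj2 : (N1 <= j <= M)%nat) by (unfold k in Hj; lia).
      destruct (HQR j) as [_ Hq]. specialize (Hq Hj2 z Hz).
      unfold Fj.
      replace (node_coef alpha sigma l j * / (RtoC (exp (xj j)) + z) - node_coef alpha sigma l j * QR j z)%C
        with (node_coef alpha sigma l j * - (QR j z - / (RtoC (exp (xj j)) + z)))%C by ring.
      rewrite Cmod_mult, Cmod_opp. apply Rmult_le_compat; try apply Cmod_ge_0; [|exact Hq].
      eapply Rle_trans; [apply node_coef_bound; [assumption|lia]|]. fold (xj j).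
      destruct (Hxj j Hj2) as [X1 X2].
      assert (X3 : Rabs (xj j) <= Rc).
      { apply Rabs_le. destruct HRc as [_ [X4 _]]. apply Rabs_le_between in X4. lra. }
      apply Rmult_le_compat.
      + apply Rmult_le_pos; [lra|apply phisize_pos].
      + left; apply exp_pos.
      + apply Rmult_le_compat_l; [lra|]. apply phisize_le; assumption.
      + apply exp_mono; assumption.
    - replace (INR (S k) * (sigma * PB * exp Rc * (rR ^ n / (opening beta * C0))))
        with (K3 * (INR (S k) * rR ^ n)) by (unfold K3; field; split; lra).
      apply Rmult_le_compat_l; [lra|]. eapply Rle_trans; [|exact HMn].
      apply Rmult_le_compat.
      + apply pos_INR.
      + apply pow_le; lra.
      + apply le_INR; unfold k; lia.
      + apply pow_incr; lra. }
  assert (BA : Cmod (circle_part alpha (x0, th) (l + Vr) - QA z) <= K1 * Bd).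
  { eapply Rle_trans; [exact QA2|]. apply Rmult_le_compat; try assumption.
    - apply Rmult_le_pos; [lra|]. apply Rmult_le_pos; [left; apply exp_pos|lra].
    - apply pow_le; lra.
    - unfold K1. apply Rmult_le_compat_l; [lra|]. apply Rmult_le_compat.
      + left; apply exp_pos. + lra.
      + apply exp_mono, Rmult_le_compat_l; lra. + lra. }
  assert (HPs : phisize alpha (l + Vr) <= PB).
  { apply phisize_le; [assumption|]. rewrite Rabs_right; lra. }
  assert (B2c : 4 * PI * phisize alpha (l + Vr) * (1 / 2) ^ n <= K2 * Bd).
  { unfold K2; apply Rmult_le_compat; try assumption.
    - apply Rmult_le_pos; [lra|apply phisize_pos].
    - apply pow_le; lra.
    - apply Rmult_le_compat_l; lra. }
  set (D1 := column alpha beta sigma l rho Vr (x0, th)) in *.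
  set (D2 := column alpha beta sigma l rho Vr (x0, (- th)%R)) in *.
  set (CP := circle_part alpha (x0, th) (l + Vr)) in *.
  assert (ER : rational_approx N1 (pole C0 sigma N1) (fun j => (- node_coef alpha sigma l j)%C) P z =
     (- sum_n_m Fj 1 N1 + P z)%C).
  { unfold rational_approx. f_equal. rewrite <- sum_n_m_opp.
    apply sum_n_m_ext; intros j. unfold Fj, Cdiv.
    replace (z - RtoC (pole C0 sigma N1 j))%C with (RtoC (exp (xj j)) + z)%C; [match goal with |- ?u = ?v => change (@eq C u v) end; ring|].
    unfold pole.
    replace (exp (xj j)) with (C0 * exp (- sigma * (sqrt (INR N1) - sqrt (INR j)))).
    - apply injective_projections; simpl; ring.
    - unfold xj, l. replace (ln C0 - sigma * sqrt (INR N1) + sigma * sqrt (INR j))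
        with (ln C0 + - sigma * (sqrt (INR N1) - sqrt (INR j))) by ring.
      rewrite exp_plus, exp_ln by assumption. reflexivity. }
  rewrite ER. unfold P.
  set (S1 := sum_n_m Fj 1 N1) in *. set (S2 := sum_n_m Fj (S N1) (S N1 + k)) in *.
  replace (- S1 + (QA z + - (1) * tailP z + - Ci * QD z + - (1) * Cconj (Ci * QD (Cconj z))) - psi alpha (x0, th))%C
   with (- (psi alpha (x0, th) - (CP - (S1 + S2) - Ci * D1 - Cconj (Ci * D2)))
         - (CP - QA z) + (S2 - tailP z) + Ci * (D1 - QD z) + Cconj (Ci * (D2 - QD (Cconj z))))%C.
  - eapply Rle_trans; [apply Cmod_triangle|]; rewrite Cmod_conj, Cmod_mult, Cmod_Ci, Rmult_1_l.
    eapply Rle_trans; [apply Rplus_le_compat_r, Cmod_triangle|]; rewrite Cmod_mult, Cmod_Ci, Rmult_1_l.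
    eapply Rle_trans; [apply Rplus_le_compat_r, Rplus_le_compat_r, Cmod_triangle|].
    eapply Rle_trans; [apply Rplus_le_compat_r, Rplus_le_compat_r, Rplus_le_compat_r, Cmod_triangle|].
    rewrite !Cmod_opp. lra.
  - rewrite !Cconj_mult, Cconj_minus. ring.
Qed.

Lemma isPoly_ccont n P z : isPoly n P -> ccont P z.
Proof.
  revert P; induction n as [|n IH]; intros P.
  - intros [c H]. apply (ccont_ext (fun _ => c)); [intros; symmetry; apply H|apply ccont_const].
  - intros [c [Q [H1 H2]]]. apply (ccont_ext (fun z => c + z * Q z)%C); [intros; symmetry; apply H2|].
    apply ccont_plus; [apply ccont_const|apply ccont_mult; [apply ccont_id|apply IH; assumption]].
Qed.

Lemma rational_approx_ccont n N1 p a P : isPoly n P -> (forall j, p j <> 0) ->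
  ccont (rational_approx N1 p a P) (RtoC 0).
Proof.
  intros HP Hp; unfold rational_approx; apply ccont_plus; [|apply (isPoly_ccont n); assumption].
  induction N1 as [|N1 IH].
  - apply (ccont_ext (fun _ => RtoC 0)); [|apply ccont_const].
    intros z; rewrite sum_n_m_zero by lia; reflexivity.
  - apply (ccont_ext (fun z => sum_n_m (fun j => a j / (z - p j)) 1 N1 + a (S N1) / (z - p (S N1)))%C).
    + intros z; rewrite sum_n_Sm by lia; reflexivity.
    + apply ccont_plus; [exact IH|]. apply ccont_div; [apply ccont_const|ccs|].
      intros E. apply (Hp (S N1)). apply Csub_eq_0 in E.
      apply (f_equal fst) in E; simpl in E; lra.
Qed.

(** At the vertex, by continuity: z^alpha log z tends to 0 there, and 0 is not a pole. *)
Lemma extend_zero alpha beta C0 sigma N1 n a P e : 0 < alpha -> 0 <= beta -> 0 < C0 -> isPoly n P ->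
  (forall z, sector beta z -> z <> 0 ->
    Cmod (rational_approx N1 (pole C0 sigma N1) a P z - zalogz alpha z) <= e) ->
  forall z, sector beta z ->
    Cmod (rational_approx N1 (pole C0 sigma N1) a P z - zalogz alpha z) <= e.
Proof.
  intros Ha Hb HC0 HP H z Hz.
  destruct (Ceq_dec z 0) as [->|Hz0]; [|apply H; assumption].
  set (r := rational_approx N1 (pole C0 sigma N1) a P) in *.
  assert (Hr : ccont r (RtoC 0)).
  { apply (rational_approx_ccont n); [assumption|].
    intros j; unfold pole. apply Rlt_not_eq.
    pose proof (exp_pos (- sigma * (sqrt (INR N1) - sqrt (INR j)))). nra. }
  apply le_epsilon; intros eps He.
  destruct (locally_C_ball (RtoC 0) _ (ccont_Cmod r (RtoC 0) Hr (eps / 2) ltac:(lra))) as [d [Hd1 Hd2]].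
  destruct (exp_lin_small alpha (eps / 2) Ha ltac:(lra)) as [L0 HL0].
  set (L := Rmin L0 (Rmin 0 (ln (d / 2)))).
  assert (HL : L <= L0 /\ L <= 0 /\ L <= ln (d / 2)).
  { unfold L; pose proof (Rmin_l L0 (Rmin 0 (ln (d / 2)))); pose proof (Rmin_r L0 (Rmin 0 (ln (d / 2)))).
    pose proof (Rmin_l 0 (ln (d / 2))); pose proof (Rmin_r 0 (ln (d / 2))). lra. }
  destruct HL as [HL1 [HL2 HL3]].
  pose proof (exp_pos L) as HeL. pose proof PI_RGT_0 as HPI.
  assert (HeL1 : exp L <= 1) by (rewrite <- exp_0; apply exp_mono; assumption).
  assert (HeL2 : exp L < d).
  { apply Rle_lt_trans with (d / 2); [|lra]. rewrite <- (exp_ln (d / 2)) by lra.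
    apply exp_mono; assumption. }
  assert (Ew : Cexp (L, 0) = RtoC (exp L)) by apply (Cexp_RtoC L).
  assert (Hs : sector beta (RtoC (exp L))).
  { exists (exp L), 0; split; [lra|split].
    - rewrite Rabs_R0. nra.
    - change ((0, 0) : C) with (RtoC 0). rewrite Cexp_0; ring. }
  assert (Hn : RtoC (exp L) <> 0) by (rewrite <- Ew; apply Cexp_neq_0).
  specialize (H _ Hs Hn).
  rewrite <- Ew, zalogz_Cexp, Ew in H by lra.
  specialize (Hd2 (exp L) 0). change ((exp L, 0) : C) with (RtoC (exp L)) in Hd2.
  assert (D : Cmod (r (RtoC (exp L)) - r 0) < eps / 2).
  { apply Hd2; unfold Re, Im; simpl.
    - rewrite Rminus_0_r, Rabs_right; lra.
    - rewrite Rminus_0_r, Rabs_R0; assumption. }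
  assert (Psm : Cmod (psi alpha (L, 0)) <= eps / 2).
  { eapply Rle_trans; [apply Cmod_psi; rewrite Rabs_R0; lra|]. apply HL0; assumption. }
  assert (Z0 : zalogz alpha 0 = 0).
  { unfold zalogz; destruct (Ceq_dec 0 0); [reflexivity|congruence]. }
  rewrite Z0.
  replace (r 0 - 0)%C with (- (r (RtoC (exp L)) - r 0) + (r (RtoC (exp L)) - psi alpha (L, 0%R)) + psi alpha (L, 0%R))%C
    by ring.
  eapply Rle_trans; [apply Cmod_triangle|].
  eapply Rle_trans; [apply Rplus_le_compat_r, Cmod_triangle|]. rewrite Cmod_opp. lra.
Qed.

(** * Rates of convergence *)

(** The last node must lie beyond C0, so that all prescribed poles are nodes, and beyond 2, so that the
    circle surrounds the unit disc with a margin. *)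
Lemma node_count (sigma C0 : R) : 0 < sigma -> 0 < C0 ->
  exists Rb mu, 0 <= mu /\ forall N1 : nat, exists (M : nat) (Vr : R),
    vstart sigma < Vr /\ Vr ^ 2 = sigma ^ 2 * (INR M + 1 / 2) /\
    ln 2 <= ln C0 - sigma * sqrt (INR N1) + Vr <= Rb /\ (N1 < M)%nat /\
    sigma * sqrt (INR N1) <= Vr /\ INR M <= (sqrt (INR N1) + mu) ^ 2 + 1.
Proof.
  intros Hs HC0.
  set (R0 := Rmax 2 C0). assert (HR0 : 2 <= R0 /\ C0 <= R0) by (split; [apply Rmax_l|apply Rmax_r]).
  set (mu := (ln R0 - ln C0) / sigma).
  assert (Hmu : 0 <= mu).
  { unfold mu; apply le_div; [assumption|]. rewrite Rmult_0_l.
    assert (ln C0 <= ln R0) by (apply ln_le; lra). lra. }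
  exists (ln R0 + 2 * sigma), mu; split; [assumption|].
  intros N1. pose proof (sqrt_pos (INR N1)) as HT. set (T := sqrt (INR N1)) in *.
  set (X := T + mu). assert (HX : 0 <= X) by (unfold X; lra).
  destruct (archimed (X ^ 2)) as [A1 A2].
  assert (HX2 : 0 <= X ^ 2) by apply pow2_ge_0.
  assert (Hup : (0 <= up (X ^ 2))%Z) by (apply le_IZR; lra).
  set (M := Z.to_nat (up (X ^ 2))).
  assert (EM : INR M = IZR (up (X ^ 2))) by (unfold M; rewrite INR_IZR_INZ, Z2Nat.id by assumption; reflexivity).
  assert (HNM : (N1 < M)%nat).
  { apply INR_lt. rewrite EM. apply Rle_lt_trans with (X ^ 2); [|lra].
    rewrite <- (sqrt_sqrt (INR N1)) by apply pos_INR. fold T. unfold X. nra. }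
  exists M, (sigma * sqrt (INR M + 1 / 2)).
  pose proof (pos_INR M) as HM0.
  assert (Hq1 : X <= sqrt (INR M + 1 / 2)).
  { rewrite <- (sqrt_pow2 X) at 1 by assumption. apply sqrt_le_1_alt. lra. }
  assert (Hq2 : sqrt (INR M + 1 / 2) <= X + 2).
  { rewrite <- (sqrt_pow2 (X + 2)) by lra. apply sqrt_le_1_alt. nra. }
  assert (EX : ln C0 - sigma * T + sigma * X = ln R0) by (unfold X, mu; field; lra).
  repeat split.
  - unfold vstart. apply Rmult_lt_compat_l; [assumption|]. apply sqrt_lt_1_alt.
    assert (1 <= INR M) by (apply (le_INR 1); lia). lra.
  - replace ((sigma * sqrt (INR M + 1 / 2)) ^ 2) with (sigma ^ 2 * (sqrt (INR M + 1 / 2) * sqrt (INR M + 1 / 2))) by ring.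
    rewrite sqrt_sqrt by lra. reflexivity.
  - apply Rle_trans with (ln R0); [apply ln_le; lra|].
    assert (sigma * X <= sigma * sqrt (INR M + 1 / 2)) by (apply Rmult_le_compat_l; lra). lra.
  - assert (sigma * sqrt (INR M + 1 / 2) <= sigma * (X + 2)) by (apply Rmult_le_compat_l; lra). lra.
  - assumption.
  - apply Rmult_le_compat_l; [lra|]. unfold X in Hq1; lra.
  - rewrite EM. fold X. lra.
Qed.

Lemma one_plus_le_exp g t : 0 < g -> 0 <= t -> 1 + t <= (1 + / g) * exp (g * t).
Proof.
  intros Hg Ht. assert (0 < / g) by (apply Rinv_0_lt_compat; assumption).
  pose proof (exp_ineq1_le (g * t)) as E.
  assert (0 <= g * t) by (apply Rmult_le_pos; lra).
  assert ((1 + / g) * (1 + g * t) <= (1 + / g) * exp (g * t)) by (apply Rmult_le_compat_l; lra).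
  assert (/ g * (g * t) = t) by (field; lra). nra.
Qed.

(** The error of the scheme, in terms of T = sqrt N1. *)
Definition rate (alpha beta sigma T : R) : R :=
  if Rle_dec alpha (decay sigma * gap beta)
  then (Rabs (jumplog alpha) * T + 1) * exp (- (sigma * alpha * T))
  else exp (- (decay sigma * gap beta * sigma * T)).

Lemma rate_pos alpha beta sigma T : 0 <= T -> 0 < rate alpha beta sigma T.
Proof.
  intros HT; unfold rate; destruct Rle_dec; [|apply exp_pos].
  apply Rmult_lt_0_compat; [|apply exp_pos].
  pose proof (Rmult_le_pos _ _ (Rabs_pos (jumplog alpha)) HT); lra.
Qed.

Lemma rate_lower alpha beta sigma T : 0 < sigma -> 0 <= T -> exp (- (sigma * alpha * T)) <= rate alpha beta sigma T.
Proof.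
  intros Hs HT; unfold rate; destruct Rle_dec as [H|H].
  - pose proof (Rmult_le_pos _ _ (Rabs_pos (jumplog alpha)) HT).
    pose proof (exp_pos (- (sigma * alpha * T))). nra.
  - apply exp_mono. apply Ropp_le_contravar.
    replace (decay sigma * gap beta * sigma * T) with (sigma * (decay sigma * gap beta) * T) by ring.
    apply Rmult_le_compat_r; [assumption|]. apply Rmult_le_compat_l; lra.
Qed.

(** The two hypotheses on the scale made by [quadrature], for Bd a multiple of the rate. The jump at the
    left end is at most of order e^(alpha l) (a T + 1), where a = 0 for integer alpha, and between the ends exp ((alpha - decay * gap) x) is monotone. *)
Lemma size_rate (alpha beta sigma C0 Rb : R) : 0 < alpha -> 0 <= beta < 2 -> 0 < sigma ->
  exists K, 0 < K /\ forall T Vr, let l := ln C0 - sigma * T in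
    0 <= T -> sigma * T <= Vr -> 0 <= l + Vr <= Rb ->
    phisize alpha (l + vstart sigma) <= K * rate alpha beta sigma T /\
    (forall x, vstart sigma <= x <= Vr ->
       phisize alpha (l + x) * exp (- (decay sigma * x * gap beta)) <= K * rate alpha beta sigma T).
Proof.
  intros Ha Hb Hs.
  pose proof (vstart_pos sigma Hs) as Hv0. pose proof (decay_pos sigma Hs) as Hk. pose proof (gap_bounds beta Hb) as Hh.
  set (G := Rabs (ln C0) + vstart sigma + Rabs Rb + 3 + sigma).
  pose proof (Rabs_pos (ln C0)) as P1; pose proof (Rabs_pos Rb) as P2.
  pose proof (jumplog_le_1 alpha) as A1; pose proof (Rabs_pos (jumplog alpha)) as A0.
  set (a := Rabs (jumplog alpha)) in *.
  assert (HG : 0 < G) by (unfold G; lra).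
  set (E0 := exp (alpha * (ln C0 + vstart sigma))). assert (HE0 : 0 < E0) by apply exp_pos.
  set (EC := exp (alpha * ln C0)). assert (HEC : 0 < EC) by apply exp_pos.
  (* On the whole scale |w| is at most a constant plus sigma * T. *)
  assert (Br : forall T w, 0 <= T -> Rabs w <= Rabs (ln C0) + vstart sigma + Rabs Rb + sigma * T ->
     a * Rabs w + 3 <= G * (a * T + 1)).
  { intros T w HT Hw.
    assert (a * Rabs w <= a * (Rabs (ln C0) + vstart sigma + Rabs Rb + sigma * T)) by (apply Rmult_le_compat_l; lra).
    assert (0 <= a * T) by (apply Rmult_le_pos; lra).
    assert (a * (Rabs (ln C0) + vstart sigma + Rabs Rb) <= 1 * (Rabs (ln C0) + vstart sigma + Rabs Rb))
      by (apply Rmult_le_compat_r; lra).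
    assert (0 <= (G - sigma) * (a * T)) by (apply Rmult_le_pos; [unfold G; lra|assumption]).
    unfold G in *. lra. }
  assert (Bw0 : forall T, 0 <= T -> Rabs (ln C0 - sigma * T + vstart sigma) <= Rabs (ln C0) + vstart sigma + Rabs Rb + sigma * T).
  { intros T HT. assert (0 <= sigma * T) by (apply Rmult_le_pos; lra).
    pose proof (Rle_abs (ln C0)); pose proof (Rle_abs (- ln C0)). rewrite Rabs_Ropp in *.
    apply Rabs_le; lra. }
  assert (S0 : forall T, 0 <= T -> phisize alpha (ln C0 - sigma * T + vstart sigma) <=
     E0 * G * ((a * T + 1) * exp (- (sigma * alpha * T)))).
  { intros T HT; unfold phisize; fold a.
    replace (exp (alpha * (ln C0 - sigma * T + vstart sigma))) with (E0 * exp (- (sigma * alpha * T)))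
      by (unfold E0; rewrite <- exp_plus; f_equal; ring).
    pose proof (exp_pos (- (sigma * alpha * T))) as Pe.
    replace (E0 * G * ((a * T + 1) * exp (- (sigma * alpha * T)))) with
      (E0 * exp (- (sigma * alpha * T)) * (G * (a * T + 1))) by ring.
    apply Rmult_le_compat_l; [apply Rmult_le_pos; lra|]. apply Br; [assumption|]. apply Bw0; assumption. }
  destruct (Rle_dec alpha (decay sigma * gap beta)) as [C|C].
  (* Here exp ((alpha - decay * gap) * x) is at most 1, so the left end is the worst. *)
  - exists (E0 * G + EC * G); split; [nra|].
    intros T Vr l HT HVr Hl. unfold rate; destruct (Rle_dec alpha (decay sigma * gap beta)); [|contradiction].
    set (e := exp (- (sigma * alpha * T))) in *. assert (He : 0 < e) by apply exp_pos. fold a.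
    assert (HaT : 0 <= a * T) by (apply Rmult_le_pos; lra).
    assert (Hq : 0 <= (a * T + 1) * e) by (apply Rmult_le_pos; lra).
    split.
    + eapply Rle_trans; [apply S0; assumption|]. fold e.
      apply Rmult_le_compat_r; [assumption|]. assert (0 < EC * G) by nra. lra.
    + intros x Hx. apply Rle_trans with (EC * G * ((a * T + 1) * e)).
      2:{ apply Rmult_le_compat_r; [assumption|]. assert (0 < E0 * G) by nra. lra. }
      unfold phisize; fold a.
      replace (exp (alpha * (l + x)) * (a * Rabs (l + x) + 3) * exp (- (decay sigma * x * gap beta))) with
        (EC * e * exp (- ((decay sigma * gap beta - alpha) * x)) * (a * Rabs (l + x) + 3)).
      2:{ unfold EC, e, l. 
          replace (exp (alpha * (ln C0 - sigma * T + x)) * (a * Rabs (ln C0 - sigma * T + x) + 3) * exp (- (decay sigma * x * gap beta)))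
            with (exp (alpha * (ln C0 - sigma * T + x)) * exp (- (decay sigma * x * gap beta)) * (a * Rabs (ln C0 - sigma * T + x) + 3)) by ring.
          f_equal. rewrite <- !exp_plus. f_equal; ring. }
      assert (X1 : exp (- ((decay sigma * gap beta - alpha) * x)) <= 1).
      { rewrite <- exp_0; apply exp_mono.
        assert (0 <= (decay sigma * gap beta - alpha) * x) by (apply Rmult_le_pos; lra). lra. }
      assert (X2 : a * Rabs (l + x) + 3 <= G * (a * T + 1)).
      { apply Br; [assumption|].
        assert (0 <= sigma * T) by (apply Rmult_le_pos; lra).
        pose proof (Rle_abs (ln C0)); pose proof (Rle_abs (- ln C0)). rewrite Rabs_Ropp in *.
        pose proof (Rle_abs Rb).
        apply Rabs_le; unfold l in *; lra. }
      assert (X3 : 0 <= a * Rabs (l + x) + 3).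
      { pose proof (Rmult_le_pos _ _ A0 (Rabs_pos (l + x))); lra. }
      replace (EC * G * ((a * T + 1) * e)) with (EC * e * 1 * (G * (a * T + 1))) by ring.
      pose proof (exp_pos (- ((decay sigma * gap beta - alpha) * x))).
      apply Rmult_le_compat; [|assumption| |assumption].
      * apply Rmult_le_pos; [apply Rmult_le_pos|]; lra.
      * apply Rmult_le_compat_l; [apply Rmult_le_pos; lra|assumption].
  (* Here the same exponential is largest at the right end x = Vr; the excess g absorbs all
     polynomial factors. *)
  - apply Rnot_le_lt in C. set (g := alpha - decay sigma * gap beta). assert (Hg : 0 < g) by (unfold g; lra).
    assert (Hgs : 0 < g * sigma) by (apply Rmult_lt_0_compat; lra).
    assert (Hig : 0 < / g) by (apply Rinv_0_lt_compat; assumption).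
    assert (Higs : 0 < / (g * sigma)) by (apply Rinv_0_lt_compat; assumption).
    set (K1 := E0 * G * (1 + / (g * sigma))). set (K2 := exp (alpha * Rabs Rb) * ((Rabs Rb + 3) * (1 + / g))).
    assert (HK1 : 0 < K1) by (unfold K1; apply Rmult_lt_0_compat; [nra|lra]).
    assert (HK2 : 0 < K2).
    { unfold K2; apply Rmult_lt_0_compat; [apply exp_pos|]. apply Rmult_lt_0_compat; lra. }
    exists (K1 + K2); split; [lra|].
    intros T Vr l HT HVr Hl. unfold rate; destruct (Rle_dec alpha (decay sigma * gap beta)); [lra|].
    set (e := exp (- (decay sigma * gap beta * sigma * T))) in *. assert (He : 0 < e) by apply exp_pos.
    split.
    + eapply Rle_trans; [apply S0; assumption|].
      apply Rle_trans with (K1 * e); [|apply Rmult_le_compat_r; lra].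
      unfold K1. rewrite (Rmult_assoc (E0 * G)).
      apply Rmult_le_compat_l; [apply Rmult_le_pos; lra|].
      assert (X1 : a * T + 1 <= (1 + / (g * sigma)) * exp (g * sigma * T)).
      { apply Rle_trans with (1 + T); [nra|]. apply one_plus_le_exp; assumption. }
      apply Rle_trans with ((1 + / (g * sigma)) * exp (g * sigma * T) * exp (- (sigma * alpha * T))).
      * apply Rmult_le_compat_r; [left; apply exp_pos|exact X1].
      * apply Req_le. rewrite Rmult_assoc, <- exp_plus. unfold e. do 2 f_equal. unfold g; ring.
    + intros x Hx. apply Rle_trans with (K2 * e); [|apply Rmult_le_compat_r; lra].
      set (t := Vr - x). assert (Ht : 0 <= t) by (unfold t; lra).
      unfold phisize; fold a.
      assert (X1 : a * Rabs (l + x) + 3 <= (Rabs Rb + 3) * (1 + t)).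
      { assert (Rabs (l + x) <= Rabs Rb + t).
        { pose proof (Rle_abs Rb). apply Rabs_le; unfold t in *; lra. }
        assert (a * Rabs (l + x) <= 1 * (Rabs Rb + t)).
        { apply Rmult_le_compat; try lra. apply Rabs_pos. }
        nra. }
      pose proof (one_plus_le_exp g t Hg Ht) as X2.
      replace (exp (alpha * (l + x)) * (a * Rabs (l + x) + 3) * exp (- (decay sigma * x * gap beta))) with
        (exp (alpha * (l + Vr)) * exp (- (decay sigma * gap beta * Vr)) * exp (- (g * t)) * (a * Rabs (l + x) + 3)).
      2:{ replace (exp (alpha * (l + x)) * (a * Rabs (l + x) + 3) * exp (- (decay sigma * x * gap beta)))
            with (exp (alpha * (l + x)) * exp (- (decay sigma * x * gap beta)) * (a * Rabs (l + x) + 3)) by ring.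
          f_equal. rewrite <- !exp_plus. f_equal; unfold g, t; ring. }
      assert (X3 : exp (alpha * (l + Vr)) <= exp (alpha * Rabs Rb)).
      { apply exp_mono, Rmult_le_compat_l; [lra|]. pose proof (Rle_abs Rb); lra. }
      assert (X4 : exp (- (decay sigma * gap beta * Vr)) <= e).
      { unfold e; apply exp_mono, Ropp_le_contravar. rewrite Rmult_assoc.
        apply Rmult_le_compat_l; [apply Rmult_le_pos|]; lra. }
      assert (X5 : exp (- (g * t)) * (a * Rabs (l + x) + 3) <= (Rabs Rb + 3) * (1 + / g)).
      { apply Rle_trans with (exp (- (g * t)) * ((Rabs Rb + 3) * ((1 + / g) * exp (g * t)))).
        - apply Rmult_le_compat_l; [left; apply exp_pos|].
          eapply Rle_trans; [exact X1|]. apply Rmult_le_compat_l; lra.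
        - apply Req_le. rewrite exp_Ropp. field. split; [lra|]. pose proof (exp_pos (g * t)); lra. }
      assert (X6 : 0 <= a * Rabs (l + x) + 3).
      { pose proof (Rmult_le_pos _ _ A0 (Rabs_pos (l + x))); lra. }
      pose proof (exp_pos (alpha * (l + Vr))); pose proof (exp_pos (- (decay sigma * gap beta * Vr))).
      pose proof (exp_pos (- (g * t))).
      rewrite (Rmult_assoc (exp (alpha * (l + Vr)) * exp (- (decay sigma * gap beta * Vr)))).
      unfold K2. replace (exp (alpha * Rabs Rb) * ((Rabs Rb + 3) * (1 + / g)) * e) with
        (exp (alpha * Rabs Rb) * e * ((Rabs Rb + 3) * (1 + / g))) by ring.
      apply Rmult_le_compat; [| |apply Rmult_le_compat; lra|exact X5].
      * apply Rmult_le_pos; lra.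
      * apply Rmult_le_pos; lra.
Qed.

Lemma sqrt_ceil (N1 : nat) : exists m : nat, sqrt (INR N1) <= INR m <= sqrt (INR N1) + 1.
Proof.
  pose proof (sqrt_pos (INR N1)) as HT. destruct (archimed (sqrt (INR N1))) as [A1 A2].
  assert (Hup : (0 <= up (sqrt (INR N1)))%Z) by (apply le_IZR; lra).
  exists (Z.to_nat (up (sqrt (INR N1)))).
  rewrite (INR_IZR_INZ (Z.to_nat _)), Z2Nat.id by assumption. lra.
Qed.

(** The polynomials have degree proportional to sqrt N1, with a factor large enough to make their errors
    smaller than exp (- sigma alpha sqrt N1). *)
Lemma scheme (alpha beta sigma C0 : R) : 0 < alpha -> 0 <= beta < 2 -> 0 < sigma -> 0 < C0 ->
  exists (a : nat -> nat -> C) (N2 : nat -> nat) (P : nat -> C -> C) (K K2 : R), 0 < K /\ 0 < K2 /\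
    forall N1 : nat, polynomial_of_degree (N2 N1) (P N1) /\
      INR (N2 N1) <= K2 * (sqrt (INR N1) + 1) /\
      forall z, sector beta z ->
        Cmod (rational_approx N1 (pole C0 sigma N1) (a N1) (P N1) z - zalogz alpha z)
          <= K * rate alpha beta sigma (sqrt (INR N1)).
Proof.
  intros Ha Hb Hs HC0.
  destruct (node_count sigma C0 Hs HC0) as [Rb [mu [Hmu HM]]].
  destruct (approximants alpha beta sigma C0 Rb Ha Hb Hs HC0) as [KA [D [rho1 [HKA [HD [Hrho HA]]]]]].
  destruct (size_rate alpha beta sigma C0 Rb Ha Hb Hs) as [KS [HKS HS]].
  assert (Hl2 : 0 < ln 2) by (rewrite <- ln_1; apply ln_increasing; lra).
  (* The exponent exceeds sigma * alpha by 2 to pay for the O(T ^ 2) nodes. *)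
  destruct (pow_small rho1 (exp (- (sigma * alpha + 2))) ltac:(lra) (exp_pos _)) as [k Hk].
  destruct (functional_choice _ sqrt_ceil) as [m Hm].
  set (KM := (1 + mu) ^ 2 + 1). assert (HKM : 0 < KM) by (unfold KM; pose proof (pow2_ge_0 (1 + mu)); lra).
  set (N2 := fun N1 => (D * (k * m N1))%nat).
  assert (Hex : forall N1 : nat, exists aP : (nat -> C) * (C -> C),
    polynomial_of_degree (N2 N1) (snd aP) /\ forall z, sector beta z ->
      Cmod (rational_approx N1 (pole C0 sigma N1) (fst aP) (snd aP) z - zalogz alpha z)
          <= (KA * (KS + KM) + 1) * rate alpha beta sigma (sqrt (INR N1))).
  { intros N1. pose proof (sqrt_pos (INR N1)) as HT. set (T := sqrt (INR N1)) in *.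
    destruct (HM N1) as [M [Vr [V1 [V2 [V3 [V4 [V5 V6]]]]]]]. fold T in V3, V5, V6.
    pose proof (rate_pos alpha beta sigma T HT) as Hrp.
    pose proof (rate_lower alpha beta sigma T Hs HT) as Hrl.
    set (rt := rate alpha beta sigma T) in *.
    set (Bd := (KS + KM) * rt).
    assert (HBd : 0 < Bd) by (unfold Bd; apply Rmult_lt_0_compat; lra).
    destruct (HS T Vr HT V5 ltac:(lra)) as [T1 T3]. fold rt in T1, T3.
    assert (HKSB : KS * rt <= Bd) by (unfold Bd; apply Rmult_le_compat_r; lra).
    assert (HKMB : KM * exp (- (sigma * alpha * T)) <= Bd).
    { unfold Bd. apply Rle_trans with (KM * rt); [apply Rmult_le_compat_l; lra|].
      apply Rmult_le_compat_r; lra. }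
    assert (HMn : INR M * rho1 ^ (k * m N1) <= Bd).
    { eapply Rle_trans; [|exact HKMB].
      assert (B1 : INR M <= KM * exp (2 * T)).
      { eapply Rle_trans; [exact V6|].
        pose proof (exp_ineq1_le T) as E. 
        replace (exp (2 * T)) with (exp T * exp T) by (rewrite <- exp_plus; f_equal; ring).
        assert (E2 : (1 + T) * (1 + T) <= exp T * exp T) by (apply Rmult_le_compat; lra).
        unfold KM.
        assert (E3 : (T + mu) ^ 2 <= (1 + mu) ^ 2 * ((1 + T) * (1 + T))).
        { replace ((1 + mu) ^ 2 * ((1 + T) * (1 + T))) with (((1 + mu) * (1 + T)) ^ 2) by ring.
          apply pow_incr. nra. }
        assert (E4 : (1 + mu) ^ 2 * ((1 + T) * (1 + T)) <= (1 + mu) ^ 2 * (exp T * exp T))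
          by (apply Rmult_le_compat_l; [apply pow2_ge_0|assumption]).
        nra. }
      assert (B2 : rho1 ^ (k * m N1) <= exp (- ((sigma * alpha + 2) * T))).
      { rewrite pow_mult. apply Rle_trans with (exp (- (sigma * alpha + 2)) ^ m N1).
        - apply pow_incr; split; [apply pow_le; lra|assumption].
        - assert (Ep : forall n, exp (- (sigma * alpha + 2)) ^ n = exp (- ((sigma * alpha + 2) * INR n))).
          { intros n; induction n as [|n IH].
            - simpl. rewrite Rmult_0_r, Ropp_0, exp_0; reflexivity.
            - rewrite S_INR. simpl. rewrite IH, <- exp_plus. f_equal; ring. }
          rewrite Ep. apply exp_mono, Ropp_le_contravar.
          apply Rmult_le_compat_l; [nra|]. apply (Hm N1). }
      apply Rle_trans with (KM * exp (2 * T) * exp (- ((sigma * alpha + 2) * T))).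
      - apply Rmult_le_compat; try assumption; [apply pos_INR|apply pow_le; lra].
      - rewrite Rmult_assoc, <- exp_plus. apply Req_le. do 2 f_equal. ring. }
    destruct (HA N1 (k * m N1)%nat M Vr Bd) as [a [P [HP Herr]]]; try assumption.
    { fold T. lra. }
    { intros x Hx. fold T. eapply Rle_trans; [apply T3; assumption|assumption]. }
    destruct (isPoly_exact (N2 N1) P rt HP Hrp) as [P' [HP1 HP2]].
    exists (a, P'); split; [exact HP1|]. simpl fst; simpl snd. intros z Hz.
    pose proof (extend_zero alpha beta C0 sigma N1 _ a P _ Ha (proj1 Hb) HC0 HP Herr z Hz) as Hz1.
    specialize (HP2 z (sector_le_1 beta z Hz)).
    replace (rational_approx N1 (pole C0 sigma N1) a P' z - zalogz alpha z)%C with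
      ((rational_approx N1 (pole C0 sigma N1) a P z - zalogz alpha z) + (P' z - P z))%C
      by (unfold rational_approx; ring).
    eapply Rle_trans; [apply Cmod_triangle|]. fold rt. unfold Bd in Hz1. lra. }
  destruct (functional_choice _ Hex) as [aP HaP].
  exists (fun N1 => fst (aP N1)), N2, (fun N1 => snd (aP N1)), (KA * (KS + KM) + 1), (INR (D * k) + 1).
  split; [|split].
  - assert (0 < KA * (KS + KM)) by (apply Rmult_lt_0_compat; lra). lra.
  - pose proof (pos_INR (D * k)); lra.
  - intros N1; destruct (HaP N1) as [H1 H2]. split; [exact H1|split; [|exact H2]].
    unfold N2. rewrite Nat.mul_assoc, mult_INR.
    destruct (Hm N1) as [M1 M2]. pose proof (pos_INR (D * k)); pose proof (pos_INR (m N1)).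
    apply Rmult_le_compat; lra.
Qed.

(** decay * gap = alpha (sigma_opt / sigma)^2. *)
Lemma sigma_opt_iff alpha beta sigma : 0 < alpha -> 0 <= beta < 2 -> 0 < sigma ->
  (sigma <= PI * sqrt (2 * (2 - beta)) / sqrt alpha <-> alpha <= decay sigma * gap beta).
Proof.
  intros Ha Hb Hs. pose proof PI_RGT_0 as HP.
  assert (Hsa : 0 < sqrt alpha) by (apply sqrt_lt_R0; assumption).
  assert (Hsb : 0 < sqrt (2 * (2 - beta))) by (apply sqrt_lt_R0; lra).
  assert (Ea : sqrt alpha * sqrt alpha = alpha) by (apply sqrt_sqrt; lra).
  assert (Eb : sqrt (2 * (2 - beta)) * sqrt (2 * (2 - beta)) = 2 * (2 - beta)) by (apply sqrt_sqrt; lra).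
  set (p := sqrt alpha) in *. set (q := sqrt (2 * (2 - beta))) in *.
  assert (E : decay sigma * gap beta = (PI * q) * (PI * q) / (sigma * sigma)).
  { unfold decay, gap. replace (PI * q * (PI * q)) with (PI * PI * (q * q)) by ring.
    rewrite Eb. field; lra. }
  rewrite E.
  assert (Hss : 0 < sigma * sigma) by (apply Rmult_lt_0_compat; assumption).
  assert (Hpq : 0 < PI * q) by (apply Rmult_lt_0_compat; assumption).
  split; intros H.
  - apply le_div; [assumption|]. apply Rle_div_r in H; [|assumption].
    rewrite <- Ea. replace (p * p * (sigma * sigma)) with ((sigma * p) * (sigma * p)) by ring.
    assert (0 < sigma * p) by (apply Rmult_lt_0_compat; assumption).
    apply Rmult_le_compat; lra.
  - apply le_div; [assumption|]. apply Rle_div_r in H; [|assumption].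
    apply Rsqr_incr_0_var; [|lra]. unfold Rsqr.
    replace (sigma * p * (sigma * p)) with (p * p * (sigma * sigma)) by ring. rewrite Ea. exact H.
Qed.

Lemma quadrature_exponent alpha beta sigma x : 0 < alpha -> 0 <= beta < 2 -> 0 < sigma -> 0 <= x ->
  PI * (PI * sqrt (2 * (2 - beta)) / sqrt alpha / sigma) * sqrt (2 * (2 - beta) * x * alpha) =
  decay sigma * gap beta * sigma * sqrt x.
Proof.
  intros Ha Hb Hs Hx.
  assert (Hsa : 0 < sqrt alpha) by (apply sqrt_lt_R0; assumption).
  assert (Eb : sqrt (2 * (2 - beta)) * sqrt (2 * (2 - beta)) = 2 * (2 - beta)) by (apply sqrt_sqrt; lra).
  rewrite !sqrt_mult by (try lra; apply Rmult_le_pos; lra). rewrite <- sqrt_mult by lra.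
  set (q := sqrt (2 * (2 - beta))) in *.
  unfold decay, gap.
  transitivity (PI * PI * (q * q) / sigma * sqrt x); [field; lra|].
  rewrite Eb. field; lra.
Qed.

(** As N2 = O(sqrt N1), sqrt N exceeds sqrt N1 by a bounded quantity only. *)
Lemma sqrt_total (N1 N2 : nat) K2 : (1 <= N1)%nat -> 0 < K2 ->
  INR N2 <= K2 * (sqrt (INR N1) + 1) ->
  1 <= sqrt (INR N1) <= sqrt (INR (N1 + N2)) /\ sqrt (INR (N1 + N2)) <= sqrt (INR N1) + K2.
Proof.
  intros H1 HK H2.
  assert (HT : 1 <= sqrt (INR N1)).
  { rewrite <- sqrt_1. apply sqrt_le_1_alt. apply (le_INR 1); assumption. }
  pose proof (pos_INR N1); pose proof (pos_INR N2).
  rewrite plus_INR. repeat split.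
  - assumption.
  - apply sqrt_le_1_alt. lra.
  - rewrite <- (sqrt_pow2 (sqrt (INR N1) + K2)) by lra. apply sqrt_le_1_alt.
    assert (E : sqrt (INR N1) * sqrt (INR N1) = INR N1) by (apply sqrt_sqrt; assumption).
    assert (0 <= K2 * K2) by nra.
    assert (K2 <= K2 * sqrt (INR N1)) by nra.
    replace ((sqrt (INR N1) + K2) ^ 2) with (sqrt (INR N1) * sqrt (INR N1) + 2 * (K2 * sqrt (INR N1)) + K2 * K2) by ring.
    lra.
Qed.

Lemma exp_transfer c T U K : 0 <= c -> U <= T + K -> exp (- (c * T)) <= exp (c * K) * exp (- (c * U)).
Proof. intros Hc H; rewrite <- exp_plus; apply exp_mono. nra. Qed.

Lemma sin_PI_nat m : sin (PI * INR m) = 0.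
Proof.
  apply sin_eq_0_1. exists (Z.of_nat m). rewrite <- INR_IZR_INZ. ring.
Qed.

Theorem theorem1p2 (alpha beta C0 sigma : R)
    (halpha : 0 < alpha) (hbeta : 0 <= beta < 2)
    (hC0 : 0 < C0) (hsigma : 0 < sigma) :
  let sigma_opt := PI * sqrt (2 * (2 - beta)) / sqrt alpha in
  let eta := sigma_opt / sigma in
  exists (a : nat -> nat -> C) (N2 : nat -> nat) (P : nat -> C -> C),
    let N := fun N1 : nat => (N1 + N2 N1)%nat in
    let r := fun N1 : nat =>
      rational_approx N1 (pole C0 sigma N1) (a N1) (P N1) in
    let err := fun (N1 : nat) (z : C) => Cmod (r N1 z - zalogz alpha z)%C in
    (forall N1 : nat, polynomial_of_degree (N2 N1) (P N1)) /\
    bigO (fun N1 => INR (N2 N1)) (fun N1 => sqrt (INR N1)) /\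
    (sigma <= sigma_opt ->
      uniform_bigO N (S_ beta) err
        (fun x => sqrt x * exp (- (sigma * alpha * sqrt x)))) /\
    (sigma_opt < sigma ->
      uniform_bigO N (S_ beta) err
        (fun x => exp (- (PI * eta * sqrt (2 * (2 - beta) * x * alpha))))) /\
    ((exists m : nat, (0 < m)%nat /\ alpha = INR m) ->
      (sigma <= sigma_opt ->
        uniform_bigO N (S_ beta) err
          (fun x => exp (- (sigma * alpha * sqrt x)))) /\
      (sigma_opt < sigma ->
        uniform_bigO N (S_ beta) err
          (fun x => exp (- (PI * eta * sqrt (2 * (2 - beta) * x * alpha)))))).
Proof.
  intros sigma_opt eta.
  destruct (scheme alpha beta sigma C0 halpha hbeta hsigma hC0)
    as [a [N2 [P [K [K2 [HK [HK2 H]]]]]]].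
  exists a, N2, P. intros N r err.
  pose proof (sigma_opt_iff alpha beta sigma halpha hbeta hsigma) as Hopt. fold sigma_opt in Hopt.
  pose proof (decay_pos sigma hsigma) as Hk. pose proof (gap_bounds beta hbeta) as Hh.
  assert (Hdeg : forall N1, polynomial_of_degree (N2 N1) (P N1)) by (intros N1; apply H).
  (* Passing from sqrt N1 to sqrt N costs the constant factor exp (c * K2). The threshold S (N2 0)
     excludes N1 = 0. *)
  assert (Htr : forall (g : R -> R) (w : R -> R) (c K3 : R), 0 <= c -> 0 <= K3 ->
     (forall N1, rate alpha beta sigma (sqrt (INR N1)) = w (sqrt (INR N1)) * exp (- (c * sqrt (INR N1)))) ->
     (forall T x, 1 <= T <= sqrt x -> 0 <= x -> 0 <= w T /\ w T * exp (- (c * sqrt x)) <= K3 * Rabs (g x)) ->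
     uniform_bigO N (S_ beta) err g).
  { intros g w c K3 Hc HK3 Hr Hw.
    exists (K * (exp (c * K2) * K3)), (S (N2 O)). intros N1 HN z Hz.
    assert (H1 : (1 <= N1)%nat) by (destruct N1; [unfold N in HN; lia|lia]).
    destruct (H N1) as [_ [H2 H3]].
    destruct (sqrt_total N1 (N2 N1) K2 H1 HK2 H2) as [S1 S2].
    specialize (H3 z (S_sector beta z Hz)).
    unfold err, r. rewrite Rabs_right by (apply Rle_ge, Cmod_ge_0).
    eapply Rle_trans; [exact H3|]. rewrite Rmult_assoc. apply Rmult_le_compat_l; [lra|].
    rewrite Hr. unfold N.
    destruct (Hw _ _ S1 (pos_INR _)) as [W1 W2].
    set (U := sqrt (INR (N1 + N2 N1))) in *. set (T := sqrt (INR N1)) in *.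
    apply Rle_trans with (w T * (exp (c * K2) * exp (- (c * U)))).
    - apply Rmult_le_compat_l; [assumption|]. apply exp_transfer; assumption.
    - replace (w T * (exp (c * K2) * exp (- (c * U)))) with (exp (c * K2) * (w T * exp (- (c * U)))) by ring.
      rewrite Rmult_assoc. apply Rmult_le_compat_l; [left; apply exp_pos|exact W2]. }
  assert (Hbig : sigma_opt < sigma -> uniform_bigO N (S_ beta) err
        (fun x => exp (- (PI * eta * sqrt (2 * (2 - beta) * x * alpha))))).
  { intros Hlt. apply (Htr _ (fun _ => 1) (decay sigma * gap beta * sigma) 1).
    - apply Rmult_le_pos; [apply Rmult_le_pos|]; lra.
    - lra.
    - intros N1; unfold rate. destruct Rle_dec as [C|C]; [apply Hopt in C; lra|]. ring.
    - intros T x HT Hx; split; [lra|].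
      unfold eta, sigma_opt. rewrite quadrature_exponent by assumption.
      rewrite Rabs_right by (left; apply exp_pos). lra. }
  assert (Hsa : 0 <= sigma * alpha) by (apply Rmult_le_pos; lra).
  split; [exact Hdeg|split; [|split; [|split; [exact Hbig|]]]].
  - exists (2 * K2). exists 1%nat. intros N1 H1.
    destruct (H N1) as [_ [H2 _]].
    destruct (sqrt_total N1 (N2 N1) K2 H1 HK2 H2) as [[S1 _] _].
    rewrite !Rabs_right by (apply Rle_ge; try apply pos_INR; apply sqrt_pos).
    eapply Rle_trans; [exact H2|]. nra.
  - intros Hle. apply (Htr _ (fun T => Rabs (jumplog alpha) * T + 1) (sigma * alpha) 2); try assumption; try lra.
    + intros N1; unfold rate. destruct Rle_dec as [C|C]; [reflexivity|]. apply Hopt in Hle; contradiction.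
    + intros T x HT Hx.
      pose proof (jumplog_le_1 alpha); pose proof (Rabs_pos (jumplog alpha)).
      pose proof (exp_pos (- (sigma * alpha * sqrt x))).
      split; [nra|].
      rewrite (Rabs_right (sqrt x * _)) by (apply Rle_ge, Rmult_le_pos; lra).
      rewrite <- Rmult_assoc. apply Rmult_le_compat_r; [lra|]. nra.
  - intros [m [Hm Em]]. split; [|exact Hbig].
    intros Hle. apply (Htr _ (fun _ => 1) (sigma * alpha) 1); try assumption; try lra.
    + intros N1; unfold rate. destruct Rle_dec as [C|C]; [|apply Hopt in Hle; contradiction].
      assert (Ea : jumplog alpha = 0).
      { unfold jumplog. rewrite Em, sin_PI_nat. unfold Rdiv; ring. }
      rewrite Ea, Rabs_R0. ring.
    + intros T x HT Hx; split; [lra|]. rewrite Rabs_right by (left; apply exp_pos). lra.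
Qed.
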